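(* Let $D=D_h\subset\mathbb C^2$ be a balanced pseudoconvex domain with $h\not\equiv0$. Then the following are equivalent: (1) $K_D(0)>0$; (2) $K_D(z)>0$ for all $z\in D$; (3) $\mathcal L^4(D_h)<\infty$; (4) $\nu(\log h,[v])<1/2$ for all $[v]\in\mathbb P^1$.
   Context: A balanced domain is $D_h:=\{z\in\mathbb C^2:h(z)<1\}$ where $h:\mathbb C^2\to[0,\infty)$ is upper semicontinuous and homogeneous, i.e. $h(\lambda z)=|\lambda|h(z)$ for $\lambda\in\mathbb C$, $z\in\mathbb C^2$; $D_h$ is pseudoconvex iff $\log h$ is plurisubharmonic. $\mathcal L^4$ is Lebesgue measure on $\mathbb C^2$. $L_h^2(D):=L^2(D)\cap\mathcal O(D)$ with the $L^2$-norm $\|\cdot\|$, and the Bergman kernel on the diagonal is $K_D(z):=\sup\{|f(z)|^2: f\in L_h^2(D),\ \|f\|\le1\}$, $z\in D$. For a subharmonic function $u\not\equiv-\infty$ on a domain in $\mathbb C$ and a point $z_0$ of the domain, the Lelong number is $\nu(u,z_0):=\lim_{r\to0^+}\frac{\max_{|\lambda|=r}u(z_0+\lambda)}{\log r}$. For $[v]\in\mathbb P^1$ (complex projective line, $v=(v_1,v_2)\in\mathbb C^2\setminus\{0\}$) put $\nu(\log h,[v]):=\nu(\log h(\cdot,v_2),v_1)$ if $v_2\ne0$, and $\nu(\log h,[v]):=\nu(\log h(v_1,\cdot),v_2)$ if $v_1\neq 0$; this is well defined (independent of the representative and of which non-zero coordinate is used). *)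

(* Defs.v *)
From HB Require Import structures.
From mathcomp Require Import all_boot all_order all_algebra.
From mathcomp Require Import all_classical all_reals all_analysis.
From mathcomp Require Import complex.

Set Implicit Arguments.
Unset Strict Implicit.
Unset Printing Implicit Defensive.

Import Order.TTheory GRing.Theory Num.Theory.
Import numFieldNormedType.Exports.
Export numFieldNormedType.Exports.

Local Open Scope classical_set_scope.
Local Open Scope ring_scope.
Local Open Scope complex_scope.

(* [R[i]^o] carries the topology and the [normedModType R[i]] structure of
   the complex plane; [R[i]] alone carries neither. *)
Notation Cx R := (R[i]^o)%type.
Notation Cx2 R := ((R[i]^o * R[i]^o)%type).

Notation cabs := ComplexField.Normc.normc.

Definition upper_semicontinuous (X : topologicalType) (R : realType)
    (u : X -> \bar R) : Prop :=
  lower_semicontinuous (fun x => - u x)%E.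

(* An upper semicontinuous [u < +oo] is bounded above on circles, so that this
   mean is well defined in [-oo, +oo). *)
Definition circle_mean (R : realType) (u : Cx R -> \bar R) (a : Cx R) (r : R) :
    \bar R :=
  (((2 * pi)^-1)%:E * \int[@lebesgue_measure R]_(t in `[0%R, (2 * pi)%R])
     u (a + r%:C * (cos t +i* sin t))%R)%E.

(* [u = -oo] identically is allowed, both here and for [plurisubharmonic]. *)
Definition subharmonic (R : realType) (u : Cx R -> \bar R) : Prop :=
  [/\ forall z, (u z < +oo)%E,
      upper_semicontinuous u
    & forall (a : Cx R) (r : R), 0 < r -> (u a <= circle_mean u a r)%E].

Definition plurisubharmonic (R : realType) (u : Cx2 R -> \bar R) : Prop :=
  [/\ forall z, (u z < +oo)%E,
      upper_semicontinuous u
    & forall a b : Cx2 R, subharmonic (fun l : Cx R => u (a + l *: b))].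

Definition balanced_gauge (R : realType) (h : Cx2 R -> R) : Prop :=
  [/\ forall z, 0 <= h z,
      upper_semicontinuous (EFin \o h)
    & forall (l : Cx R) (z : Cx2 R), h (l *: z) = cabs l * h z].

Definition balanced_domain (R : realType) (h : Cx2 R -> R) : set (Cx2 R) :=
  [set z | h z < 1].

(* [lne] sends [0] to [-oo]. *)
Definition log_gauge (R : realType) (h : Cx2 R -> R) (z : Cx2 R) : \bar R :=
  lne (h z)%:E.

(* A balanced domain with gauge [h] is pseudoconvex iff [log h] is
   plurisubharmonic; this criterion is the definition used for such domains. *)
Definition balanced_pseudoconvex (R : realType) (h : Cx2 R -> R) : Prop :=
  plurisubharmonic (log_gauge h).

(* C^2 is identified with R^4 through real and imaginary parts, and Lebesgue
   measure on R^4 is the product of four copies of Lebesgue measure on R. *)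
Definition toC2 (R : realType) (p : (R * R) * (R * R)) : Cx2 R :=
  (p.1.1 +i* p.1.2, p.2.1 +i* p.2.2).

Definition lebesgue2 (R : realType) :
    set (measurableTypeR R * measurableTypeR R)%type -> \bar R :=
  (@lebesgue_measure R \x @lebesgue_measure R)%E.

HB.instance Definition _ (R : realType) := Measure.copy (@lebesgue2 R)
  ((@lebesgue_measure R \x @lebesgue_measure R)%E : {measure set _ -> \bar R}).

(* Canonical structure inference does not find the sigma-finiteness of a
   product of two sigma-finite measures, hence this explicit instance. *)
Lemma lebesgue2_sigma_finite (R : realType) :
  sigma_finite setT (@lebesgue2 R).
Proof.
have /sigma_finiteP[F [TF ndF Foo]] := sigma_finiteT (@lebesgue_measure R).
exists (fun n => F n `*` F n).
  rewrite -setXTT TF predeqE => -[x y]; split.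
    move=> [/= [n _ Fnx] [k _ Gky]]; exists (maxn n k) => //; split.
    - by move: x Fnx; exact/subsetPset/ndF/leq_maxl.
    - by move: y Gky; exact/subsetPset/ndF/leq_maxr.
  by move=> [n _ []/= ? ?]; split; exists n.
move=> k; have [mF Fk] := Foo k.
split; first exact: measurableX.
by rewrite /lebesgue2 product_measure1E// lte_mul_pinfty// ge0_fin_numE.
Qed.

HB.instance Definition _ (R : realType) := Measure_isSigmaFinite.Build _ _ _
  (@lebesgue2 R) (@lebesgue2_sigma_finite R).

Definition lebesgue4 (R : realType) :
    set ((measurableTypeR R * measurableTypeR R) *
         (measurableTypeR R * measurableTypeR R))%type -> \bar R :=
  (@lebesgue2 R \x @lebesgue2 R)%E.

HB.instance Definition _ (R : realType) := Measure.copy (@lebesgue4 R)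
  ((@lebesgue2 R \x @lebesgue2 R)%E : {measure set _ -> \bar R}).

Definition volume (R : realType) (A : set (Cx2 R)) : \bar R :=
  @lebesgue4 R (@toC2 R @^-1` A).

(* [differentiable] is taken over the scalars [R[i]]: the differential is
   required to be complex-linear. *)
Definition holomorphic (R : realType) (D : set (Cx2 R)) (f : Cx2 R -> Cx R) :
    Prop :=
  forall z, D z -> differentiable f z.

Definition L2norm (R : realType) (D : set (Cx2 R)) (f : Cx2 R -> Cx R) :
    \bar R :=
  'N[@lebesgue4 R]_(2%:E)[
    (fun p => (cabs (f (toC2 p)))%:E) \_ (@toC2 R @^-1` D)].

(* Functions are total; only their values on [D] matter.  A function
   holomorphic on an open [D] is continuous there, hence measurable on [D]. *)
Definition L2h (R : realType) (D : set (Cx2 R)) : set (Cx2 R -> Cx R) :=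
  [set f | holomorphic D f /\ (L2norm D f < +oo)%E].

Definition bergman_kernel (R : realType) (D : set (Cx2 R)) (z : Cx2 R) :
    \bar R :=
  ereal_sup [set (cabs (f z) ^+ 2)%:E | f in
    [set f : Cx2 R -> Cx R | L2h D f /\ (L2norm D f <= 1)%E]].

(* For subharmonic [u] this supremum is a maximum, by upper semicontinuity. *)
Definition circle_max (R : realType) (u : Cx R -> \bar R) (a : Cx R) (r : R) :
    \bar R :=
  ereal_sup [set u (a + l) | l in [set l : Cx R | cabs l = r]].

Definition lelong (R : realType) (u : Cx R -> \bar R) (z0 : Cx R) : \bar R :=
  lim ((circle_max u z0 r / (ln r)%:E)%E @[r --> (0 : R)^'+]).

(* The Lelong number at the point [[v]] of the projective line, for a
   representative [v != 0]. *)
Definition lelong_proj (R : realType) (h : Cx2 R -> R) (v : Cx2 R) : \bar R :=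
  if v.2 != 0 then lelong (fun l => log_gauge h (l, v.2)) v.1
  else lelong (fun l => log_gauge h (v.1, l)) v.2.

(* Main.v *)
(* Write D for the domain and h for its gauge.  A rotation average of a
   holomorphic function f over z |-> e^{it} z is f(0), by the mean value
   property on complex lines through 0; since D is invariant under rotations,
   this gives |f(0)|^2 vol(D) <= ||f||^2.  Hence K_D(0) > 0 bounds vol(D), and
   conversely the constants lie in L^2_h(D) once vol(D) is finite.

   If u = log h(., v2) has Lelong number at least 1/2 at v1, then
   h(w, v2)^2 <= C |w - v1| near v1, and by homogeneity the slice of D at height
   z2 contains a disc of radius c / |z2| for large z2.  Its area ~ |z2|^-2 is
   not integrable over the plane.

   If the Lelong number is less than 1/2, then V = - log h(., v2) is a
   nonnegative superharmonic function near v1 whose means over discs of radius r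
   are at most gam log (1/r) + const, with gam < 1/2.  Such a V satisfies
   area {V > gam log (1/r) + const} = O(r^2): V exceeds its mean by 1 there,
   while the total excess is O(r^2) because the disc means of a paraboloid
   differ from it by O(r^2).  With r = 2^-k and homogeneity, the volume of
   D inside a cone around [v1 : v2] is bounded by a geometric series of ratio
   2^(4 gam) / 4 < 1, and finitely many cones cover C^2 minus the origin. *)

Require Import Defs.
From HB Require Import structures.
From mathcomp Require Import all_boot all_order all_algebra.
From mathcomp Require Import all_classical all_reals all_analysis.
From mathcomp Require Import measurable_realfun complex.
From mathcomp Require Import ring lra.
Import Order.TTheory GRing.Theory Num.Theory.
Local Open Scope classical_set_scope.
Local Open Scope ring_scope.
Local Open Scope complex_scope.

Set Implicit Arguments.
Unset Strict Implicit.
Unset Printing Implicit Defensive.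

(** * The complex plane and its Lebesgue measure *)

(** Holomorphy is given only as complex differentiability, so the mean value property rests on
    Goursat's bisection, carried out for g(z) dz / z in the coordinates log z: there the sides at t
    = 0 and t = 2 pi cancel and a circle mean is a vertical side. Subharmonicity is given only as a
    circle inequality, so no Laplacian or Riesz measure appears. A maximum principle on annuli
    against A + B ln |w - a| gives the three-circle convexity behind Lelong numbers, and pairing
    with a truncated paraboloid gives the area estimate. The obstacle on the way from small Lelong
    numbers to finite volume is uniformity: the hypothesis concerns the single point v1, while disc
    means are needed at all nearby centres. Hence a chain of exponents nu < nu' < al < gam < 1/2:
    nu' absorbs the constant in the growth at v1, al pays for moving the centre, and gam = (1 +
    eta)^2 al pays for recentring the disc at a point where log h is not too small. No integral is
    computed in polar coordinates; averages over rotations and the scaling w |-> 2 w replace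
    them. *)

Definition toC (R : realType) (p : R * R) : Cx R := p.1 +i* p.2.

Lemma normCx (R : realType) (z : Cx R) : `|z| = (cabs z)%:C%C.
Proof. by case: z => a b; rewrite normc_def. Qed.

Lemma cabs_ge0 (R : realType) (z : Cx R) : 0 <= cabs z.
Proof. by case: z => a b; exact: sqrtr_ge0. Qed.

Lemma cabsN (R : realType) (z : Cx R) : cabs (- z) = cabs z.
Proof. exact: normcN. Qed.

Lemma cabsM (R : realType) (z w : Cx R) : cabs (z * w) = cabs z * cabs w.
Proof. exact: ComplexField.Normc.normcM. Qed.

Lemma cabsD (R : realType) (z w : Cx R) : cabs (z + w) <= cabs z + cabs w.
Proof. exact: le_normcD. Qed.

Lemma cabs_distC (R : realType) (z w : Cx R) : cabs (z - w) = cabs (w - z).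
Proof. by rewrite -cabsN opprB. Qed.

Lemma cabs_real (R : realType) (x : R) : cabs (x%:C%C) = `|x|.
Proof. by rewrite /= expr0n addr0 sqrtr_sqr. Qed.

Lemma cabs0 (R : realType) : cabs (0 : Cx R) = 0.
Proof. by rewrite /= expr0n addr0 sqrtr0. Qed.

Lemma cabs_eq0 (R : realType) (z : Cx R) : (cabs z == 0) = (z == 0).
Proof.
apply/eqP/eqP => [/ComplexField.Normc.eq0_normc//|->]; exact: cabs0.
Qed.

Lemma cabs_gt0 (R : realType) (z : Cx R) : (0 < cabs z) = (z != 0).
Proof. by rewrite lt0r cabs_ge0 andbT cabs_eq0. Qed.

Lemma cabs_sqr (R : realType) (a b : R) :
  cabs (a +i* b)%C ^+ 2 = a ^+ 2 + b ^+ 2.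
Proof. by rewrite sqr_sqrtr// addr_ge0 ?sqr_ge0. Qed.

Lemma Re_le_cabs (R : realType) (z : Cx R) : `|complex.Re z| <= cabs z.
Proof.
case: z => a b /=; rewrite -sqrtr_sqr ler_sqrt ?addr_ge0 ?sqr_ge0//.
by rewrite lerDl sqr_ge0.
Qed.

Lemma Im_le_cabs (R : realType) (z : Cx R) : `|complex.Im z| <= cabs z.
Proof.
case: z => a b /=; rewrite -sqrtr_sqr ler_sqrt ?addr_ge0 ?sqr_ge0//.
by rewrite lerDr sqr_ge0.
Qed.

Lemma cabs_le_add (R : realType) (a b : R) : cabs (a +i* b)%C <= `|a| + `|b|.
Proof.
rewrite -(@ler_pXn2r _ 2)// ?nnegrE ?cabs_ge0 ?addr_ge0// cabs_sqr.
rewrite sqrrD !real_normK ?num_real//.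
by rewrite lerD2r lerDl mulrn_wge0// mulr_ge0.
Qed.

Lemma nbhs_CxP (R : realType) (z : Cx R) (A : set (Cx R)) :
  nbhs z A <-> exists2 e : R, 0 < e & forall y, cabs (y - z) < e -> A y.
Proof.
split.
  move=> /nbhs_ballP[[e e'] /= e0 H].
  (* A positive element of [R[i]] is real, so the radius of a ball has imaginary part 0. *)
  move: e0; rewrite ltcE/= => /andP[/eqP ? e0]; subst e'.
  exists e => // y yz; apply: H; rewrite -ball_normE /ball_/= normCx.
  by rewrite cabs_distC ltcR.
move=> [e e0 H]; apply/nbhs_ballP; exists e%:C%C; first by rewrite /= ltcR.
move=> y; rewrite -ball_normE /ball_/= normCx ltcR => yz.
by apply: H; rewrite cabs_distC.
Qed.

Lemma nbhs_Cx2P (R : realType) (z : Cx2 R) (A : set (Cx2 R)) :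
  nbhs z A <-> exists2 e : R, 0 < e &
    forall y, cabs (y.1 - z.1) < e -> cabs (y.2 - z.2) < e -> A y.
Proof.
split.
  move=> [[A1 A2] /= [/nbhs_CxP[e1 e10 H1] /nbhs_CxP[e2 e20 H2]] H].
  exists (Num.min e1 e2); first by rewrite lt_min e10.
  move=> y; rewrite !lt_min => /andP[? _] /andP[_ ?]; apply: H.
  by split => /=; [exact: H1|exact: H2].
move=> [e e0 H].
exists ([set y | cabs (y - z.1) < e], [set y | cabs (y - z.2) < e]) => /=.
  by split; apply/nbhs_CxP; exists e.
by move=> y [/= ? ?]; exact: H.
Qed.

(** * Measurability of open sets in real coordinates *)

(** Second countability for an arbitrary relation [N x A], read as A being a neighbourhood of x. The
    sigma-algebras on R^2 and R^4 are products of those of the factors, so open sets are shown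
    measurable as countable unions of measurable boxes. *)
Definition has_measurable_base d (T : measurableType d)
    (N : T -> set T -> Prop) :=
  exists B : nat -> set T, (forall n, measurable (B n)) /\
    forall x A, N x A -> exists n, B n x /\ B n `<=` A.

Lemma measurable_base_open d (T : measurableType d) (N : T -> set T -> Prop)
    (U : set T) :
  has_measurable_base N -> (forall x, U x -> N x U) -> measurable U.
Proof.
move=> [B [mB HB]] HU.
rewrite (_ : U = \bigcup_(n in [set n | B n `<=` U]) B n).
  by apply: bigcup_measurable => n _; exact: mB.
apply/seteqP; split => x.
  by move=> /HU/HB[n [Bx BU]]; exists n.
by move=> [n /= BU Bx]; exact: BU.
Qed.

(** Pairs of indices are coded by [pickle]; numbers that code no pair give the empty set, so the
    base stays indexed by [nat]. *)
Lemma has_measurable_baseX d1 d2 (T1 : measurableType d1)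
    (T2 : measurableType d2) (N1 : T1 -> set T1 -> Prop)
    (N2 : T2 -> set T2 -> Prop) :
  has_measurable_base N1 -> has_measurable_base N2 ->
  has_measurable_base (fun (x : T1 * T2) A =>
    exists A1 A2, [/\ N1 x.1 A1, N2 x.2 A2 & A1 `*` A2 `<=` A]).
Proof.
move=> [B1 [mB1 H1]] [B2 [mB2 H2]].
exists (fun n => match @unpickle (nat * nat)%type n with
  | Some (i, j) => B1 i `*` B2 j | None => set0 end); split.
  by move=> n; case: unpickle => [[i j]|]//; exact: measurableX.
move=> [x y] A /= [A1 [A2 [/H1[i [Bx BA1]] /H2[j [By BA2]] AA]]].
exists (pickle (i, j)); rewrite pickleK; split => //.
by move=> [a b] [/= /BA1 ? /BA2 ?]; exact: AA.
Qed.

Lemma has_measurable_baseR (R : realType) :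
  @has_measurable_base _ (measurableTypeR R) (fun (x : R) (A : set R) =>
    exists2 e : R, 0 < e & forall y, `|y - x| < e -> A y).
Proof.
exists (fun n => match @unpickle (rat * rat)%type n with
  | Some (i, j) => `](ratr i : R), (ratr j : R)[%classic | None => set0 end).
split.
  by move=> n; case: unpickle => [[i j]|]//; exact: measurable_itv.
move=> x A [e e0 H].
have xe : x - e < x by rewrite ltrBlDr ltrDl.
have ex : x < x + e by rewrite ltrDl.
have [q] := rat_in_itvoo xe.
rewrite in_itv/= => /andP[i1 i2].
have [j] := rat_in_itvoo ex.
rewrite in_itv/= => /andP[j1 j2].
exists (pickle (q, j)); rewrite pickleK; split; first by rewrite /= in_itv/= i2.
move=> y; rewrite /= in_itv/= => /andP[y1 y2]; apply: H.
by rewrite ltr_norml; apply/andP; split; lra.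
Qed.

Lemma toC_open_measurable (R : realType) (U : set (Cx R)) :
  open U -> measurable
    (@toC R @^-1` U : set (measurableTypeR R * measurableTypeR R)).
Proof.
move=> oU; apply: (measurable_base_open (has_measurable_baseX
  (has_measurable_baseR R) (has_measurable_baseR R))).
move=> [x y] /= Uxy.
have := open_nbhs_nbhs (conj oU Uxy) => /nbhs_CxP[e e0 H].
exists [set x' | `|x' - x| < e / 2], [set x' | `|x' - y| < e / 2].
have e20 : 0 < e / 2 by rewrite divr_gt0.
split; [by exists (e / 2)|by exists (e / 2)|].
move=> [a b] /= [ax bx]; apply: H.
rewrite (le_lt_trans (cabs_le_add _ _))//=; lra.
Qed.

Lemma toC2_open_measurable (R : realType) (U : set (Cx2 R)) :
  open U -> measurable
    (@toC2 R @^-1` U : set ((measurableTypeR R * measurableTypeR R) *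
      (measurableTypeR R * measurableTypeR R))).
Proof.
move=> oU; have B2 := has_measurable_baseX
  (has_measurable_baseR R) (has_measurable_baseR R).
apply: (measurable_base_open (has_measurable_baseX B2 B2)).
move=> [[x y] [z t]] /= Uxy.
have := open_nbhs_nbhs (conj oU Uxy) => /nbhs_Cx2P[e e0 H].
have e20 : 0 < e / 2 by rewrite divr_gt0.
exists ([set x' | `|x' - x| < e / 2] `*` [set x' | `|x' - y| < e / 2]).
exists ([set x' | `|x' - z| < e / 2] `*` [set x' | `|x' - t| < e / 2]).
split.
- by do 2 eexists; split; [exists (e / 2); [|move=> ? K; exact: K]..|].
- by do 2 eexists; split; [exists (e / 2); [|move=> ? K; exact: K]..|].
move=> [[a b] [c d]] /= [[/= ax bx] [/= cx dx]]; apply: H => /=;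
rewrite (le_lt_trans (cabs_le_add _ _))//=; lra.
Qed.

(** If P failed on K, the sets A for which P holds on K minus A would form a proper filter
    containing K. A cluster point of it in K contradicts the local hypothesis there. *)
Lemma compact_local_to_global (T : topologicalType) (K : set T)
    (P : set T -> Prop) :
  compact K -> P set0 -> (forall A B, A `<=` B -> P B -> P A) ->
  (forall A B, P A -> P B -> P (A `|` B)) ->
  (forall x, K x -> exists2 U, nbhs x U & P (K `&` U)) -> P K.
Proof.
move=> cK P0 Psub PU Ploc; apply: contrapT => nPK.
pose F : set_system T := [set A | P (K `\` A)].
have FF : ProperFilter F.
  apply: Build_ProperFilter_ex.
    move=> A FA; apply: contrapT => nA; apply: nPK.
    apply: Psub FA => x Kx; split => // Ax; apply: nA; by exists x.
  split.
  - by rewrite /F/= setDT.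
  - by move=> A B FA FB; rewrite /F/= setDIr; exact: PU.
  - by move=> A B AB; apply: Psub; exact: setDS.
have FK : F K by rewrite /F/= setDv.
have [x [Kx clx]] := cK F FF FK.
have [U nU PKU] := Ploc x Kx.
have FU : F (~` U) by rewrite /F/= setDE setCK.
by have [y [/= nUy Uy]] := clx _ _ FU nU.
Qed.

(** * Linear changes of variables *)

(** Stated as an existence so that later goals see an opaque [m'] instead of a pushforward that
    carries the proof [mphi]. *)
Lemma pushforward_measure_exists d d' (T : measurableType d)
    (T' : measurableType d') (R : realType) (mu : {measure set T -> \bar R})
    (phi : T -> T') :
  measurable_fun setT phi -> exists m' : {measure set T' -> \bar R},
   (forall A, m' A = mu (phi @^-1` A)) /\
   forall f : T' -> \bar R, measurable_fun setT f -> (forall x, (0 <= f x)%E) ->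
     (\int[m']_x f x = \int[mu]_x f (phi x))%E.
Proof.
move=> mphi.
exists (measure_function_pushforward__canonical__measure_function_Measure
  mu mphi); split => // f mf f0.
by rewrite (ge0_integral_pushforward mphi).
Qed.

(* [k] is the inverse of the Jacobian factor of [phi]. *)
Definition dilates d (T : measurableType d) (R : realType)
    (mu : {measure set T -> \bar R}) (phi : T -> T) (k : R) :=
  measurable_fun setT phi /\
  forall f : T -> \bar R, measurable_fun setT f -> (forall x, (0 <= f x)%E) ->
    (\int[mu]_x f (phi x) = k%:E * \int[mu]_x f x)%E.

Lemma dilates_comp d (T : measurableType d) (R : realType)
    (mu : {measure set T -> \bar R}) (phi psi : T -> T) (k l : R) :
  dilates mu phi k -> dilates mu psi l -> dilates mu (phi \o psi) (k * l).
Proof.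
move=> [mphi Hphi] [mpsi Hpsi]; split; first exact: measurableT_comp.
move=> f mf f0 /=.
rewrite (Hpsi (f \o phi)).
- by rewrite /= Hphi// muleA -EFinM mulrC.
- exact: measurableT_comp.
- by move=> x /=.
Qed.

Lemma measurable_fun_affine (R : realType) (a b : R) :
  measurable_fun setT
    (fun x : measurableTypeR R => a * x + b : measurableTypeR R).
Proof. by apply: measurable_funD => //; exact: measurable_funM. Qed.

Lemma dilates_affine (R : realType) (a b : R) : a != 0 ->
  dilates (@lebesgue_measure R)
    (fun x : measurableTypeR R => a * x + b : measurableTypeR R) `|a|^-1.
Proof.
move=> a0; split; first exact: measurable_fun_affine.
move=> f mf f0.
have [m' [m'E Im']] := pushforward_measure_exists (@lebesgue_measure R)
  (measurable_fun_affine a b).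
rewrite -Im'//.
have aa : 0 < `|a| by rewrite normr_gt0.
pose k : {nonneg R} := NngNum (normr_ge0 a).
(* Lebesgue measure is determined by its values on half-open intervals. Preimages under x |-> a x +
   b have their length divided by |a|, and the closed end changes side when a < 0. *)
have H A : measurable A -> mscale k m' A = lebesgue_measure A.
  move=> mA; apply/esym/lebesgue_measure_unique => // _ [[p q] /= pq <-].
  rewrite /mscale/= m'E.
  have [an|ap] := ltP a 0.
    rewrite (_ : _ @^-1` _ = `[(q - b) / a, (p - b) / a[%classic); last first.
      apply/seteqP; split => x /=; rewrite !in_itv/= ler_ndivrMr// (@ltr_ndivlMr _ a x (p - b))//
        ![a * x]mulrC => /andP[? ?]; apply/andP; split; lra.
    rewrite lebesgue_measure_itv/= !lte_fin.
    rewrite [X in (_ * X)%E](lebesgue_measure_itv `[((q - b) / a)%R, ((p - b) / a)%R[)/= lte_fin.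
    have -> : ((q - b) / a < (p - b) / a) = (p < q).
      by rewrite ltr_nM2r ?invr_lt0// ltrD2r.
    case: ifPn => _; last by rewrite mule0.
    rewrite -!EFinB -EFinM; congr EFin; rewrite ltr0_norm//; field.
    by rewrite lt_eqF.
  have {}ap : 0 < a by rewrite lt_def a0.
  rewrite (_ : _ @^-1` _ = `](p - b) / a, (q - b) / a]%classic); last first.
    apply/seteqP; split => x /=; rewrite !in_itv/= ler_pdivlMr// ltr_pdivrMr//
        ![a * x]mulrC => /andP[? ?]; apply/andP; split; lra.
  rewrite lebesgue_measure_itv/= !lte_fin.
  rewrite [X in (_ * X)%E](lebesgue_measure_itv `](p - b) / a, (q - b) / a])/= lte_fin.
  have -> : ((p - b) / a < (q - b) / a) = (p < q).
    by rewrite ltr_pM2r ?invr_gt0// ltrD2r.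
  case: ifPn => _; last by rewrite mule0.
  rewrite -!EFinB -EFinM; congr EFin; rewrite gtr0_norm//; field.
  by rewrite gt_eqF.
have <- : (\int[mscale k m']_x f x = \int[lebesgue_measure]_x f x)%E.
  by apply: eq_measure_integral => A mA _; exact: H.
rewrite ge0_integral_mscale// muleA -EFinM mulVf ?mul1e// gt_eqF//.
Qed.

(** A map that moves only the first coordinate, with the second as a parameter, is handled fibre by
    fibre by Tonelli; the maps of the plane are then composed from such shears. *)
Lemma dilates_fiber1 d1 d2 (T1 : measurableType d1) (T2 : measurableType d2)
    (R : realType) (m1 : {sigma_finite_measure set T1 -> \bar R})
    (m2 : {sigma_finite_measure set T2 -> \bar R}) (psi : T1 * T2 -> T1)
    (k : R) :
  0 <= k -> measurable_fun setT psi ->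
  (forall y, dilates m1 (fun x => psi (x, y)) k) ->
  dilates (m1 \x m2)%E (fun p => (psi p, p.2)) k.
Proof.
move=> k0 mpsi Hpsi.
have mphi : measurable_fun setT (fun p : T1 * T2 => (psi p, p.2)).
  by apply/measurable_fun_pairP; split => //; exact: measurable_snd.
split => // f mf f0.
rewrite fubini_tonelli2//=; last exact: (measurableT_comp mf mphi).
rewrite fubini_tonelli2// -ge0_integralZl//.
- apply: eq_integral => y _; rewrite /fubini_G/=.
  have [_ H] := Hpsi y; apply: (H (fun x => f (x, y))) => //.
  by apply: (measurableT_comp mf); exact: pair2_measurable.
- exact: measurable_fun_fubini_tonelli_G.
- by move=> y _; apply: integral_ge0.
Qed.

Lemma dilates_fiber2 d1 d2 (T1 : measurableType d1) (T2 : measurableType d2)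
    (R : realType) (m1 : {sigma_finite_measure set T1 -> \bar R})
    (m2 : {sigma_finite_measure set T2 -> \bar R}) (psi : T1 * T2 -> T2)
    (k : R) :
  0 <= k -> measurable_fun setT psi ->
  (forall x, dilates m2 (fun y => psi (x, y)) k) ->
  dilates (m1 \x m2)%E (fun p => (p.1, psi p)) k.
Proof.
move=> k0 mpsi Hpsi.
have mphi : measurable_fun setT (fun p : T1 * T2 => (p.1, psi p)).
  by apply/measurable_fun_pairP; split => //; exact: measurable_fst.
split => // f mf f0.
rewrite fubini_tonelli1//=; last exact: (measurableT_comp mf mphi).
rewrite fubini_tonelli1// -ge0_integralZl//.
- apply: eq_integral => x _; rewrite /fubini_F/=.
  have [_ H] := Hpsi x; apply: (H (fun y => f (x, y))) => //.
  by apply: (measurableT_comp mf); exact: pair1_measurable.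
- exact: measurable_fun_fubini_tonelli_F.
- by move=> x _; apply: integral_ge0.
Qed.

Lemma integral_swap d (T : measurableType d)
    (R : realType) (m : {sigma_finite_measure set T -> \bar R})
    (f : T * T -> \bar R) : measurable_fun setT f -> (forall x, (0 <= f x)%E) ->
  (\int[m \x m]_p f (p.2, p.1) = \int[m \x m]_p f p)%E.
Proof.
move=> mf f0; rewrite fubini_tonelli1//=; last first.
  exact: (measurableT_comp mf (measurable_fun_pair measurable_snd measurable_fst)).
by rewrite fubini_tonelli2.
Qed.

Lemma dilates_translate2 (R : realType) (a b : R) :
  dilates (@lebesgue2 R) (fun p => (p.1 + a, p.2 + b)) 1.
Proof.
have H c : dilates (@lebesgue_measure R)
    (fun x : measurableTypeR R => x + c : measurableTypeR R) 1.
  have := dilates_affine c (@oner_neq0 R); rewrite normr1 invr1.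
  by under eq_fun do rewrite mul1r.
have H1 := @dilates_fiber1 _ _ _ _ R lebesgue_measure lebesgue_measure
  (fun p : measurableTypeR R * measurableTypeR R => p.1 + a) 1 ler01.
have H2 := @dilates_fiber2 _ _ _ _ R lebesgue_measure lebesgue_measure
  (fun p : measurableTypeR R * measurableTypeR R => p.2 + b) 1 ler01.
rewrite -[1]mulr1; apply: (dilates_comp (H2 _ _) (H1 _ _)) => //.
- by apply: measurable_funD => //; exact: measurable_snd.
- by apply: measurable_funD => //; exact: measurable_fst.
Qed.

(** Triangular factorisation of multiplication by a + ib: x is replaced by x' = a x - b y, then y by
    c y + (b / a) x'. The pivot [c] is (a^2 + b^2) / a, hence the condition on a, and the two
    factors multiply to a^2 + b^2. *)
Lemma dilates_cmul_neq0 (R : realType) (a b : R) : a != 0 ->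
  dilates (@lebesgue2 R) (fun p => (a * p.1 - b * p.2, b * p.1 + a * p.2))
    (a ^+ 2 + b ^+ 2)^-1.
Proof.
move=> a0.
have a2 : 0 < a ^+ 2 by rewrite exprn_even_gt0//= a0.
have n0 : 0 < a ^+ 2 + b ^+ 2 by rewrite ltr_wpDr// sqr_ge0.
pose c := (a ^+ 2 + b ^+ 2) / a.
have c0 : c != 0 by rewrite mulf_neq0// ?invr_eq0// gt_eqF.
have mf1 : measurable_fun setT
    (fun p : measurableTypeR R * measurableTypeR R => a * p.1 + (- b * p.2)).
  by apply: measurable_funD; apply: measurable_funM.
have mf2 : measurable_fun setT
    (fun p : measurableTypeR R * measurableTypeR R => c * p.2 + b / a * p.1).
  by apply: measurable_funD; apply: measurable_funM.
have k1 : 0 <= `|a|^-1 by rewrite invr_ge0.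
have k2 : 0 <= `|c|^-1 by rewrite invr_ge0.
have H1 := @dilates_fiber1 _ _ _ _ R lebesgue_measure lebesgue_measure
  _ _ k1 mf1 (fun y => dilates_affine (- b * y) a0).
have H2 := @dilates_fiber2 _ _ _ _ R lebesgue_measure lebesgue_measure
  _ _ k2 mf2 (fun x => dilates_affine (b / a * x) c0).
have := dilates_comp H2 H1.
have -> : `|c|^-1 * `|a|^-1 = (a ^+ 2 + b ^+ 2)^-1.
  rewrite normrM normfV (gtr0_norm n0) invfM invrK mulrAC -mulrA.
  by rewrite mulVf ?mulr1// normr_eq0.
rewrite (_ : _ \o _ =
  fun p => (a * p.1 - b * p.2, b * p.1 + a * p.2))//; apply/funext => -[x y] /=.
congr pair; first by rewrite mulNr.
by rewrite /c; field.
Qed.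

Lemma dilates_cmul (R : realType) (a b : R) : a ^+ 2 + b ^+ 2 != 0 ->
  dilates (@lebesgue2 R) (fun p => (a * p.1 - b * p.2, b * p.1 + a * p.2))
    (a ^+ 2 + b ^+ 2)^-1.
Proof.
move=> n0; have [a0|a0] := eqVneq a 0; last exact: dilates_cmul_neq0.
have b0 : b != 0 by move: n0; rewrite a0 expr0n add0r sqrf_eq0.
(* i b = (1 + i) (b/2 + i b/2) reduces to multipliers with nonzero real part *)
have b20 : b / 2 != 0 by rewrite mulf_neq0// invr_eq0 pnatr_eq0.
have := dilates_comp (dilates_cmul_neq0 1 (@oner_neq0 R))
  (dilates_cmul_neq0 (b / 2) b20).
have -> : (1 ^+ 2 + 1 ^+ 2)^-1 * ((b / 2) ^+ 2 + (b / 2) ^+ 2)^-1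
    = (a ^+ 2 + b ^+ 2)^-1.
  by rewrite -invfM a0; congr (_^-1); field.
rewrite (_ : _ \o _ =
  fun p => (a * p.1 - b * p.2, b * p.1 + a * p.2))//; apply/funext => -[x y] /=.
by rewrite a0; congr pair; field.
Qed.

Lemma integral_translate (R : realType) (f : Cx R -> \bar R) (a : Cx R) :
  measurable_fun setT (f \o @toC R : measurableTypeR R * measurableTypeR R -> _) ->
  (forall x, (0 <= f x)%E) ->
  (\int[@lebesgue2 R]_p f (toC p + a)%R = \int[@lebesgue2 R]_p f (toC p))%E.
Proof.
case: a => a b mf f0.
have [_ /(_ (f \o @toC R) mf (fun p => f0 (toC p)))] := dilates_translate2 a b.
by rewrite mul1e.
Qed.

Lemma integral_scale (R : realType) (f : Cx R -> \bar R) (c : Cx R) :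
  c != 0 ->
  measurable_fun setT (f \o @toC R : measurableTypeR R * measurableTypeR R -> _) ->
  (forall x, (0 <= f x)%E) ->
  (\int[@lebesgue2 R]_p f (c * toC p)%R
     = (cabs c ^- 2)%:E * \int[@lebesgue2 R]_p f (toC p))%E.
Proof.
case: c => a b c0 mf f0.
have n0 : a ^+ 2 + b ^+ 2 != 0 by rewrite -cabs_sqr sqrf_eq0 cabs_eq0.
have [_ /(_ (f \o @toC R) mf (fun p => f0 (toC p)))] := dilates_cmul n0.
rewrite cabs_sqr => <-; apply: eq_integral => -[x y] _ /=.
by congr (f (Complex _ _)); rewrite /= addrC.
Qed.

Lemma integral4_rotate (R : realType) (f : Cx2 R -> \bar R) (c : Cx R) :
  cabs c = 1 ->
  measurable_fun setT
    (f \o @toC2 R : (measurableTypeR R * measurableTypeR R) *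
                    (measurableTypeR R * measurableTypeR R) -> _) ->
  (forall x, (0 <= f x)%E) ->
  (\int[@lebesgue4 R]_p f (c *: toC2 p)%R = \int[@lebesgue4 R]_p f (toC2 p))%E.
Proof.
case: c => a b c1 mf f0.
have n1 : a ^+ 2 + b ^+ 2 = 1 by rewrite -cabs_sqr c1 expr1n.
have n0 : a ^+ 2 + b ^+ 2 != 0 by rewrite n1 oner_neq0.
have := dilates_cmul n0; rewrite n1 invr1.
set g := (X in dilates _ X _) => H.
have H1 := @dilates_fiber1 _ _ _ _ R (@lebesgue2 R) (@lebesgue2 R)
  (g \o fst) 1 ler01 (measurableT_comp H.1 measurable_fst) (fun=> H).
have H2 := @dilates_fiber2 _ _ _ _ R (@lebesgue2 R) (@lebesgue2 R)
  (g \o snd) 1 ler01 (measurableT_comp H.1 measurable_snd) (fun=> H).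
have [_ /(_ (f \o @toC2 R) mf (fun p => f0 (toC2 p)))] := dilates_comp H2 H1.
rewrite mulr1 mul1e => <-; apply: eq_integral => -[[x y] [z t]] _ /=.
by congr (f (Complex _ _, Complex _ _)); rewrite /= addrC.
Qed.

Lemma lebesgue4_tonelli (R : realType) (f : Cx2 R -> \bar R) :
  measurable_fun setT
    (f \o @toC2 R : (measurableTypeR R * measurableTypeR R) *
                    (measurableTypeR R * measurableTypeR R) -> _) ->
  (forall x, (0 <= f x)%E) ->
  (\int[@lebesgue4 R]_p f (toC2 p) =
   \int[@lebesgue2 R]_q \int[@lebesgue2 R]_p f (toC p, toC q))%E.
Proof.
move=> mf f0.
exact: (@fubini_tonelli2 _ _ _ _ R (@lebesgue2 R) (@lebesgue2 R) _ mf
  (fun p => f0 (toC2 p))).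
Qed.

Lemma integral4_swap (R : realType) (f : Cx2 R -> \bar R) :
  measurable_fun setT
    (f \o @toC2 R : (measurableTypeR R * measurableTypeR R) *
                    (measurableTypeR R * measurableTypeR R) -> _) ->
  (forall x, (0 <= f x)%E) ->
  (\int[@lebesgue4 R]_p f ((toC2 p).2, (toC2 p).1)
     = \int[@lebesgue4 R]_p f (toC2 p))%E.
Proof.
move=> mf f0.
exact: (@integral_swap _ _ R (@lebesgue2 R) _ mf (fun p => f0 (toC2 p))).
Qed.

Lemma volumeE (R : realType) (A : set (Cx2 R)) :
  measurable (@toC2 R @^-1` A : set ((measurableTypeR R * measurableTypeR R) *
                    (measurableTypeR R * measurableTypeR R))) ->
  (volume A = \int[@lebesgue4 R]_p (\1_A (toC2 p))%:E)%E.
Proof.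
move=> mA; have := @integral_indic _ _ R (@lebesgue4 R) _ measurableT _ mA.
by rewrite setIT => H; exact: esym H.
Qed.

(** * The mean value property *)

Section segment_integral.
Variable R : realType.
Implicit Types (f g : R -> R) (a b c : R).
Local Notation mu := (@lebesgue_measure R).
Local Notation J f a b := (\int[mu]_(x in `[a, b]) f x).

Definition cont_on f a b := forall x, a <= x <= b -> {for x, continuous f}.

Lemma cont_on_within f a b : cont_on f a b -> {within `[a, b], continuous f}.
Proof.
move=> cf; apply: continuous_in_subspaceT => x; rewrite inE/= in_itv/=.
exact: cf.
Qed.

Lemma cont_on_integrable f a b :
  cont_on f a b -> mu.-integrable `[a, b] (EFin \o f).
Proof.
move=> cf; apply: continuous_compact_integrable; first exact: segment_compact.
exact: cont_on_within.
Qed.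

Lemma cont_onB f g a b :
  cont_on f a b -> cont_on g a b -> cont_on (fun x => f x - g x) a b.
Proof. by move=> cf cg x xab; apply: continuousB; [exact: cf|exact: cg]. Qed.

Lemma segment_integralB f g a b : cont_on f a b -> cont_on g a b ->
  J (fun x => f x - g x) a b = J f a b - J g a b.
Proof. by move=> cf cg; rewrite RintegralB//; exact: cont_on_integrable. Qed.

Lemma segment_integral_split f a b c : a <= c -> c <= b -> cont_on f a b ->
  J f a b = J f a c + J f c b.
Proof.
move=> ac cb cf; have intf := cont_on_integrable cf.
have := @Rintegral_itvB _ f (BLeft a) (BRight b) c intf.
rewrite !bnd_simp => /(_ ac cb) /eqP; rewrite subr_eq addrC => /eqP ->.
congr (_ + _); rewrite Rintegral_itv_obnd_cbnd//.
apply: integrableS intf => //; apply: subset_itv; rewrite bnd_simp//.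
Qed.

Lemma lebesgue_segment a b : a <= b -> (mu `[a, b]%classic = (b - a)%:E)%E.
Proof.
move=> ab; rewrite lebesgue_measure_itv/= lte_fin EFinB; case: ltgtP ab => //.
by move=> -> _; rewrite subee.
Qed.

Lemma segment_integral_bound f a b M : a <= b -> cont_on f a b ->
  (forall x, a <= x <= b -> `|f x| <= M) -> `|J f a b| <= M * (b - a).
Proof.
move=> ab cf fM.
apply: le_trans (le_normr_Rintegral _ (cont_on_integrable cf)) _ => //.
have -> : M * (b - a) = J (fun=> M) a b.
  by rewrite Rintegral_cst// [X in fine X](lebesgue_segment ab).
apply: le_Rintegral => //.
- apply: cont_on_integrable => x xab.
  by apply: continuous_comp; [exact: cf|exact: norm_continuous].
- by apply: cont_on_integrable => x _; exact: cst_continuous.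
Qed.

Lemma segment_FTC f (F : R -> R) a b : a <= b -> (forall x, is_derive x (1 : R) F (f x)) ->
  continuous f -> J f a b = F b - F a.
Proof.
rewrite le_eqVlt => /predU1P[<- _ _|ab dF cf].
  by rewrite set_itv1 Rintegral_set1 subrr.
have cF x : {for x, continuous F}.
  by apply/differentiable_continuous/derivable1_diffP; exact: ex_derive.
rewrite /Rintegral (continuous_FTC2 ab (F := F))//.
- exact: continuous_subspaceT.
- split => [x _||].
  + exact: ex_derive.
  + apply: cvg_at_right_filter; exact: cF.
  + apply: cvg_at_left_filter; exact: cF.
- by move=> x _; rewrite derive1E derive_val.
Qed.

End segment_integral.

(** * Goursat's theorem in logarithmic coordinates *)

(** The bisection scheme alone: [P s t n] speaks of the rectangle with lower corner (s, t) and sides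
    L / 2^n and M / 2^n. The lower ends of the nested intervals increase, the upper ends decrease,
    and the supremum of the lower ends lies in all of them. *)
Lemma dyadic_rectangles (R : realType) (P : R -> R -> nat -> Prop)
    (L M s0 t0 : R) :
  0 <= L -> 0 <= M -> P s0 t0 0 ->
  (forall s t n, P s t n -> exists s' t', [/\ P s' t' n.+1,
    s <= s' <= s + L / 2 ^+ n.+1 & t <= t' <= t + M / 2 ^+ n.+1]) ->
  exists s' t', forall n, exists s t, [/\ P s t n,
    s <= s' <= s + L / 2 ^+ n & t <= t' <= t + M / 2 ^+ n].
Proof.
move=> L0 M0 P0 step.
(* [choice] needs a total relation; where [P] fails, the corner itself is a dummy value. *)
have step' (x : nat * (R * R)) : exists y : R * R,
    P x.2.1 x.2.2 x.1 -> [/\ P y.1 y.2 x.1.+1,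
      x.2.1 <= y.1 <= x.2.1 + L / 2 ^+ x.1.+1 &
      x.2.2 <= y.2 <= x.2.2 + M / 2 ^+ x.1.+1].
  case: x => n [s t] /=.
  have [/step[s' [t' H]]|nP] := pselect (P s t n); first by exists (s', t').
  by exists (s, t).
have [F HF] := choice step'.
pose q := fix q n := if n is m.+1 then F (m, q m) else (s0, t0).
have qP n : P (q n).1 (q n).2 n.
  by elim: n => [|n /(HF (n, q n))[]].
have mono (X : R) (u : nat -> R) : 0 <= X ->
    (forall n, u n <= u n.+1 <= u n + X / 2 ^+ n.+1) ->
    exists x, forall n, u n <= x <= u n + X / 2 ^+ n.
  move=> X0 Hu.
  have u_nd n k : u n <= u (n + k)%N.
    elim: k => [|k IH]; first by rewrite addn0.
    by rewrite addnS (le_trans IH)//; have /andP[] := Hu (n + k)%N.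
  have u_ni n k : u (n + k)%N + X / 2 ^+ (n + k) <= u n + X / 2 ^+ n.
    elim: k => [|k IH]; first by rewrite addn0.
    apply: le_trans IH; rewrite addnS; have /andP[_] := Hu (n + k)%N.
    have -> : X / 2 ^+ (n + k) = X / 2 ^+ (n + k).+1 + X / 2 ^+ (n + k).+1.
      by rewrite exprS; field; rewrite expf_neq0.
    lra.
  have p2 n : 0 <= X / 2 ^+ n by rewrite divr_ge0// exprn_ge0.
  have ub n : ubound (range u) (u n + X / 2 ^+ n).
    move=> _ [m _ <-]; have [mn|/ltnW nm] := leqP m n.
      by rewrite (le_trans (u_nd m (n - m)%N))// subnKC// lerDl.
    rewrite -(subnKC nm); apply: le_trans (u_ni n (m - n)%N).
    by rewrite lerDl.
  exists (sup (range u)) => n; apply/andP; split.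
    by apply: sup_upper_bound; [split; [exists (u 0%N), 0%N|exists (u 0%N + X / 2 ^+ 0)]|exists n].
  by apply: sup_le_ub; [exists (u 0%N), 0%N|exact: ub].
have [s' Hs'] := mono L (fun n => (q n).1) L0 (fun n =>
  let: And3 _ h _ := HF (n, q n) (qP n) in h).
have [t' Ht'] := mono M (fun n => (q n).2) M0 (fun n =>
  let: And3 _ _ h := HF (n, q n) (qP n) in h).
by exists s', t' => n; exists (q n).1, (q n).2; split.
Qed.

Definition cis (R : realType) (t : R) : Cx R := cos t +i* sin t.

(** This is exp (s + it); the half-plane s <= 0 covers the closed unit disc without the origin. *)
Definition polar (R : realType) (s t : R) : Cx R :=
  (expR s * cos t) +i* (expR s * sin t).

(** Complex differentiability with real epsilon and delta, the form that Goursat's estimate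
    consumes. *)
Definition cdiff (R : realType) (g : Cx R -> Cx R) (z : Cx R) :=
  exists d : Cx R, forall e : R, 0 < e -> exists2 del : R, 0 < del &
    forall w, cabs (w - z) < del ->
      cabs (g w - g z - d * (w - z)) <= e * cabs (w - z).

Lemma cabs_polar (R : realType) (s t : R) : cabs (polar s t) = expR s.
Proof.
rewrite /= !exprMn -mulrDr cos2Dsin2 mulr1 sqrtr_sqr ger0_norm//.
Qed.

Lemma cabs_cis (R : realType) (t : R) : cabs (cis t) = 1.
Proof. by rewrite /= cos2Dsin2 sqrtr1. Qed.

Lemma polar0 (R : realType) (t : R) : polar 0 t = cis t.
Proof. by rewrite /polar expR0 !mul1r. Qed.

Lemma lip1 (R : realType) (f df : R -> R) (x y : R) :
  (forall z, is_derive z (1 : R) f (df z)) -> (forall z, `|df z| <= 1) ->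
  `|f x - f y| <= `|x - y|.
Proof.
move=> fdf df1; wlog xy : x y / y <= x.
  move=> H; have [yx|/ltW xy] := leP y x; first exact: H.
  by rewrite distrC [leRHS]distrC; exact: H.
have cf : {within `[y, x], continuous f}.
  apply: continuous_subspaceT => z.
  by apply/differentiable_continuous/derivable1_diffP; exact: ex_derive.
have [c _ ->] := MVT_segment xy (fun z _ => fdf z) cf.
by rewrite normrM ler_piMl.
Qed.

Lemma sin_lip (R : realType) (x y : R) : `|sin x - sin y| <= `|x - y|.
Proof.
by apply: (lip1 _ _ (fun z => is_derive_sin z)) => z; exact: cos_max.
Qed.

Lemma cos_lip (R : realType) (x y : R) : `|cos x - cos y| <= `|x - y|.
Proof.
apply: (lip1 _ _ (fun z => is_derive_cos z)) => z.
by rewrite normrN; exact: sin_max.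
Qed.

Lemma expR_lip (R : realType) (x y : R) : x <= 1 -> y <= 1 ->
  `|expR x - expR y| <= expR 1 * `|x - y|.
Proof.
wlog xy : x y / y <= x.
  move=> H; have [yx|/ltW xy] := leP y x; first exact: H.
  by move=> ? ?; rewrite distrC [X in _ * X]distrC; exact: H.
move=> x1 y1; rewrite !ger0_norm ?subr_ge0 ?ler_expR//.
have -> : expR x - expR y = expR x * (1 - expR (y - x)).
  by rewrite mulrBr mulr1 -expRD (addrC x) subrK.
apply: ler_pM; rewrite ?expR_ge0 ?subr_ge0 ?ler_expR//.
  by rewrite -expR0 ler_expR subr_le0.
by have := expR_ge1Dx (y - x); lra.
Qed.

(** The bound is on s <= 1 rather than s <= 0, which leaves room for two-sided neighbourhoods of
    points with s <= 0. *)
Lemma polar_lip (R : realType) (s t s' t' : R) : s <= 1 -> s' <= 1 ->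
  cabs (polar s t - polar s' t') <= 2 * expR 1 * (`|s - s'| + `|t - t'|).
Proof.
move=> s1 s'1.
have H (f : R -> R) : `|f t| <= 1 -> `|f t - f t'| <= `|t - t'| ->
    `|expR s * f t - expR s' * f t'| <= expR 1 * (`|s - s'| + `|t - t'|).
  move=> ft ftt.
  have -> : expR s * f t - expR s' * f t' =
      (expR s - expR s') * f t + expR s' * (f t - f t') by ring.
  rewrite [leRHS]mulrDr (le_trans (ler_normD _ _))// !normrM lerD//.
    apply: le_trans (expR_lip s1 s'1); exact: ler_piMr.
  by apply: ler_pM => //; rewrite ger0_norm ?expR_ge0// ler_expR.
apply: le_trans (cabs_le_add _ _) _.
have := H cos (cos_max t) (cos_lip t t').
have := H sin (sin_max t) (sin_lip t t'); lra.
Qed.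

Section rect_form.
Variable R : realType.
Implicit Types U V : R -> R -> R.
Local Notation mu := (@lebesgue_measure R).
Local Notation J f a b := (\int[mu]_(x in `[a, b]) f x).

(* The imaginary part of the integral of [(U + iV) d(s + it)] along the
   boundary of the rectangle. *)
Definition rect_form U V s1 s2 t1 t2 :=
  J (fun t => U s2 t - U s1 t) t1 t2 - J (fun s => V s t2 - V s t1) s1 s2.

Definition half_cont U V :=
  (forall s t, s <= 0 -> {for t, continuous (U s)}) /\
  (forall s t, s <= 0 -> {for s, continuous (V ^~ t)}).

Lemma half_contU U V s1 s2 t1 t2 : half_cont U V -> s1 <= 0 -> s2 <= 0 ->
  cont_on (fun t => U s2 t - U s1 t) t1 t2.
Proof. by move=> [cU _] s10 s20; apply: cont_onB => t _; exact: cU. Qed.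

Lemma half_contV U V s1 s2 t1 t2 : half_cont U V -> s2 <= 0 ->
  cont_on (fun s => V s t2 - V s t1) s1 s2.
Proof.
move=> [_ cV] s20; apply: cont_onB => s /andP[_ ss]; apply: cV;
  exact: le_trans ss s20.
Qed.

Lemma rect_form_splits U V s1 s s2 t1 t2 : half_cont U V ->
  s1 <= s -> s <= s2 -> s2 <= 0 -> t1 <= t2 ->
  rect_form U V s1 s2 t1 t2 = rect_form U V s1 s t1 t2 + rect_form U V s s2 t1 t2.
Proof.
move=> c s1s ss2 s20 t12; rewrite /rect_form.
have s0 := le_trans ss2 s20; have s10 := le_trans s1s s0.
rewrite (segment_integral_split s1s ss2 (half_contV c s20)).
have -> : J (fun t => U s2 t - U s1 t) t1 t2 =
    J (fun t => U s t - U s1 t) t1 t2 + J (fun t => U s2 t - U s t) t1 t2.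
  rewrite -RintegralD//; first by apply: eq_Rintegral => t _; ring.
  - by apply: cont_on_integrable; exact: (half_contU c).
  - by apply: cont_on_integrable; exact: (half_contU c).
ring.
Qed.

Lemma rect_form_splitt U V s1 s2 t1 t t2 : half_cont U V ->
  t1 <= t -> t <= t2 -> s2 <= 0 -> s1 <= s2 ->
  rect_form U V s1 s2 t1 t2 = rect_form U V s1 s2 t1 t + rect_form U V s1 s2 t t2.
Proof.
move=> c t1t tt2 s20 s12; rewrite /rect_form.
have s10 := le_trans s12 s20.
rewrite (segment_integral_split t1t tt2 (half_contU c s10 s20)).
have -> : J (fun s => V s t2 - V s t1) s1 s2 =
    J (fun s => V s t - V s t1) s1 s2 + J (fun s => V s t2 - V s t) s1 s2.
  rewrite -RintegralD//; first by apply: eq_Rintegral => s _; ring.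
  - by apply: cont_on_integrable; exact: (half_contV c).
  - by apply: cont_on_integrable; exact: (half_contV c).
ring.
Qed.

Lemma rect_formB U V U' V' s1 s2 t1 t2 : half_cont U V -> half_cont U' V' ->
  s1 <= s2 -> s2 <= 0 ->
  rect_form (fun s t => U s t - U' s t) (fun s t => V s t - V' s t) s1 s2 t1 t2
  = rect_form U V s1 s2 t1 t2 - rect_form U' V' s1 s2 t1 t2.
Proof.
move=> c c' s12 s20; rewrite /rect_form; have s10 := le_trans s12 s20.
have -> : J (fun t => U s2 t - U' s2 t - (U s1 t - U' s1 t)) t1 t2 =
    J (fun t => U s2 t - U s1 t) t1 t2 - J (fun t => U' s2 t - U' s1 t) t1 t2.
  rewrite -segment_integralB; last 2 first.
  - exact: (half_contU c).
  - exact: (half_contU c').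
  by apply: eq_Rintegral => t _; ring.
have -> : J (fun s => V s t2 - V' s t2 - (V s t1 - V' s t1)) s1 s2 =
    J (fun s => V s t2 - V s t1) s1 s2 - J (fun s => V' s t2 - V' s t1) s1 s2.
  rewrite -segment_integralB; last 2 first.
  - exact: (half_contV c).
  - exact: (half_contV c').
  by apply: eq_Rintegral => s _; ring.
ring.
Qed.

Lemma rect_form_bound U V s1 s2 t1 t2 M : half_cont U V ->
  s1 <= s2 -> s2 <= 0 -> t1 <= t2 ->
  (forall s t, s1 <= s <= s2 -> t1 <= t <= t2 -> `|U s t| <= M /\ `|V s t| <= M) ->
  `|rect_form U V s1 s2 t1 t2| <= 2 * M * ((s2 - s1) + (t2 - t1)).
Proof.
move=> c s12 s20 t12 HM; have s10 := le_trans s12 s20.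
have s1i : s1 <= s1 <= s2 by rewrite lexx.
have s2i : s1 <= s2 <= s2 by rewrite lexx s12.
have t1i : t1 <= t1 <= t2 by rewrite lexx.
have t2i : t1 <= t2 <= t2 by rewrite lexx t12.
have HU : `|J (fun t => U s2 t - U s1 t) t1 t2| <= 2 * M * (t2 - t1).
  apply: segment_integral_bound => //; first exact: (half_contU c).
  move=> t tt; rewrite (le_trans (ler_normB _ _))// mulr_natl mulr2n.
  by rewrite lerD//; [have [] := HM s2 t s2i tt|have [] := HM s1 t s1i tt].
have HV : `|J (fun s => V s t2 - V s t1) s1 s2| <= 2 * M * (s2 - s1).
  apply: segment_integral_bound => //; first exact: (half_contV c).
  move=> s ss; rewrite (le_trans (ler_normB _ _))// mulr_natl mulr2n.
  by rewrite lerD//; [have [] := HM s t2 ss t2i|have [] := HM s t1 ss t1i].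
rewrite /rect_form (le_trans (ler_normB _ _))// mulrDr addrC lerD//.
Qed.

(** An affine g has the primitive c w + d exp w in the coordinate w = s + it. [F] and [G] are
    differences of Im (d exp w) across the rectangle; c has cancelled. *)
Lemma rect_form_polar (c d : Cx R) s1 s2 t1 t2 : s1 <= s2 -> t1 <= t2 ->
  rect_form (fun s t => complex.Re (c + d * polar s t))
    (fun s t => complex.Im (c + d * polar s t)) s1 s2 t1 t2 = 0.
Proof.
case: c d => [c1 c2] [d1 d2] s12 t12; rewrite /rect_form /=.
pose F t := (expR s2 - expR s1) * (d1 * sin t + d2 * cos t).
pose A := d1 * (sin t2 - sin t1) + d2 * (cos t2 - cos t1).
pose G s := expR s * A.
have dF t : is_derive t (1 : R) F
    ((expR s2 - expR s1) * (d1 * cos t - d2 * sin t)).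
  by apply: is_derive_eq; rewrite /GRing.scale/=; ring.
have dG s : is_derive s (1 : R) G (expR s * A).
  by apply: is_derive_eq; rewrite /GRing.scale/=; ring.
have -> : J (fun t => c1 + (d1 * (expR s2 * cos t) - d2 * (expR s2 * sin t)) -
    (c1 + (d1 * (expR s1 * cos t) - d2 * (expR s1 * sin t)))) t1 t2
    = F t2 - F t1.
  rewrite -(segment_FTC t12 dF).
    by apply: eq_Rintegral => t _; ring.
  move=> t; apply: cvgM; first exact: cvg_cst.
  by apply: cvgB; apply: cvgM;
    [exact: cvg_cst|exact: continuous_cos|
     exact: cvg_cst|exact: continuous_sin].
have -> : J (fun s => c2 + (d1 * (expR s * sin t2) + d2 * (expR s * cos t2)) -
    (c2 + (d1 * (expR s * sin t1) + d2 * (expR s * cos t1)))) s1 s2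
    = G s2 - G s1.
  rewrite -(segment_FTC s12 dG).
    by apply: eq_Rintegral => s _; rewrite /A; ring.
  by move=> s; apply: cvgM; [exact: continuous_expR|exact: cvg_cst].
by rewrite /F /G /A; ring.
Qed.

End rect_form.

Lemma cdiff_lip (R : realType) (g : Cx R -> Cx R) (z : Cx R) : cdiff g z ->
  exists2 C : R, 0 < C & exists2 del : R, 0 < del &
    forall w, cabs (w - z) < del -> cabs (g w - g z) <= C * cabs (w - z).
Proof.
move=> [d /(_ 1 ltr01)[del del0 H]].
exists (1 + cabs d); first by rewrite ltr_pwDl// cabs_ge0.
exists del => // w wz.
have -> : g w - g z = (g w - g z - d * (w - z)) + d * (w - z) by rewrite subrK.
rewrite (le_trans (cabsD _ _))// cabsM mulrDl lerD//; exact: H.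
Qed.

Lemma cdiff_affine (R : realType) (c d z : Cx R) : cdiff (fun w => c + d * w) z.
Proof.
exists d => e e0; exists 1 => // w _.
have -> : c + d * w - (c + d * z) - d * (w - z) = 0 by ring.
by rewrite cabs0 mulr_ge0 ?cabs_ge0// ltW.
Qed.

Lemma half_cont_cdiff (R : realType) (g : Cx R -> Cx R) :
  (forall z, cabs z <= 1 -> cdiff g z) ->
  half_cont (fun s t => complex.Re (g (polar s t)))
            (fun s t => complex.Im (g (polar s t))).
Proof.
move=> Hg.
pose K : R := 2 * expR 1.
have K0 : 0 < K by rewrite mulr_gt0// expR_gt0.
have key (s t e : R) : s <= 0 -> 0 < e -> exists2 eta : R, 0 < eta &
    forall s' t', `|s - s'| + `|t - t'| < eta ->
      cabs (g (polar s t) - g (polar s' t')) < e.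
  move=> s0 e0; have sz : cabs (polar s t) <= 1 by rewrite cabs_polar -expR0 ler_expR.
  have [C C0 [del del0 H]] := cdiff_lip (Hg _ sz).
  (* The bound 1 keeps s' <= 1, as [polar_lip] requires; the other two keep the image point within
     del and the change of g below e. *)
  exists (Num.min 1 (Num.min (del / K) (e / (C * K)))).
    by rewrite !lt_min ltr01 !divr_gt0// mulr_gt0.
  move=> s' t'; rewrite !lt_min => /and3P[h1 h2 h3].
  have s'1 : s' <= 1.
    have : `|s - s'| < 1 by apply: le_lt_trans h1; rewrite lerDl.
    by rewrite ltr_norml => /andP[? ?]; lra.
  have s1 : s <= 1 by lra.
  have := polar_lip t t' s1 s'1; rewrite -/K => hK.
  have h2' : cabs (polar s' t' - polar s t) < del.
    rewrite cabs_distC (le_lt_trans hK)//.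
    by move: h2; rewrite ltr_pdivlMr// mulrC.
  rewrite cabs_distC (le_lt_trans (H _ h2'))// cabs_distC.
  apply: (@le_lt_trans _ _ (C * (K * (`|s - s'| + `|t - t'|)))).
    by rewrite ler_pM2l.
  by move: h3; rewrite ltr_pdivlMr ?mulr_gt0// mulrA mulrC.
split => s t s0; apply/cvgrPdist_lt => e /(key s t e s0)[eta eta0 H];
  apply/nbhs_ballP; exists eta => //= x; rewrite /ball/= => dx; rewrite -raddfB.
- apply: le_lt_trans (Re_le_cabs _) _; apply: H.
  by rewrite subrr normr0 add0r.
- apply: le_lt_trans (Im_le_cabs _) _; apply: H.
  by rewrite subrr normr0 addr0.
Qed.

Lemma exp2_unbounded (R : realType) (x y : R) : 0 <= x -> 0 < y ->
  exists n, x / 2 ^+ n < y.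
Proof.
move=> x0 y0; exists (Num.bound (x / y)).
rewrite ltr_pdivrMr ?exprn_gt0// mulrC -ltr_pdivrMr//.
apply: lt_le_trans (archi_boundP _) _; first by rewrite divr_ge0// ltW.
by rewrite -natrX ler_nat ltnW// ltn_expl.
Qed.

(* Goursat's bisection for the form g(z) dz / z in the coordinates
   z = exp (s + it). *)
Lemma goursat_polar (R : realType) (g : Cx R -> Cx R) (s0 T : R) :
  (forall z, cabs z <= 1 -> cdiff g z) -> s0 <= 0 -> 0 < T ->
  rect_form (fun s t => complex.Re (g (polar s t)))
            (fun s t => complex.Im (g (polar s t))) s0 0 0 T = 0.
Proof.
move=> Hg s00 T0; have hc := half_cont_cdiff Hg.
set U := (X in rect_form X _) in hc *; set V := (X in rect_form _ X) in hc *.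
apply/eqP; apply: contrapT => /negP; rewrite -normr_gt0.
set c := `|_| => c0.
pose L := - s0.
have L0 : 0 <= L by rewrite oppr_ge0.
(* Bisection keeps a quarter that carries at least a quarter of the form; the first clause keeps it
   in s <= 0, over the closed unit disc. *)
pose P s t n := [/\ s + L / 2 ^+ n <= 0 &
  c / 4 ^+ n <= `|rect_form U V s (s + L / 2 ^+ n) t (t + T / 2 ^+ n)|].
have P0 : P s0 0 0%N.
  by rewrite /P !expr0 !divr1 add0r subrr; split.
have p2 n : 0 < (2 : R) ^+ n by rewrite exprn_gt0.
have [|s [t st]] := dyadic_rectangles L0 (ltW T0) P0.
  move=> s t n [sl0 cn].
  set l := L / 2 ^+ n.+1; set m := T / 2 ^+ n.+1.
  have l0 : 0 <= l by rewrite divr_ge0// ltW.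
  have m0 : 0 <= m by rewrite divr_ge0 ?(ltW T0)// ltW.
  have El : L / 2 ^+ n = l + l.
    by rewrite /l exprS; field; rewrite expf_neq0.
  have Em : T / 2 ^+ n = m + m.
    by rewrite /m exprS; field; rewrite expf_neq0.
  rewrite El in sl0.
  have key : rect_form U V s (s + (l + l)) t (t + (m + m)) =
     (rect_form U V s (s + l) t (t + m) +
      rect_form U V s (s + l) (t + m) (t + m + m)) +
     (rect_form U V (s + l) (s + l + l) t (t + m) +
      rect_form U V (s + l) (s + l + l) (t + m) (t + m + m)).
    rewrite (addrA s) (addrA t) (rect_form_splits (s := s + l) hc)//; [|lra..].
    rewrite (rect_form_splitt (t := t + m) hc)//; [|lra..].
    by rewrite (rect_form_splitt (s1 := s + l) (t := t + m) hc)//; first [lra|rewrite -addrA].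
  rewrite El Em key in cn.
  have c4 : c / 4 ^+ n = 4 * (c / 4 ^+ n.+1).
    by rewrite exprS; field; rewrite expf_neq0.
  rewrite c4 in cn.
  have sl1 : s + l <= 0 by lra.
  have sl2 : s + l + l <= 0 by rewrite -addrA.
  have bs0 : s <= s <= s + l by rewrite lexx lerDl.
  have bs1 : s <= s + l <= s + l by rewrite lexx lerDl l0.
  have bt0 : t <= t <= t + m by rewrite lexx lerDl.
  have bt1 : t <= t + m <= t + m by rewrite lexx lerDl m0.
  have [q1|q1] := leP (c / 4 ^+ n.+1) `|rect_form U V s (s + l) t (t + m)|.
    by exists s, t; split; [split; [exact: sl1|]|exact: bs0|exact: bt0].
  have [q2|q2] := leP (c / 4 ^+ n.+1)
      `|rect_form U V s (s + l) (t + m) (t + m + m)|.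
    by exists s, (t + m); split; [split; [exact: sl1|]|exact: bs0|exact: bt1].
  have [q3|q3] := leP (c / 4 ^+ n.+1)
      `|rect_form U V (s + l) (s + l + l) t (t + m)|.
    by exists (s + l), t; split; [split; [exact: sl2|]|exact: bs1|exact: bt0].
  have [q4|q4] := leP (c / 4 ^+ n.+1)
      `|rect_form U V (s + l) (s + l + l) (t + m) (t + m + m)|.
    by exists (s + l), (t + m); split; [split; [exact: sl2|]|exact: bs1|exact: bt1].
  exfalso; move: cn; apply/negP; rewrite -ltNge.
  apply: le_lt_trans (ler_normD _ _) _.
  apply: le_lt_trans (lerD (ler_normD _ _) (ler_normD _ _)) _.
  lra.
have s_le0 : s <= 0.
  have [s' [t' [[h _] /andP[_ h2] _]]] := st 0%N; exact: le_trans h2 h.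
have zD : cabs (polar s t) <= 1 by rewrite cabs_polar -expR0 ler_expR.
have [d Hd] := Hg _ zD.
pose K : R := 2 * expR 1.
have K0 : 0 < K by rewrite mulr_gt0// expR_gt0.
have LT : 0 < L + T by rewrite ltr_pwDr.
(* Chosen so that the error bound 2 e K (l + m)^2 on the n-th rectangle is half of c / 4^n. *)
pose e := c / (4 * K * (L + T) ^+ 2).
have e0 : 0 < e by rewrite divr_gt0// mulr_gt0 ?exprn_gt0// mulr_gt0.
have [del del0 H] := Hd _ e0.
have [n Hn] := exp2_unbounded (ltW (mulr_gt0 K0 LT)) del0.
have [s' [t' [[sl0 cn] /andP[ss1 ss2] /andP[tt1 tt2]]]] := st n.
move: sl0 cn ss2 tt2; set l := L / 2 ^+ n; set m := T / 2 ^+ n => sl0 cn ss2 tt2.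
have l0 : 0 <= l by rewrite divr_ge0// ltW.
have m0 : 0 <= m by rewrite divr_ge0 ?(ltW T0)// ltW.
pose w := polar s t.
(* The affine approximation of g at [w] has zero form, so the form of g equals that of the
   remainder, which is at most e |z - w|. *)
have hc0 := half_cont_cdiff (fun z _ => cdiff_affine (g w - d * w) d z).
have ss0 : s' <= s' + l by lra.
have tt0 : t' <= t' + m by lra.
have := rect_formB t' (t' + m) hc hc0 ss0 sl0.
rewrite rect_form_polar// subr0 => E.
have lmE : K * (l + m) = K * (L + T) / 2 ^+ n by rewrite /l /m; field; rewrite expf_neq0.
have hcB : half_cont
    (fun a b => U a b - complex.Re (g w - d * w + d * polar a b))
    (fun a b => V a b - complex.Im (g w - d * w + d * polar a b)).
  by split => a b ab; apply: continuousB; [exact: hc.1|exact: hc0.1|exact: hc.2|exact: hc0.2].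
have := @rect_form_bound R _ _ s' (s' + l) t' (t' + m) (e * (K * (l + m)))
  hcB ss0 sl0 tt0.
rewrite E => hb; have : `|rect_form U V s' (s' + l) t' (t' + m)| <=
    2 * (e * (K * (l + m))) * (s' + l - s' + (t' + m - t')).
  apply: hb => a b /andP[a1 a2] /andP[b1 b2].
  have hK : cabs (polar a b - w) <= K * (l + m).
    apply: le_trans (polar_lip _ _ _ _) _; [lra|lra|].
    rewrite ler_pM2l// lerD//; rewrite ler_norml; apply/andP; split; lra.
  have hd : cabs (g (polar a b) - (g w - d * w + d * polar a b)) <=
      e * (K * (l + m)).
    have -> : g (polar a b) - (g w - d * w + d * polar a b) =
      g (polar a b) - g w - d * (polar a b - w) by ring.
    apply: le_trans (H _ _) _; last by rewrite ler_pM2l.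
    by apply: le_lt_trans hK _; rewrite lmE.
  split; rewrite /U /V -raddfB; apply: le_trans hd.
    exact: Re_le_cabs.
  exact: Im_le_cabs.
apply/negP; rewrite -ltNge; apply: lt_le_trans cn.
have -> : 2 * (e * (K * (l + m))) * (s' + l - s' + (t' + m - t')) =
    c / 4 ^+ n / 2.
  rewrite /e /l /m (_ : 4 = 2 * 2)// ?exprMn; last by rewrite -natrM.
  by field; rewrite expf_neq0// !gt_eqF.
rewrite ltr_pdivrMr// ltr_pMr ?divr_gt0 ?exprn_gt0//.
by rewrite (ltr_nat R 1 2).
Qed.

Lemma cis_continuous_Re (R : realType) (g : Cx R -> Cx R) (a b : R) :
  (forall z, cabs z <= 1 -> cdiff g z) ->
  cont_on (fun t => complex.Re (g (cis t))) a b.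
Proof.
move=> Hg t _; have [cU _] := half_cont_cdiff Hg.
have := cU 0 t (lexx 0).
by rewrite (_ : (fun _ => _) = fun t => complex.Re (g (cis t)))//;
  apply/funext => x; rewrite polar0.
Qed.

(** The mean over |z| = exp s does not depend on s, because the two horizontal sides cancel by
    periodicity in t. As s tends to -oo it tends to the value at 0; the proof fixes one s small
    enough to refute a positive gap. *)
Lemma mean_value (R : realType) (g : Cx R -> Cx R) :
  (forall z, cabs z <= 1 -> cdiff g z) ->
  \int[@lebesgue_measure R]_(t in `[0, 2 * pi]) complex.Re (g (cis t)) =
  2 * pi * complex.Re (g 0).
Proof.
move=> Hg; have [cU cV] := half_cont_cdiff Hg.
have pi20 : 0 < 2 * pi :> R by rewrite mulr_gt0// pi_gt0.
have cU' s : s <= 0 ->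
    cont_on (fun t => complex.Re (g (polar s t))) 0 (2 * pi).
  by move=> s0 t _; exact: cU.
have cc : cont_on (fun=> complex.Re (g 0)) 0 (2 * pi :> R).
  by move=> t _; exact: cvg_cst.
set J := LHS.
have HJ s : s <= 0 -> \int[@lebesgue_measure R]_(t in `[0, 2 * pi])
    complex.Re (g (polar s t)) = J.
  move=> s0; have := goursat_polar Hg s0 pi20; rewrite /rect_form.
  rewrite (segment_integralB (cU' 0 (lexx 0)) (cU' s s0)).
  have -> : \int[lebesgue_measure]_(x in `[s, 0])
      (complex.Im (g (polar x (2 * pi))) - complex.Im (g (polar x 0))) = 0.
    rewrite (_ : (fun _ => _) = fun=> 0) ?Rintegral_cst ?mul0r//.
    apply/funext => x; rewrite /polar mulr_natl cos2pi sin2pi cos0 sin0.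
    by rewrite subrr.
  rewrite subr0 => /eqP; rewrite subr_eq0 => /eqP <-.
  by apply: eq_Rintegral => t _; rewrite polar0.
apply/eqP; rewrite -subr_eq0; apply: contrapT => /negP; rewrite -normr_gt0 => J0.
set e := `|_| in J0.
have z0 : cabs (0 : Cx R) <= 1 by rewrite cabs0.
have [C C0 [del del0 H]] := cdiff_lip (Hg _ z0).
(* C (del' / 2) 2 pi is then at most e / 4, and [del'] <= 1 gives s <= 0. *)
pose del' := Num.min 1 (Num.min del (e / (2 * C * (2 * pi)))).
have del'0 : 0 < del'.
  by rewrite !lt_min ltr01 del0 divr_gt0// mulr_gt0// mulr_gt0.
pose s := ln (del' / 2).
have sE : expR s = del' / 2 by rewrite lnK// posrE divr_gt0.
have d1 : del' <= 1 by rewrite ge_min lexx.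
have s0 : s <= 0 by rewrite ln_le0//; lra.
have : e <= C * (del' / 2) * (2 * pi - 0).
  rewrite /e -(HJ s s0).
  have -> : 2 * pi * complex.Re (g 0) =
      \int[@lebesgue_measure R]_(t in `[0, 2 * pi]) complex.Re (g 0).
    by rewrite Rintegral_cst// [X in fine X](lebesgue_segment (ltW pi20)) subr0 mulrC.
  rewrite -(segment_integralB (cU' s s0) cc).
  apply: segment_integral_bound; [exact: ltW|exact: cont_onB (cU' s s0) cc|].
  move=> t _; rewrite -raddfB (le_trans (Re_le_cabs _))//.
  have hw : cabs (polar s t - 0) < del.
    rewrite subr0 cabs_polar sE.
    have : del' <= del by rewrite !ge_min lexx orbT.
    lra.
  by have := H _ hw; rewrite subr0 cabs_polar sE.
have : del' <= e / (2 * C * (2 * pi)) by rewrite !ge_min lexx !orbT.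
rewrite ler_pdivlMr; last by rewrite mulr_gt0// mulr_gt0.
move: (J0); nra.
Qed.

(** * The Bergman kernel and the volume of a balanced domain *)

Lemma norm_Cx2_le (R : realType) (h : Cx2 R) :
  `|h| <= (cabs h.1 + cabs h.2)%:C%C.
Proof.
rewrite prod_normE !normCx.
have [h12|h21] := leP (cabs h.1) (cabs h.2).
  by rewrite max_r ?lecR// lerDr cabs_ge0.
by rewrite max_l ?lecR; [rewrite lerDl cabs_ge0|exact: ltW].
Qed.

Lemma cdiff_slice (R : realType) (f : Cx2 R -> Cx R) (z : Cx2 R) (l : Cx R) :
  differentiable f (l *: z) -> cdiff (fun l => f (l *: z)) l.
Proof.
move=> df; exists ('d f (l *: z) z) => e e0.
have := diff_locally df => /eqaddoP.
(* The summand 1 keeps [N] positive when z = 0. *)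
pose N := cabs z.1 + cabs z.2 + 1.
have N0 : 0 < N by rewrite ltr_wpDl// addr_ge0 ?cabs_ge0.
have eN : 0 < (e / N)%:C%C :> R[i] by rewrite ltcR divr_gt0.
move=> /(_ _ eN)/nbhs_Cx2P[del del0 H].
exists (del / N); first by rewrite divr_gt0.
move=> w; rewrite ltr_pdivlMr// => wl.
have z1N : cabs z.1 <= N.
  by rewrite /N; have := cabs_ge0 z.2; lra.
have z2N : cabs z.2 <= N.
  by rewrite /N; have := cabs_ge0 z.1; lra.
have h1 : cabs (((w - l) *: z).1 - 0) < del.
  rewrite subr0 [_.1](_ : _ = (w - l) * z.1)// cabsM.
  by apply: le_lt_trans wl; rewrite ler_wpM2l// cabs_ge0.
have h2 : cabs (((w - l) *: z).2 - 0) < del.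
  rewrite subr0 [_.2](_ : _ = (w - l) * z.2)// cabsM.
  by apply: le_lt_trans wl; rewrite ler_wpM2l// cabs_ge0.
have := H _ h1 h2.
have -> : (f \o shift (l *: z) - (cst (f (l *: z)) + 'd f (l *: z)))
    ((w - l) *: z) = f (w *: z) - f (l *: z) - 'd f (l *: z) z * (w - l).
  rewrite -[LHS]/(f ((w - l) *: z + l *: z) -
    (f (l *: z) + 'd f (l *: z) ((w - l) *: z))).
  by rewrite -scalerDl subrK linearZ opprD addrA mulrC.
have hN : `|(w - l) *: z| <= (cabs (w - l) * N)%:C%C.
  rewrite normrZ normCx rmorphM ler_wpM2l ?ler0c ?cabs_ge0//.
  by apply: le_trans (norm_Cx2_le z) _; rewrite lecR lerDl.
rewrite normCx => /le_trans/(_ (ler_wpM2l _ hN)); rewrite ler0c => /(_ _).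
rewrite -rmorphM lecR => HH; apply: le_trans (HH _) _.
  by rewrite divr_ge0// ltW.
by rewrite mulrCA divfK ?gt_eqF// mulrC.
Qed.

Lemma open_balanced_domain (R : realType) (h : Cx2 R -> R) :
  balanced_gauge h -> open (balanced_domain h).
Proof.
move=> [_ usc _].
have := (lower_semicontinuousP (fun x => - (h x)%:E)%E).1 usc (-1).
rewrite (_ : [set _ | _] = balanced_domain h)//; apply/seteqP.
by split => z /=; rewrite lte_fin ltrN2.
Qed.

(** * Averages over rotations *)

Lemma lebesgue4_sigma_finite (R : realType) : sigma_finite setT (@lebesgue4 R).
Proof.
have /sigma_finiteP[F [TF ndF Foo]] := @lebesgue2_sigma_finite R.
exists (fun n => F n `*` F n).
  rewrite -setXTT TF predeqE => -[x y]; split.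
    move=> [/= [n _ Fnx] [k _ Gky]]; exists (maxn n k) => //; split.
    - by move: x Fnx; exact/subsetPset/ndF/leq_maxl.
    - by move: y Gky; exact/subsetPset/ndF/leq_maxr.
  by move=> [n _ []/= ? ?]; split; exists n.
move=> k; have [mF Fk] := Foo k.
split; first exact: measurableX.
by rewrite /lebesgue4 product_measure1E// lte_mul_pinfty// ge0_fin_numE.
Qed.

HB.instance Definition _ (R : realType) := Measure_isSigmaFinite.Build _ _ _
  (@lebesgue4 R) (@lebesgue4_sigma_finite R).

(** Tonelli on [0, 2 pi] x T: for each fixed t the rotated integral is that of G, so the t-integral
    only contributes the factor 2 pi. One statement serves both the plane and C^2. *)
Lemma integral_rotation_average d (T : measurableType d) (R : realType)
    (mu : {sigma_finite_measure set T -> \bar R}) (rot : R -> T -> T)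
    (G : T -> \bar R) :
  measurable_fun setT (fun x : measurableTypeR R * T => rot x.1 x.2) ->
  (forall t F, measurable_fun setT F -> (forall x, (0 <= F x)%E) ->
    (\int[mu]_x F (rot t x) = \int[mu]_x F x)%E) ->
  measurable_fun setT G -> (forall x, (0 <= G x)%E) ->
  measurable_fun setT (fun x =>
    \int[@lebesgue_measure R]_(t in `[0%R, (2 * pi)%R]) G (rot t x))%E /\
  ((2 * pi)%:E * \int[mu]_x G x =
   \int[mu]_x \int[@lebesgue_measure R]_(t in `[0%R, (2 * pi)%R]) G (rot t x))%E.
Proof.
move=> mrot irot mG G0.
pose F (x : measurableTypeR R * T) :=
  ((\1_`[0%R, (2 * pi)%R] x.1)%:E * G (rot x.1 x.2))%E.
have mF : measurable_fun setT F.
  apply: emeasurable_funM.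
    by do 2 apply: measurableT_comp => //.
  exact: (measurableT_comp mG mrot).
have F0 x : (0 <= F x)%E by rewrite mule_ge0// lee_fin.
have E1 := @fubini_tonelli1 _ _ _ _ R (@lebesgue_measure R) mu F mF F0.
have E2 := @fubini_tonelli2 _ _ _ _ R (@lebesgue_measure R) mu F mF F0.
rewrite E1 in E2.
have mG' t : measurable_fun setT (fun x => G (rot t x)).
  exact: (measurableT_comp mG (measurableT_comp mrot (pair1_measurable t))).
have L4 t : fubini_F mu F t =
    ((\1_`[0%R, (2 * pi)%R] t)%:E * \int[mu]_x G x)%E.
  by rewrite /fubini_F /F /= ge0_integralZl// irot.
have L1 x : fubini_G (@lebesgue_measure R) F x =
    (\int[@lebesgue_measure R]_(t in `[0%R, (2 * pi)%R]) G (rot t x))%E.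
  rewrite /fubini_G /F [RHS]integral_mkcond; apply: eq_integral => t0 _.
  by rewrite /= patchE indicE; case: ifP => _; rewrite ?mul1e ?mul0e.
split.
  have := @measurable_fun_fubini_tonelli_G _ _ _ _ R (@lebesgue_measure R) F mF F0.
  by apply: eq_measurable_fun => x _; rewrite L1.
apply/esym; transitivity (\int[mu]_x fubini_G (@lebesgue_measure R) F x)%E.
  by apply: eq_integral => x _; rewrite L1.
rewrite -E2; transitivity (\int[@lebesgue_measure R]_t
    ((\1_`[0%R, (2 * pi)%R] t)%:E * \int[mu]_x G x))%E.
  by apply: eq_integral => t0 _; rewrite -L4.
rewrite ge0_integralZr//; [|exact: measurableT_comp|exact: integral_ge0].
by rewrite integral_indic// setIT [X in (X * _)%E]lebesgue_segment ?subr0// mulr_ge0// pi_ge0.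
Qed.

Lemma integral4_circle (R : realType) (G : Cx2 R -> \bar R) :
  measurable_fun setT
    (G \o @toC2 R : (measurableTypeR R * measurableTypeR R) *
                    (measurableTypeR R * measurableTypeR R) -> _) ->
  (forall x, (0 <= G x)%E) ->
  measurable_fun setT (fun p : (measurableTypeR R * measurableTypeR R) *
      (measurableTypeR R * measurableTypeR R) =>
    \int[@lebesgue_measure R]_(t in `[0%R, (2 * pi)%R])
     G (cis t *: toC2 p)%R)%E /\
  ((2 * pi)%:E * \int[@lebesgue4 R]_p G (toC2 p) =
   \int[@lebesgue4 R]_p \int[@lebesgue_measure R]_(t in `[0%R, (2 * pi)%R])
     G (cis t *: toC2 p)%R)%E.
Proof.
move=> mG G0.
(* Sums are ordered as in the product of [R[i]], so that [rotE] holds by computation. *)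
pose rot t (p : R * R * (R * R)) :=
   ((cos t * p.1.1 - sin t * p.1.2, cos t * p.1.2 + sin t * p.1.1),
    (cos t * p.2.1 - sin t * p.2.2, cos t * p.2.2 + sin t * p.2.1)).
have mrot : measurable_fun setT (fun x : measurableTypeR R *
    ((measurableTypeR R * measurableTypeR R) *
                    (measurableTypeR R * measurableTypeR R)) => rot x.1 x.2).
  have mc : measurable_fun setT (fun x : measurableTypeR R *
      ((measurableTypeR R * measurableTypeR R) *
                    (measurableTypeR R * measurableTypeR R)) => cos x.1).
    apply: measurableT_comp; last exact: measurable_fst.
    by apply: continuous_measurable_fun; exact: continuous_cos.
  have ms : measurable_fun setT (fun x : measurableTypeR R *
      ((measurableTypeR R * measurableTypeR R) *
                    (measurableTypeR R * measurableTypeR R)) => sin x.1).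
    apply: measurableT_comp; last exact: measurable_fst.
    by apply: continuous_measurable_fun; exact: continuous_sin.
  
  have m21 := measurableT_comp measurable_fst (@measurable_snd _ _
    (measurableTypeR R) ((measurableTypeR R * measurableTypeR R) *
                    (measurableTypeR R * measurableTypeR R))%type).
  have m22 := measurableT_comp measurable_snd (@measurable_snd _ _
    (measurableTypeR R) ((measurableTypeR R * measurableTypeR R) *
                    (measurableTypeR R * measurableTypeR R))%type).
  have m211 := measurableT_comp measurable_fst m21.
  have m212 := measurableT_comp measurable_snd m21.
  have m221 := measurableT_comp measurable_fst m22.
  have m222 := measurableT_comp measurable_snd m22.
  apply: measurable_fun_pair; apply: measurable_fun_pair.
  - exact: measurable_funB (measurable_funM mc m211) (measurable_funM ms m212).
  - exact: measurable_funD (measurable_funM mc m212) (measurable_funM ms m211).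
  - exact: measurable_funB (measurable_funM mc m221) (measurable_funM ms m222).
  - exact: measurable_funD (measurable_funM mc m222) (measurable_funM ms m221).
have rotE t p : toC2 (rot t p) = cis t *: toC2 p by [].
apply: (@integral_rotation_average _ _ R (@lebesgue4 R) _ _ mrot _ mG
  (fun p => G0 (toC2 p))) => t F mF F0.
(* Invariance is known for functions on C^2, so F is carried over through real and imaginary
   parts. *)
pose F' (z : Cx2 R) := F ((complex.Re z.1, complex.Im z.1), (complex.Re z.2, complex.Im z.2)).
have E (p : R * R * (R * R)) : F' (toC2 p) = F p by case: p => [[? ?] [? ?]].
have := @integral4_rotate R F' (cis t) (cabs_cis t).
have -> : F' \o @toC2 R = F by apply/funext => p; rewrite /= -E.
move=> /(_ mF (fun z => F0 _)) H.
transitivity (\int[@lebesgue4 R]_p F' (cis t *: toC2 p)%R)%E; first by [].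
by rewrite H; apply: eq_integral => p _; rewrite E.
Qed.

Lemma integral2_circle (R : realType) (G : Cx R -> \bar R) :
  measurable_fun setT
    (G \o @toC R : measurableTypeR R * measurableTypeR R -> _) ->
  (forall x, (0 <= G x)%E) ->
  measurable_fun setT (fun p : measurableTypeR R * measurableTypeR R =>
    \int[@lebesgue_measure R]_(t in `[0%R, (2 * pi)%R])
     G (cis t * toC p)%R)%E /\
  ((2 * pi)%:E * \int[@lebesgue2 R]_p G (toC p) =
   \int[@lebesgue2 R]_p \int[@lebesgue_measure R]_(t in `[0%R, (2 * pi)%R])
     G (cis t * toC p)%R)%E.
Proof.
move=> mG G0.
pose rot t (p : R * R) :=
   (cos t * p.1 - sin t * p.2, cos t * p.2 + sin t * p.1).
have mrot : measurable_fun setT (fun x : measurableTypeR R *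
    (measurableTypeR R * measurableTypeR R) => rot x.1 x.2).
  have mc : measurable_fun setT (fun x : measurableTypeR R *
      (measurableTypeR R * measurableTypeR R) => cos x.1).
    apply: measurableT_comp; last exact: measurable_fst.
    by apply: continuous_measurable_fun; exact: continuous_cos.
  have ms : measurable_fun setT (fun x : measurableTypeR R *
      (measurableTypeR R * measurableTypeR R) => sin x.1).
    apply: measurableT_comp; last exact: measurable_fst.
    by apply: continuous_measurable_fun; exact: continuous_sin.
  have m21 := measurableT_comp measurable_fst (@measurable_snd _ _
    (measurableTypeR R) (measurableTypeR R * measurableTypeR R)%type).
  have m22 := measurableT_comp measurable_snd (@measurable_snd _ _
    (measurableTypeR R) (measurableTypeR R * measurableTypeR R)%type).
  apply: measurable_fun_pair.
  - exact: measurable_funB (measurable_funM mc m21) (measurable_funM ms m22).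
  - exact: measurable_funD (measurable_funM mc m22) (measurable_funM ms m21).
have rotE t p : toC (rot t p) = cis t * toC p by [].
apply: (@integral_rotation_average _ _ R (@lebesgue2 R) _ _ mrot _ mG
  (fun p => G0 (toC p))) => t F mF F0.
pose F' (z : Cx R) := F (complex.Re z, complex.Im z).
have E (p : R * R) : F' (toC p) = F p by case: p => [? ?].
have c0 : cis t != 0 by rewrite -cabs_gt0 cabs_cis.
have := @integral_scale R F' (cis t) c0.
have -> : F' \o @toC R = F by apply/funext => p; rewrite /= -E.
move=> /(_ mF (fun z => F0 _)); rewrite cabs_cis expr1n invr1 mul1e => H.
transitivity (\int[@lebesgue2 R]_p F' (cis t * toC p)%R)%E; first by [].
by rewrite H; apply: eq_integral => p _; rewrite E.
Qed.

(** * Measurability by semicontinuity, and square means on circles *)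

Lemma open_preimage_measurable d (T : measurableType d) (R : realType)
    (F : T -> \bar R) :
  (forall a : R, measurable [set x | (a%:E < F x)%E]) -> measurable_fun setT F.
Proof.
move=> H; apply: (measurability _ (ErealGenOInfty.measurableE R)).
move=> /= _ [_ [a ->]] <-; rewrite setTI preimage_itvoy; exact: H.
Qed.

Lemma lsc_measurable4 (R : realType) (F : Cx2 R -> \bar R) :
  (forall a : R, open [set x | (a%:E < F x)%E]) ->
  measurable_fun setT
    (F \o @toC2 R : (measurableTypeR R * measurableTypeR R) *
                    (measurableTypeR R * measurableTypeR R) -> _).
Proof.
move=> H; apply: open_preimage_measurable => a.
exact: (toC2_open_measurable (H a)).
Qed.

Lemma lsc_measurable2 (R : realType) (F : Cx R -> \bar R) :
  (forall a : R, open [set x | (a%:E < F x)%E]) ->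
  measurable_fun setT
    (F \o @toC R : measurableTypeR R * measurableTypeR R -> _).
Proof.
move=> H; apply: open_preimage_measurable => a.
exact: (toC_open_measurable (H a)).
Qed.

Lemma cdiff_scale (R : realType) (g : Cx R -> Cx R) (c z : Cx R) :
  cdiff g z -> cdiff (fun w => c * g w) z.
Proof.
move=> [d Hd]; exists (c * d) => e e0.
have c1 : 0 < cabs c + 1 by rewrite ltr_wpDl// cabs_ge0.
have [del del0 H] := Hd _ (divr_gt0 e0 c1).
exists del => // w /H hw.
have -> : c * g w - c * g z - c * d * (w - z) = c * (g w - g z - d * (w - z)).
  by ring.
rewrite cabsM; apply: le_trans (ler_wpM2l (cabs_ge0 c) hw) _.
rewrite mulrA ler_wpM2r ?cabs_ge0// mulrCA ler_piMr ?(ltW e0)//.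
by rewrite ler_pdivrMr// mul1r lerDl.
Qed.

Lemma Re_conjM (R : realType) (z w : Cx R) :
  complex.Re (conjc z * w) = complex.Re z * complex.Re w + complex.Im z * complex.Im w.
Proof. by case: z w => [a b] [c d] /=; ring. Qed.

Lemma cabs_sqrE (R : realType) (z : Cx R) :
  cabs z ^+ 2 = complex.Re z ^+ 2 + complex.Im z ^+ 2.
Proof. by case: z => a b; rewrite cabs_sqr. Qed.

(** Integrates |g - g(0)|^2 >= 0 over the circle: the cross term 2 Re (conj g(0) g) is evaluated by
    the mean value property of conj g(0) g. *)
Lemma mean_square_ge (R : realType) (g : Cx R -> Cx R) :
  (forall z, cabs z <= 1 -> cdiff g z) ->
  ((2 * pi * cabs (g 0) ^+ 2)%:E <= \int[@lebesgue_measure R]_(t in `[0%R, (2 * pi)%R])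
    (cabs (g (cis t)) ^+ 2)%:E)%E.
Proof.
move=> Hg.
have pi20 : 0 <= 2 * pi :> R by rewrite mulr_ge0// pi_ge0.
(* Im g is the real part of -i g, so continuity of real parts along the circle suffices. *)
have HIm z : cabs z <= 1 -> cdiff (fun w => - 'i%C * g w) z.
  by move=> /Hg; exact: cdiff_scale.
have Hc z : cabs z <= 1 -> cdiff (fun w => conjc (g 0) * g w) z.
  by move=> /Hg; exact: cdiff_scale.
have cRe := @cis_continuous_Re R g 0 (2 * pi) Hg.
have cIm := @cis_continuous_Re R _ 0 (2 * pi) HIm.
have ccj := @cis_continuous_Re R _ 0 (2 * pi) Hc.
have csq : cont_on (fun t => cabs (g (cis t)) ^+ 2) 0 (2 * pi).
  move=> t ht; rewrite (_ : (fun _ => _) = (fun t => complex.Re (g (cis t)) ^+ 2 +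
      complex.Re (- 'i%C * g (cis t)) ^+ 2)).
    by apply: cvgD; apply: cvgM; [exact: cRe|exact: cRe|exact: cIm|exact: cIm].
  apply/funext => x; rewrite cabs_sqrE; case: (g (cis x)) => a b /=; ring.
have intsq := cont_on_integrable csq.
have -> : (\int[@lebesgue_measure R]_(t in `[0%R, (2 * pi)%R]) (cabs (g (cis t)) ^+ 2)%:E
   = (\int[@lebesgue_measure R]_(t in `[0%R, (2 * pi)%R]) (cabs (g (cis t)) ^+ 2)%R)%:E)%E.
  by rewrite /Rintegral fineK//; exact: integrable_fin_num.
rewrite lee_fin.
have := mean_value Hc.
pose c := cabs (g 0) ^+ 2 => E.
have ccst : cont_on (fun _ : R => c) 0 (2 * pi) by move=> t _; exact: cvg_cst.
have : \int[@lebesgue_measure R]_(t in `[0%R, (2 * pi)%R])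
   (complex.Re (conjc (g 0) * g (cis t)) - c) <=
   \int[@lebesgue_measure R]_(t in `[0%R, (2 * pi)%R])
    (cabs (g (cis t)) ^+ 2 - complex.Re (conjc (g 0) * g (cis t))).
  apply: le_Rintegral => //.
  - by apply: cont_on_integrable; exact: cont_onB.
  - by apply: cont_on_integrable; exact: cont_onB.
  - move=> t _; rewrite Re_conjM /c !cabs_sqrE.
    have := sqr_ge0 (complex.Re (g (cis t)) - complex.Re (g 0)).
    have := sqr_ge0 (complex.Im (g (cis t)) - complex.Im (g 0)).
    by move: (complex.Re _) (complex.Im _) (complex.Re _) (complex.Im _) => x y z w; lra.
rewrite !segment_integralB// E Rintegral_cst// [X in fine X](lebesgue_segment pi20).
rewrite Re_conjM -!expr2 -cabs_sqrE -/c subr0 /=; lra.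
Qed.

Lemma balanced_domain_scale (R : realType) (h : Cx2 R -> R) (z : Cx2 R)
    (l : Cx R) : balanced_gauge h -> cabs l <= 1 ->
  balanced_domain h z -> balanced_domain h (l *: z).
Proof.
move=> [h0 _ hom] l1 hz; rewrite /balanced_domain/= hom.
by apply: le_lt_trans hz; rewrite ler_piMl.
Qed.

Lemma measurable_domain (R : realType) (h : Cx2 R -> R) : balanced_gauge h ->
  measurable (@toC2 R @^-1` balanced_domain h :
    set ((measurableTypeR R * measurableTypeR R) *
         (measurableTypeR R * measurableTypeR R))).
Proof. by move=> /open_balanced_domain; exact: toC2_open_measurable. Qed.

Lemma cabs_lip (R : realType) (z w : Cx R) : `|cabs z - cabs w| <= cabs (z - w).
Proof.
rewrite ler_norml; apply/andP; split.
- rewrite lerNl opprB lerBlDr cabs_distC.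
  by apply: le_trans (cabsD _ _); rewrite subrK.
- by rewrite lerBlDr; apply: le_trans (cabsD _ _); rewrite subrK.
Qed.

(** Makes |f|^2 times the indicator of D lower semicontinuous, hence measurable, whatever the values
    of f off D. *)
Lemma holomorphic_sq_open (R : realType) (D : set (Cx2 R))
    (f : Cx2 R -> Cx R) (a : R) : open D -> holomorphic D f -> 0 <= a ->
  open (D `&` [set z | a < cabs (f z) ^+ 2]).
Proof.
move=> oD hf a0; rewrite openE => z [Dz afz]; rewrite /interior.
have cf : {for z, continuous f} := differentiable_continuous (hf z Dz).
pose e := cabs (f z) - Num.sqrt a.
have e0 : 0 < e.
  rewrite subr_gt0 -(ger0_norm (cabs_ge0 (f z))) -sqrtr_sqr.
  by rewrite ltr_sqrt// (le_lt_trans a0).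
have nf : nbhs (f z) [set w | cabs (w - f z) < e] by apply/nbhs_CxP; exists e.
have nD : nbhs z D by exact: open_nbhs_nbhs.
apply: filterS (filterI nD (cf _ nf)) => w [Dw /= fw]; split => //.
have /ltr_normlP[hw _] : `|cabs (f w) - cabs (f z)| < e.
  by apply: le_lt_trans fw; exact: cabs_lip.
have : Num.sqrt a < cabs (f w) by move: hw; rewrite /e; lra.
rewrite -{2}(sqr_sqrtr a0) => H.
by rewrite ltr_pXn2r// ?nnegrE ?cabs_ge0 ?sqrtr_ge0.
Qed.

Lemma lnorm_sq_fin (R : realType) (D : set (Cx2 R)) (f : Cx2 R -> Cx R) :
  (L2norm D f < +oo)%E ->
  (\int[@lebesgue4 R]_p ((cabs (f (toC2 p)) ^+ 2)%:E * (\1_D (toC2 p))%:E) < +oo)%E.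
Proof.
rewrite /L2norm unlock => /lty_poweRy; rewrite invr_eq0 pnatr_eq0 => /(_ isT).
congr (_ < _)%E; apply: eq_integral => p _ /=.
rewrite patchE indicE.
have -> : (p \in @toC2 R @^-1` D) = (toC2 p \in D) by apply/idP/idP => /set_mem/mem_set.
case: ifP => _; last by rewrite abse0 mule0 poweR0r// pnatr_eq0.
by rewrite mule1 poweR_EFin ger0_norm ?cabs_ge0// powR_mulrn ?cabs_ge0.
Qed.

Lemma measurable_indic_preimage d (T : measurableType d) (U : Type)
    (R : realType) (phi : T -> U) (A : set U) : measurable (phi @^-1` A) ->
  measurable_fun setT (fun p => (\1_A (phi p) : R)%:E).
Proof.
move=> mA; apply/measurable_EFinP.
rewrite (_ : (fun _ => _) = \1_(phi @^-1` A)); first exact: measurable_indic.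
by apply/funext => p; rewrite !indicE; congr (nat_of_bool _)%:R;
  apply/idP/idP => /set_mem/mem_set.
Qed.

Lemma bergman_volume (R : realType) (h : Cx2 R -> R) : balanced_gauge h ->
  (0 < bergman_kernel (balanced_domain h) 0%R)%E ->
  (volume (balanced_domain h) < +oo)%E.
Proof.
move=> hg /ereal_sup_gt[_ [f [[hf f2] _] <-]]; rewrite lte_fin => f0.
have oD := open_balanced_domain hg.
set D := balanced_domain h in hf f2 oD *.
pose G z := ((cabs (f z) ^+ 2)%:E * (\1_D z)%:E)%E.
have G0 z : (0 <= G z)%E by rewrite mule_ge0// lee_fin ?sqr_ge0.
have mG : measurable_fun setT
    (G \o @toC2 R : (measurableTypeR R * measurableTypeR R) *
                    (measurableTypeR R * measurableTypeR R) -> _).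
  apply: lsc_measurable4 => a; have [a0|a0] := ltP a 0.
    rewrite (_ : [set _ | _] = setT); first exact: openT.
    by apply/seteqP; split => // z _ /=; rewrite (lt_le_trans _ (G0 z))// lte_fin.
  rewrite (_ : [set _ | _] = D `&` [set z | a < cabs (f z) ^+ 2]).
    exact: holomorphic_sq_open.
  apply/seteqP; split => z /=; rewrite /G indicE.
    have [/set_mem Dz|_] := boolP (z \in D); first by rewrite mule1 lte_fin.
    by rewrite mule0 lte_fin ltNge a0.
  by move=> [Dz ?]; rewrite mem_set// mule1 lte_fin.
have IG := lnorm_sq_fin f2.
have pi20 : 0 < 2 * pi :> R by rewrite mulr_gt0// pi_gt0.
have c0 : 0 < 2 * pi * cabs (f 0) ^+ 2 by rewrite mulr_gt0.
have mD := measurable_domain hg.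
have [mI EI] := integral4_circle mG G0.
have key : ((2 * pi * cabs (f 0) ^+ 2)%:E * volume D <=
    (2 * pi)%:E * \int[@lebesgue4 R]_p G (toC2 p))%E.
  rewrite EI volumeE// -ge0_integralZl//; last 2 first.
  - exact: measurable_indic_preimage.
  - by rewrite lee_fin ltW.
  apply: ge0_le_integral => //.
  - by move=> x _; rewrite mule_ge0// lee_fin// ltW.
  - by apply: emeasurable_funM => //; exact: measurable_indic_preimage.
- move=> p _; rewrite indicE.
  have [/set_mem Dp|_] := boolP (toC2 p \in D); last first.
    by rewrite mule0; exact: integral_ge0.
  rewrite mule1.
  (* With p the domain contains all l p with |l| <= 1, so the slice of f is differentiable up to the
     unit circle. *)
  have Dl l : cabs l <= 1 -> D (l *: toC2 p).
    by move=> l1; exact: balanced_domain_scale.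
  have Hg l : cabs l <= 1 -> cdiff (fun l => f (l *: toC2 p)) l.
    by move=> /Dl/hf; exact: cdiff_slice.
  have := mean_square_ge Hg; rewrite scale0r => /le_trans; apply.
  rewrite le_eqVlt; apply/orP; left; apply/eqP; apply: eq_integral => t _.
  by rewrite /G indicE mem_set ?mule1//; apply: Dl; rewrite cabs_cis.
have : ((2 * pi * cabs (f 0) ^+ 2)%:E * volume D < +oo)%E.
  by apply: le_lt_trans key _; rewrite lte_mul_pinfty// ?lee_fin ?ltW.
by case: (volume D) => [r _||] //; [exact: ltry|rewrite gt0_muley ?lte_fin].
Qed.

Lemma volume_bergman (R : realType) (h : Cx2 R -> R) (z : Cx2 R) :
  balanced_gauge h -> (volume (balanced_domain h) < +oo)%E ->
  (0 < bergman_kernel (balanced_domain h) z)%E.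
Proof.
move=> hg vfin; have mD := measurable_domain hg.
set D := balanced_domain h in vfin mD *.
have v0 : (0 <= volume D)%E by exact: measure_ge0.
pose v := fine (volume D).
have vE : volume D = v%:E by rewrite fineK// ge0_fin_numE.
have {}v0 : 0 <= v by rewrite fine_ge0.
(* With this constant c^2 v <= 1 holds for v = 0 too, and no square root is involved. *)
pose c := (1 + v)^-1.
have c0 : 0 < c by rewrite invr_gt0 ltr_pwDl.
pose f : Cx2 R -> Cx R := fun=> c%:C%C.
have N1 : (L2norm D f <= 1)%E.
  rewrite /L2norm unlock.
  have -> : (\int[@lebesgue4 R]_x
    `|((fun p => (cabs (f (toC2 p)))%:E) \_ (@toC2 R @^-1` D)) x| `^ 2 =
    (c ^+ 2 * v)%:E)%E.
    transitivity (\int[@lebesgue4 R]_p ((c ^+ 2)%:E * (\1_D (toC2 p))%:E))%E.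
      apply: eq_integral => p _; rewrite patchE indicE.
      have -> : (p \in @toC2 R @^-1` D) = (toC2 p \in D) by apply/idP/idP => /set_mem/mem_set.
      case: ifP => _; last by rewrite abse0 mule0 poweR0r// pnatr_eq0.
      rewrite mule1 /f cabs_real poweR_EFin normr_id ger0_norm ?ltW//.
      by rewrite powR_mulrn// ltW.
    rewrite ge0_integralZl//; last 2 first.
    - exact: measurable_indic_preimage.
    - by rewrite lee_fin sqr_ge0.
    by rewrite -volumeE// vE EFinM.
  have E1 : 1 = 1 `^ (2^-1) :> R by rewrite powR1.
  rewrite poweR_EFin lee_fin [leRHS]E1.
  apply: ge0_ler_powR; rewrite ?nnegrE ?invr_ge0 ?mulr_ge0 ?sqr_ge0 ?(ltW c0)//.
  have cv : c * (1 + v) = 1 by rewrite mulVf// gt_eqF// ltr_pwDl.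
  have c1 : c <= 1 by rewrite invf_le1 ?lerDl// ltr_pwDl.
  nra.
apply: (@lt_le_trans _ _ (c ^+ 2)%:E); first by rewrite lte_fin exprn_gt0.
apply: ereal_sup_ubound; exists f; last by rewrite /f cabs_real ger0_norm ?ltW.
split => //; split; last by apply: le_lt_trans N1 _; rewrite ltry.
by move=> w _; exact: differentiable_cst.
Qed.

(** * Lelong numbers *)

Lemma ereal_between (R : realType) (x y : \bar R) : (x < y)%E ->
  exists c : R, (x < c%:E < y)%E.
Proof.
case: x y => [a||] [b||] //; rewrite ?lte_fin => ab.
- by exists ((a + b) / 2); rewrite !lte_fin; apply/andP; split; lra.
- by exists (a + 1); rewrite lte_fin ltry ltrDl ltr01.
- by exists (b - 1); rewrite lte_fin ltNyr/= ltrBlDr ltrDl.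
- by exists 0; rewrite ltNyr ltry.
Qed.

(** Were the supremum not attained, each point would have a neighbourhood on which F stays below a
    constant less than it; compactness gives one such constant on all of K. *)
Lemma usc_compact_max (T : topologicalType) (R : realType) (K : set T)
    (F : T -> \bar R) :
  compact K -> K !=set0 ->
  (forall x (c : R), K x -> (F x < c%:E)%E -> \forall y \near x, (F y < c%:E)%E) ->
  exists2 x, K x & forall y, K y -> (F y <= F x)%E.
Proof.
move=> cK [x0 Kx0] usc; apply: contrapT => nmax.
pose S := ereal_sup (F @` K).
have leS y : K y -> (F y <= S)%E by move=> Ky; apply: ereal_sup_ubound; exists y.
have ltS x : K x -> (F x < S)%E.
  move=> Kx; rewrite ltNge; apply/negP => SF; apply: nmax.
  by exists x => // y Ky; exact: le_trans (leS y Ky) SF.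
have [c [cS Hc]] : exists c, (c < S)%E /\ forall y, K y -> (F y <= c)%E.
  apply: (compact_local_to_global
    (P := fun A => exists c, (c < S)%E /\ forall y, A y -> (F y <= c)%E)) cK _ _ _ _.
  - by exists (F x0); split => //; exact: ltS.
  - by move=> A B AB [c [? Hc]]; exists c; split => // y /AB; exact: Hc.
  - move=> A B [c [cS Hc]] [d [dS Hd]]; exists (Order.max c d).
    rewrite gt_max cS dS; split => // y; rewrite le_max => -[/Hc->//|/Hd->].
    by rewrite orbT.
  - move=> x Kx; have [c /andP[Fc cS]] : exists c : R, (F x < c%:E < S)%E.
      exact: ereal_between (ltS x Kx).
    exists [set y | (F y < c%:E)%E]; first exact: usc.
    by exists c%:E; split => // y [_ /= /ltW].
have : (S <= c)%E by apply: ge_ereal_sup => _ [y Ky <-]; exact: Hc.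
by rewrite leNgt cS.
Qed.

(** Positive and negative parts are compared separately, so neither side has to be integrable: on a
    circle u may have integral -oo. *)
Lemma le_integral_of_le_integrable d (T : measurableType d) (R : realType)
    (mu : {measure set T -> \bar R}) (D : set T) (f g : T -> \bar R) :
  measurable D -> measurable_fun D f -> measurable_fun D g ->
  (forall x, D x -> (f x <= g x)%E) ->
  (\int[mu]_(x in D) f x <= \int[mu]_(x in D) g x)%E.
Proof.
move=> mD mf mg fg; rewrite integralE [leRHS]integralE; apply: leeB.
- apply: ge0_le_integral => //.
  + exact: measurable_funepos.
  + exact: measurable_funepos.
  + by move=> x Dx; apply: (@funepos_le _ _ D); [move=> y /set_mem; exact: fg|exact: mem_set].
- apply: ge0_le_integral => //.
  + exact: measurable_funeneg.
  + exact: measurable_funeneg.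
  + by move=> x Dx; apply: (@funeneg_le _ _ D); [move=> y /set_mem; exact: fg|exact: mem_set].
Qed.

(** * Comparison with logarithms on annuli *)

(** Quadratic polynomials in cos t are the only majorants of u on circles whose means are
    computed. *)
Lemma integral_trig2 (R : realType) (p0 p1 p2 : R) :
  (\int[@lebesgue_measure R]_(t in `[0%R, (2 * pi)%R])
    (p0 + p1 * cos t + p2 * cos t ^+ 2)%:E = (2 * pi * (p0 + p2 / 2))%:E)%E.
Proof.
have pi20 : 0 <= 2 * pi :> R by rewrite mulr_ge0// pi_ge0.
pose f t : R := p0 + p1 * cos t + p2 * cos t ^+ 2.
pose F (t : R) := p0 * t + p1 * sin t + p2 * ((t + sin t * cos t) / 2).
have cf : continuous f.
  move=> t; apply: cvgD; first (apply: cvgD; first exact: cvg_cst).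
    by apply: cvgM; [exact: cvg_cst|exact: continuous_cos].
  by apply: cvgM; [exact: cvg_cst|apply: cvgM; exact: continuous_cos].
have dF t : is_derive t (1 : R) F (f t).
  apply: is_derive_eq; rewrite /GRing.scale/= /f.
  apply/eqP; rewrite -subr_eq0; apply/eqP.
  transitivity (p2 / 2 * (1 - (cos t ^+ 2 + sin t ^+ 2))); first by field.
  by rewrite cos2Dsin2 subrr mulr0.
have cof : cont_on f 0 (2 * pi) by move=> t _; exact: cf.
have <- : (\int[@lebesgue_measure R]_(t in `[0%R, (2 * pi)%R]) f t)%R =
    2 * pi * (p0 + p2 / 2).
  by rewrite (segment_FTC pi20 dF cf) /F !mulr_natl sin2pi sin0; field.
by rewrite /Rintegral fineK//; exact: integrable_fin_num (cont_on_integrable cof).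
Qed.

(** The radius b is complex, so that the point t = 0 of the circle can be placed in any direction;
    [submean_annulus] points it away from the centre of the annulus. *)
Definition submean (R : realType) (u : Cx R -> \bar R) :=
  [/\ forall z, (u z < +oo)%E,
      forall c : R, open [set z | (u z < c%:E)%E]
    & forall a b : Cx R, (u a <= (2 * pi)^-1%:E *
        \int[@lebesgue_measure R]_(t in `[0%R, (2 * pi)%R])
          u (a + b * cis t)%R)%E].

Lemma usc_measurable2 (R : realType) (u : Cx R -> \bar R) :
  (forall c : R, open [set z | (u z < c%:E)%E]) ->
  measurable_fun setT
    (u \o @toC R : measurableTypeR R * measurableTypeR R -> _).
Proof.
move=> usc; rewrite (_ : u \o _ = -%E \o ((fun z => - u z)%E \o @toC R)).
  apply: measurableT_comp => //; apply: lsc_measurable2 => a.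
  rewrite (_ : [set _ | _] = [set z | (u z < (- a)%:E)%E])//.
  by apply/seteqP; split => z /=; rewrite lteNr EFinN.
by apply/funext => p /=; rewrite oppeK.
Qed.

Lemma measurable_circle (R : realType) (u : Cx R -> \bar R) (a b : Cx R) :
  (forall c : R, open [set z | (u z < c%:E)%E]) ->
  measurable_fun setT (fun t : measurableTypeR R => u (a + b * cis t)).
Proof.
case: a b => [a1 a2] [b1 b2] usc.
have mc : measurable_fun setT (cos : measurableTypeR R -> R).
  by apply: continuous_measurable_fun; exact: continuous_cos.
have ms : measurable_fun setT (sin : measurableTypeR R -> R).
  by apply: continuous_measurable_fun; exact: continuous_sin.
have mp : measurable_fun setT (fun t : measurableTypeR R =>
  (a1 + (b1 * cos t - b2 * sin t), a2 + (b1 * sin t + b2 * cos t))).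
  apply: measurable_fun_pair.
    apply: measurable_funD => //; apply: measurable_funB; exact: measurable_funM.
  apply: measurable_funD => //; apply: measurable_funD; exact: measurable_funM.
exact: (measurableT_comp (usc_measurable2 usc) mp).
Qed.

Lemma submean_trig (R : realType) (u : Cx R -> \bar R) (a b : Cx R)
    (p0 p1 p2 : R) : submean u ->
  (forall t, (u (a + b * cis t)%R <= (p0 + p1 * cos t + p2 * cos t ^+ 2)%:E)%E) ->
  (u a <= (p0 + p2 / 2)%:E)%E.
Proof.
move=> [_ usc sm] H; apply: (le_trans (sm a b)).
have pi20 : 0 < 2 * pi :> R by rewrite mulr_gt0// pi_gt0.
have -> : ((p0 + p2 / 2)%:E = (2 * pi)^-1%:E * (2 * pi * (p0 + p2 / 2))%:E)%E.
  by rewrite -EFinM mulrA mulVf ?mul1r// gt_eqF.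
rewrite -(integral_trig2 p0 p1 p2) lee_pmul2l ?lte_fin ?invr_gt0//.
apply: le_integral_of_le_integrable => //.
- by apply: measurable_funTS; exact: measurable_circle.
- apply/measurable_EFinP; apply: measurable_funTS.
  have mc : measurable_fun setT (cos : measurableTypeR R -> R).
    by apply: continuous_measurable_fun; exact: continuous_cos.
  apply: measurable_funD; first by apply: measurable_funD => //; exact: measurable_funM.
  by apply: measurable_funM => //; exact: measurable_funX.
Qed.

(** The right side minus the left vanishes at 0 and has derivative y^3 / (1 + y), which has the sign
    of y; so 0 is its minimum. *)
Lemma ln1Dx_le (R : realType) (x : R) : `|x| <= 2^-1 ->
  ln (1 + x) <= x - x ^+ 2 / 2 + x ^+ 3 / 3.
Proof.
rewrite ler_norml => /andP[xl xu].
pose f y : R := y - y ^+ 2 / 2 + y ^+ 3 / 3 - ln (1 + y).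
have df (y : R) : - 2^-1 <= y -> is_derive y (1 : R) f (y ^+ 3 / (1 + y)).
  move=> hy; have y0 : 0 < 1 + y by lra.
  have dln : is_derive y (1 : R) (fun y => ln (1 + y)) (1 + y)^-1.
    have H := is_derive1_ln y0.
    have H2 : is_derive y (1 : R) (fun y => 1 + y) 1.
      rewrite -[X in is_derive _ _ _ X]add0r.
      exact: (is_deriveD (is_derive_cst (1 : R) y (1 : R)) (is_derive_id y (1 : R))).
    by have := is_derive1_comp H H2; rewrite mulr1.
  apply: is_derive_eq; rewrite /GRing.scale/=; field.
  by rewrite gt_eqF.
have cf : {within `[- 2^-1, 2^-1], continuous f}.
  apply: continuous_in_subspaceT => y; rewrite inE/= in_itv/= => /andP[yl _].
  apply/differentiable_continuous/derivable1_diffP.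
  by have := df y yl => H; exact: ex_derive.
suff : 0 <= f x by rewrite /f subr_ge0.
have f0 : f 0 = 0 by rewrite /f addr0 ln1 expr0n /= expr0n /= !mul0r !subr0 addr0.
have [x0|x0] := leP 0 x.
  have [y||c] := @MVT_segment R f (fun y => y ^+ 3 / (1 + y)) 0 x x0.
  - by rewrite in_itv/= => /andP[? ?]; apply: df; lra.
  - by apply: continuous_subspaceW cf; apply: subset_itv; rewrite bnd_simp; lra.
  rewrite f0 !subr0 in_itv/= => /andP[c0 _] ->.
  by rewrite mulr_ge0// divr_ge0 ?exprn_ge0//; lra.
have [y||c] := @MVT_segment R f (fun y => y ^+ 3 / (1 + y)) x 0 (ltW x0).
- by rewrite in_itv/= => /andP[? ?]; apply: df; lra.
- by apply: continuous_subspaceW cf; apply: subset_itv; rewrite bnd_simp; lra.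
rewrite f0 !sub0r in_itv/= => /andP[cx c0] /eqP; rewrite eqr_oppLR => /eqP ->.
rewrite -mulrN opprK mulr_le0//; last exact: ltW.
rewrite pmulr_lle0 ?invr_gt0; last lra.
by rewrite exprS mulr_le0_ge0// sqr_ge0.
Qed.

Lemma cabs_triangle (R : realType) (x y z : Cx R) :
  cabs (x - z) <= cabs (x - y) + cabs (y - z).
Proof.
have -> : x - z = (x - y) + (y - z) by rewrite addrA subrK.
exact: cabsD.
Qed.

Lemma toC_continuous (R : realType) : continuous (@toC R).
Proof.
move=> [x y] A /nbhs_CxP[e e0 H].
exists ([set x' | `|x' - x| < e / 2], [set y' | `|y' - y| < e / 2]) => /=.
  have e20 : 0 < e / 2 by rewrite divr_gt0.
  by split; apply/nbhs_ballP; exists (e / 2) => //= z; rewrite /ball/= distrC.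
move=> [a b] [/= h1 h2]; apply: H.
by apply: le_lt_trans (cabs_le_add (a - x) (b - y)) _; lra.
Qed.

Lemma open_cabs_gt (R : realType) (a : Cx R) (r : R) :
  open [set w : Cx R | r < cabs (w - a)].
Proof.
rewrite openE => z /= rz; apply/nbhs_CxP.
exists (cabs (z - a) - r); first by rewrite subr_gt0.
move=> y yz /=; have := cabs_triangle z y a.
by rewrite (cabs_distC z y); move: yz; lra.
Qed.

Lemma open_cabs_lt (R : realType) (a : Cx R) (r : R) :
  open [set w : Cx R | cabs (w - a) < r].
Proof.
rewrite openE => z /= rz; apply/nbhs_CxP.
exists (r - cabs (z - a)); first by rewrite subr_gt0.
move=> y yz /=; have := cabs_triangle y z a.
by move: yz; lra.
Qed.

Lemma compact_annulus (R : realType) (a : Cx R) (r1 r2 : R) :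
  compact [set w : Cx R | r1 <= cabs (w - a) <= r2].
Proof.
pose M := cabs a + `|r2|.
apply: (@subclosed_compact _ _ (@toC R @` (`[- M, M] `*` `[- M, M]))).
- rewrite (_ : [set _ | _] = ~` ([set w | cabs (w - a) < r1] `|`
      [set w | r2 < cabs (w - a)])).
    apply: open_closedC; apply: openU; [exact: open_cabs_lt|exact: open_cabs_gt].
  apply/seteqP; split => w /=.
    by move=> /andP[h1 h2] []; rewrite ltNge ?h1 ?h2.
  by move=> H; apply/andP; split; rewrite leNgt; apply/negP => ?; apply: H;
    [left|right].
- apply: continuous_compact; first exact/continuous_subspaceT/toC_continuous.
  by apply: compact_setX; exact: segment_compact.
- move=> w /= /andP[_ wr].
  have wM : cabs w <= M.
    rewrite -[w](subrK a) addrC (le_trans (cabsD _ _))// lerD2l.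
    by rewrite (le_trans wr)// ler_norm.
  exists (complex.Re w, complex.Im w); last by case: (w).
  by split; rewrite /= in_itv/= -ler_norml;
    [exact: le_trans (Re_le_cabs w) wM|exact: le_trans (Im_le_cabs w) wM].
Qed.

Lemma cabs_1D_cis (R : realType) (b t : R) :
  cabs (1 + b%:C%C * cis t) ^+ 2 = 1 + (2 * b * cos t + b ^+ 2).
Proof.
rewrite cabs_sqrE /= !mul0r !subr0 !addr0 add0r.
by have := cos2Dsin2 t; rewrite !expr2; nra.
Qed.

Lemma cabs_1D_bounds (R : realType) (b t : R) : 0 <= b ->
  1 - b <= cabs (1 + b%:C%C * cis t) <= 1 + b.
Proof.
move=> b0; have c1 : cabs (1 : Cx R) = 1 by rewrite -[1](rmorph1 (real_complex R)) cabs_real normr1.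
have cb : cabs (b%:C%C * cis t) = b by rewrite cabsM cabs_cis mulr1 cabs_real ger0_norm.
apply/andP; split; last by rewrite (le_trans (cabsD _ _))// c1 cb.
have := cabsD (1 + b%:C%C * cis t) (- (b%:C%C * cis t)).
by rewrite addrK cabsN cb c1; lra.
Qed.

(** With c = cos t the argument of [ln] is |1 + b exp (it)|^2. The condition b <= 1/6 gives |x| <=
    1/2 and x <= 3 b, and the constant 9 is 3^3 / 3. *)
Lemma ln_1D_cis_le (R : realType) (b c : R) : 0 < b -> b <= 6^-1 ->
  -1 <= c -> c <= 1 ->
  ln (1 + (2 * b * c + b ^+ 2)) <=
    2 * b * c + b ^+ 2 - (2 * b * c + b ^+ 2) ^+ 2 / 2 + 9 * b ^+ 3.
Proof.
move=> b0 b1 cl cu; set x := 2 * b * c + b ^+ 2.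
have bb : b ^+ 2 <= b / 6 by rewrite expr2 ler_pM2l.
have bc1 : 2 * b * c <= 2 * b by rewrite ler_piMr// mulr_ge0// ltW.
have bc2 : - (2 * b) <= 2 * b * c.
  by rewrite -mulrN1 ler_pM2l// mulr_gt0.
have bsq := sqr_ge0 b.
have xb : `|x| <= 2^-1 by rewrite ler_norml /x; apply/andP; split; lra.
have xu : x <= 3 * b by rewrite /x; lra.
have x3 : x ^+ 3 <= 27 * b ^+ 3.
  have [xn|xp] := leP x 0.
    have : x ^+ 3 <= 0 by rewrite exprS mulr_le0_ge0// sqr_ge0.
    have : 0 <= b ^+ 3 by rewrite exprn_ge0// ltW.
    lra.
  have -> : 27 * b ^+ 3 = (3 * b) ^+ 3 by ring.
  by rewrite lerXn2r// nnegrE ltW// mulr_gt0.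
have L := ln1Dx_le xb.
lra.
Qed.

(** Maximum principle against the radial harmonic functions A + B ln |w - a|; with r1 = 0 and B = 0
    it is the one on a disc. Harmonicity of the logarithm enters through a third-order expansion: on
    a circle of relative radius b around a maximum point the error is O(b^3), which the gain e rho^2
    b^2 of the perturbation beats for small b. *)
Lemma submean_annulus (R : realType) (u : Cx R -> \bar R) (a : Cx R)
    (r1 r2 A B : R) : submean u -> 0 <= B ->
  (0 < r1 /\ (forall w, cabs (w - a) = r1 -> (u w <= (A + B * ln r1)%:E)%E) \/
   r1 = 0 /\ B = 0) ->
  (forall w, cabs (w - a) = r2 -> (u w <= (A + B * ln r2)%:E)%E) ->
  forall w, r1 <= cabs (w - a) <= r2 -> (u w <= (A + B * ln (cabs (w - a)))%:E)%E.
Proof.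
move=> su B0 Hr1 Hr2 w0 Kw0; have [ulty usc sm] := su.
rewrite leNgt; apply/negP => gap.
have r10 : 0 <= r1 by case: Hr1 => [[/ltW//]|[-> _]].
pose K := [set w : Cx R | r1 <= cabs (w - a) <= r2].
(* Perturbing u - A - B ln|w - a| by e |w - a|^2 makes it strictly submean. *)
pose eta := fine (u w0) - (A + B * ln (cabs (w0 - a))).
have uw0 : u w0 = (fine (u w0))%:E.
  by rewrite fineK// fin_numElt ulty andbT (le_lt_trans _ gap)// leNye.
have eta0 : 0 < eta by rewrite subr_gt0 -lte_fin -uw0.
(* Then e r2^2 < eta, so the perturbed function cannot reach its maximum on the boundary circles. *)
pose e := eta / (r2 ^+ 2 + 1).
have r21 : 0 < r2 ^+ 2 + 1 by rewrite ltr_wpDl// sqr_ge0.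
have e0 : 0 < e by rewrite divr_gt0.
pose phi (r : R) := e * r ^+ 2 - A - B * ln r.
pose F w := (u w + (phi (cabs (w - a)))%:E)%E.
have cphi (r : R) : 0 < r \/ B = 0 -> {for r, continuous phi}.
  move=> hr; apply: cvgB.
    by apply: cvgB; [apply: cvgM; [exact: cvg_cst|apply: exprn_continuous]|exact: cvg_cst].
  case: hr => [r0|->].
    by apply: cvgM; [exact: cvg_cst|exact: continuous_ln].
  rewrite mul0r (_ : (fun x => 0 * ln x) = fun=> 0); first exact: cvg_cst.
  by apply/funext => x; rewrite mul0r.
have Fusc w (c : R) : K w -> (F w < c%:E)%E -> \forall y \near w, (F y < c%:E)%E.
  move=> /andP[wr1 _]; rewrite /F -lteBrDr// -EFinB => /ereal_between[d /andP[ud dc]].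
  rewrite lte_fin in dc.
  have hr : 0 < cabs (w - a) \/ B = 0.
    by case: Hr1 => [[r0 _]|[_ ->]]; [left; exact: lt_le_trans wr1|right].
  have := cphi _ hr => /cvgrPdist_lt/(_ (c - d - phi (cabs (w - a)))).
  have g0 : 0 < c - d - phi (cabs (w - a)) by lra.
  move=> /(_ g0)/nbhs_ballP[del /= del0 Hd].
  have n1 : \forall y \near w, (u y < d%:E)%E by exact: open_nbhs_nbhs (conj (usc d) ud).
  have n2 : \forall y \near w, cabs (y - w) < del by apply/nbhs_CxP; exists del.
  apply: filterS (filterI n1 n2) => y [uyd yw]; rewrite -lteBrDr// -EFinB.
  apply: (lt_trans uyd); rewrite lte_fin.
  have hb : ball (cabs (w - a)) del (cabs (y - a)).
    rewrite /ball/=; apply: le_lt_trans (cabs_lip _ _) _.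
    by rewrite opprB addrA subrK cabs_distC.
  by have := Hd _ hb; rewrite ltr_norml => /andP[? ?]; lra.
have [ws Kws Hws] := usc_compact_max (@compact_annulus R a r1 r2)
  (ex_intro _ w0 Kw0) Fusc.
have /andP[r1s rs2] := Kws.
have Fs : (eta%:E <= F ws)%E.
  apply: le_trans (Hws _ Kw0); rewrite /F uw0 lee_fin /eta /phi.
  by have := mulr_ge0 (ltW e0) (sqr_ge0 (cabs (w0 - a))); lra.
pose S := fine (F ws).
have FsE : F ws = S%:E.
  rewrite fineK// fin_numElt (lt_le_trans _ Fs) ?ltNyr//=.
  by rewrite /F lte_add_pinfty// ltry.
have S0 : eta <= S by rewrite -lee_fin -FsE.
have uwsE : u ws = (S - phi (cabs (ws - a)))%:E.
  by rewrite EFinB -FsE /F addeK.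
have er : e * r2 ^+ 2 < eta.
  by rewrite /e mulrAC ltr_pdivrMr// ltr_pM2l// ltrDl.
have bd r w : cabs (w - a) = r -> r <= r2 -> 0 <= r -> (u w <= (A + B * ln r)%:E)%E -> w <> ws.
  move=> wr rr2 r0 uw wE; move: uw; rewrite wE uwsE -wE wr lee_fin /phi => uw.
  have : e * r ^+ 2 <= e * r2 ^+ 2 by rewrite ler_pM2l// ler_sqr ?nnegrE ?(le_trans r0).
  lra.
have Hs z : K z -> (u z <= (S - phi (cabs (z - a)))%:E)%E.
  by move=> /Hws; rewrite FsE EFinB /F leeBrDr.
have r20 : 0 <= r2 by rewrite (le_trans r10)// (le_trans r1s).
have sr2 : cabs (ws - a) < r2.
  rewrite lt_neqAle rs2 andbT; apply/eqP => E.
  exact: (bd _ ws E (lexx _) r20 (Hr2 _ E)).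
(* A maximum at the centre occurs only in the disc case; there B = 0, and the circle of radius r2
   can be used at once. *)
have [wsa|wsa] := eqVneq ws a.
  have B00 : B = 0.
    case: Hr1 => [[r1p _]|[_ //]].
    by move: r1s; rewrite wsa subrr cabs0 leNgt r1p.
  have r1z : r1 <= 0 by move: r1s; rewrite wsa subrr cabs0.
  have r2p : 0 < r2 by move: sr2; rewrite wsa subrr cabs0.
  have H t : (u (ws + r2%:C%C * cis t)%R <=
      ((S - phi r2) + 0 * cos t + 0 * cos t ^+ 2)%:E)%E.
    have c2 : cabs (ws + r2%:C%C * cis t - a) = r2.
      by rewrite wsa addrC addKr cabsM cabs_cis mulr1 cabs_real ger0_norm.
    by rewrite !mul0r !addr0 -{2}c2; apply: Hs; rewrite /K/= c2 lexx (le_trans r1z).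
  have := submean_trig su H; rewrite uwsE lee_fin wsa subrr cabs0 /phi B00.
  rewrite !mul0r expr0n/= mulr0 addr0.
  have : 0 < e * r2 ^+ 2 by rewrite mulr_gt0// exprn_gt0.
  lra.
have r1s' : r1 < cabs (ws - a).
  case: Hr1 => [[r1p Hr1]|[-> _]]; last by rewrite cabs_gt0 subr_eq0.
  rewrite lt_neqAle r1s andbT; apply/eqP => E.
  have r12 : r1 <= r2 by rewrite (le_trans r1s).
  exact: (bd _ ws (esym E) r12 r10 (Hr1 _ (esym E))).
set rho := cabs (ws - a) in r1s' sr2 uwsE *.
have rho0 : 0 < rho by exact: le_lt_trans r1s'.
have B9 : 0 < 9 * B + 1 by rewrite ltr_wpDl// mulr_ge0.
have erho : 0 < e * rho ^+ 2 by rewrite mulr_gt0// exprn_gt0.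
(* The two middle bounds keep the circle of radius b rho inside the annulus; the last lets the gain
   dominate the cubic error. *)
pose b := Num.min 6^-1 (Num.min ((r2 - rho) / rho)
  (Num.min ((rho - r1) / rho) (e * rho ^+ 2 / (9 * B + 1)))).
have b0 : 0 < b by rewrite !lt_min invr_gt0 ltr0n !divr_gt0// subr_gt0.
have b1 : b <= 6^-1 by rewrite ge_min lexx.
have b2 : b * rho <= r2 - rho by rewrite -ler_pdivlMr// !ge_min lexx orbT.
have b3 : b * rho <= rho - r1 by rewrite -ler_pdivlMr// !ge_min lexx !orbT.
have b4 : b * (9 * B + 1) <= e * rho ^+ 2 by rewrite -ler_pdivlMr// !ge_min lexx !orbT.
(* Coefficients in cos t of the bound S - phi (rho |1 + b exp (it)|) after expanding the
   logarithm. *)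
pose p0 := S + A + B * ln rho - e * rho ^+ 2 * (1 + b ^+ 2) +
  B / 2 * (b ^+ 2 - b ^+ 4 / 2 + 9 * b ^+ 3).
pose p1 := - 2 * (e * rho ^+ 2) * b + B / 2 * (2 * b - 2 * b ^+ 3).
pose p2 := - (B * b ^+ 2).
(* The complex radius (ws - a) b makes the distance to [a] equal to rho |1 + b exp (it)|. *)
have H t : (u (ws + ((ws - a) * b%:C%C) * cis t)%R <=
    (p0 + p1 * cos t + p2 * cos t ^+ 2)%:E)%E.
  set c := cabs (1 + b%:C%C * cis t).
  have Ec : cabs (ws + ((ws - a) * b%:C%C) * cis t - a) = rho * c.
    by rewrite -cabsM mulrDr mulr1 mulrA addrAC.
  have /andP[c1 c2] := cabs_1D_bounds t (ltW b0).
  have c0 : 0 < c by apply: lt_le_trans c1; rewrite subr_gt0; lra.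
  have c1' : 1 - b <= c by [].
  have c2' : c <= 1 + b by [].
  have KK : K (ws + ((ws - a) * b%:C%C) * cis t).
    rewrite /K/= Ec; apply/andP; split.
      by apply: (@le_trans _ _ (rho * (1 - b))); [lra|rewrite ler_pM2l].
    by apply: (@le_trans _ _ (rho * (1 + b))); [rewrite ler_pM2l|lra].
  apply: le_trans (Hs _ KK) _; rewrite Ec lee_fin /phi.
  have Ec2 := cabs_1D_cis b t; rewrite -/c in Ec2.
  rewrite lnM ?posrE// exprMn Ec2.
  have lnc : ln c = ln (1 + (2 * b * cos t + b ^+ 2)) / 2.
    by rewrite -Ec2 lnXn// mulr2n; field.
  have /andP[cl cu] : -1 <= cos t <= 1 by rewrite cos_geN1 cos_le1.
  set x := 2 * b * cos t + b ^+ 2 in lnc *.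
  have L2 : ln (1 + x) <= x - x ^+ 2 / 2 + 9 * b ^+ 3 by exact: ln_1D_cis_le.
  have L3 : B * ln c <= B / 2 * (x - x ^+ 2 / 2 + 9 * b ^+ 3).
    by rewrite lnc mulrCA -mulrA mulrC -mulrA ler_wpM2l// ler_wpM2l// invr_ge0.
  rewrite -subr_ge0; move: L3; rewrite -subr_ge0.
  suff -> : p0 + p1 * cos t + p2 * cos t ^+ 2 -
      (S - (e * (rho ^+ 2 * (1 + x)) - A - B * (ln rho + ln c))) =
    B / 2 * (x - x ^+ 2 / 2 + 9 * b ^+ 3) - B * ln c by [].
  by rewrite /p0 /p1 /p2 /x; field.
have := submean_trig su H; rewrite uwsE lee_fin /phi /p0 /p2.
have q3 : 0 < b ^+ 2 by rewrite exprn_gt0.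
have q4 : b ^+ 2 * (b * (9 * B + 1)) <= b ^+ 2 * (e * rho ^+ 2) by rewrite ler_pM2l.
have q5 : 0 < b ^+ 2 * (e * rho ^+ 2) by rewrite mulr_gt0.
have q6 : 0 <= B * b ^+ 4 by rewrite mulr_ge0// exprn_ge0// ltW.
have q7 : 0 < b ^+ 2 * b by rewrite mulr_gt0.
have q8 : 0 <= B * (b ^+ 2 * b) by rewrite mulr_ge0// ltW.
clear - q4 q5 q6 q7 q8; rewrite -subr_ge0.
have -> : S + A + B * ln rho - e * rho ^+ 2 * (1 + b ^+ 2) +
   B / 2 * (b ^+ 2 - b ^+ 4 / 2 + 9 * b ^+ 3) + - (B * b ^+ 2) / 2 -
   (S - (e * rho ^+ 2 - A - B * ln rho)) =
   - (b ^+ 2 * (e * rho ^+ 2)) + (9 / 2) * (B * (b ^+ 2 * b)) - B * b ^+ 4 / 4.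
  by field.
move: q4; rewrite (_ : b ^+ 2 * (b * (9 * B + 1)) = 9 * (B * (b ^+ 2 * b)) + b ^+ 2 * b); last by ring.
lra.
Qed.

(** * Circle maxima and existence of the Lelong number *)

Section lelong_dichotomy.
Variables (R : realType) (u : Cx R -> \bar R) (a z1 : Cx R).
Hypotheses (su : submean u) (uz1 : (-oo < u z1)%E).

Local Notation M := (circle_max u a).
Local Notation dst w := (cabs (w - a)%R).

Lemma circle_max_attained (r : R) : 0 <= r ->
  exists2 w, cabs (w - a) = r & u w = M r.
Proof.
move=> r0; have [_ usc _] := su.
have inh : [set w : Cx R | r <= cabs (w - a) <= r] !=set0.
  by exists (a + r%:C%C); rewrite /= addrC addKr cabs_real ger0_norm ?lexx.
have [|w /=] := usc_compact_max (F := u) (@compact_annulus R a r r) inh.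
  by move=> x c _ xc; exact: open_nbhs_nbhs (conj (usc c) xc).
rewrite -eq_le eq_sym => /eqP wr Hw; exists w => //.
apply/eqP; rewrite eq_le; apply/andP; split.
  apply: ereal_sup_ubound; exists (w - a) => //=.
  by rewrite addrC subrK.
apply: ge_ereal_sup => _ [l /= lr <-]; apply: Hw.
by rewrite /= addrC addKr lr lexx.
Qed.

Lemma circle_max_ub (w : Cx R) : (u w <= M (dst w))%E.
Proof.
by apply: ereal_sup_ubound; exists (w - a) => //=; rewrite addrC subrK.
Qed.

Lemma circle_max_lty (r : R) : 0 <= r -> (M r < +oo)%E.
Proof. by move=> /circle_max_attained[w _ <-]; have [H _ _] := su. Qed.

Lemma disc_max (r : R) (A : R) : 0 <= r ->
  (forall w, cabs (w - a) = r -> (u w <= A%:E)%E) ->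
  forall w, cabs (w - a) <= r -> (u w <= A%:E)%E.
Proof.
move=> r0 HA w wr.
have H2 z : cabs (z - a) = r -> (u z <= (A + 0 * ln r)%:E)%E.
  by rewrite mul0r addr0; exact: HA.
have := @submean_annulus R u a 0 r A 0 su (lexx _)
  (or_intror (conj erefl erefl)) H2 w.
by rewrite cabs_ge0 wr mul0r addr0; exact.
Qed.

(** A circle on which u is -oo would force u(z1) = -oo: inside it by the maximum principle on discs,
    outside by comparison with logarithms of arbitrarily large coefficient. *)
Lemma circle_max_gtNy (r : R) : 0 < r -> (-oo < M r)%E.
Proof.
move=> r0; rewrite ltNye; apply/eqP => MN.
have uN w : cabs (w - a) = r -> u w = -oo%E.
  by move=> wr; apply/eqP; rewrite -leeNy_eq -MN -wr; exact: circle_max_ub.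
have [ulty _ _] := su.
pose v := fine (u z1).
have uz : u z1 = v%:E by rewrite fineK// fin_numElt uz1 ulty.
have [z1r|z1r] := leP (cabs (z1 - a)) r.
  have Hr w : cabs (w - a) = r -> (u w <= (v - 1)%:E)%E by move=> /uN ->; rewrite leNye.
  by have := disc_max (ltW r0) Hr z1r; rewrite uz lee_fin; lra.
set rho := cabs (z1 - a) in z1r.
have rho0 : 0 < rho by exact: lt_trans z1r.
have rho1 : 0 <= rho + 1 by rewrite addr_ge0// ltW.
have [C HC] : exists C : R, (M (rho + 1) <= C%:E)%E.
  have := circle_max_lty rho1.
  case: (M _) => [c _|//|_]; first by exists c.
  by exists 0; rewrite leNye.
have lnlt : ln rho < ln (rho + 1) by rewrite ltr_ln ?posrE//; lra.
pose g := ln (rho + 1) - ln rho.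
have g0 : 0 < g by rewrite subr_gt0.
(* B g exceeds C - v, so the logarithm with value C at rho + 1 lies below v at rho. *)
pose B := (`|C - v| + 1) / g.
have B0 : 0 <= B by rewrite divr_ge0 ?ltW// addr_ge0.
have := @submean_annulus R u a r (rho + 1) (C - B * ln (rho + 1)) B su B0.
move=> /(_ (or_introl (conj r0 _)) _ z1).
rewrite uz lee_fin -/rho => H.
have : v <= C - B * ln (rho + 1) + B * ln rho.
  apply: H; last by rewrite -/rho; apply/andP; split; lra.
  - by move=> w' /uN ->; rewrite leNye.
  - by move=> w' w'r; rewrite subrK; apply: le_trans HC; rewrite -w'r circle_max_ub.
have : B * g = `|C - v| + 1 by rewrite divfK// gt_eqF.
by rewrite /g; have := ler_norm (C - v); nra.
Qed.

Let m r := fine (M r).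

Let mE (r : R) : 0 < r -> M r = (m r)%:E.
Proof.
by move=> r0; rewrite fineK// fin_numElt circle_max_gtNy// circle_max_lty// ltW.
Qed.

Let um w : 0 < cabs (w - a) -> (u w <= (m (dst w))%:E)%E.
Proof. by move=> h; rewrite -mE//; exact: circle_max_ub. Qed.

Let m_mono (r s : R) : 0 < r -> r <= s -> m r <= m s.
Proof.
move=> r0 rs; have s0 := lt_le_trans r0 rs; rewrite -lee_fin -!mE//.
have [w wr <-] := circle_max_attained (ltW r0); rewrite mE//.
apply: (disc_max (ltW s0)); last by rewrite wr.
by move=> z zs; rewrite -zs; apply: um; rewrite zs.
Qed.

(** Secant slope, between r and 1, of the circle maximum as a function of ln r; recall ln 1 = 0. *)
Let k r := (m r - m 1) / ln r.

Let ln_lt0' (r : R) : 0 < r -> r < 1 -> ln r < 0.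
Proof. by move=> r0 r1; rewrite ln_lt0// r0. Qed.

Let k_ge0 (r : R) : 0 < r -> r < 1 -> 0 <= k r.
Proof.
move=> r0 r1; rewrite /k -mulrNN -invrN divr_ge0// ?oppr_ge0 ?subr_le0.
- exact: m_mono (ltW r1).
- by rewrite ltW// ln_lt0'.
Qed.

(** Hadamard's three-circle inequality, by comparison on r <= |w - a| <= 1 with the logarithm that
    matches both boundary maxima. It makes [k] nondecreasing, so that the infimum [nu] is its limit
    at 0. *)
Let k_bound (r s : R) : 0 < r -> r < s -> s < 1 -> m s <= m 1 + k r * ln s.
Proof.
move=> r0 rs s1; have s0 := lt_trans r0 rs; have r1 := lt_trans rs s1.
have [w ws uw] := circle_max_attained (ltW s0).
have := @submean_annulus R u a r 1 (m 1) (k r) su (k_ge0 r0 r1).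
move=> /(_ (or_introl (conj r0 _)) _ w).
rewrite uw ws mE// lee_fin; apply.
- move=> z zr; rewrite /k divfK ?lt_eqF ?ln_lt0'// (addrC (m 1)) subrK.
  by rewrite -zr; apply: um; rewrite zr.
- by move=> z z1'; rewrite ln1 mulr0 addr0 -z1'; apply: um; rewrite z1'.
- by rewrite !ltW.
Qed.

Let k_mono : {in `]0, 1[ &, {homo k : r s / r <= s}}.
Proof.
move=> r s; rewrite !in_itv/= => /andP[r0 r1] /andP[s0 s1].
rewrite le_eqVlt => /predU1P[->//|rs].
by rewrite {2}/k ler_ndivlMr ?ln_lt0'// lerBlDl; exact: k_bound.
Qed.

Let nu := inf (k @` `]0, 1[).

Let k_lb : lbound (k @` `]0, 1[) 0.
Proof.
move=> x [r /= rI <-]; move: rI; rewrite in_itv/= => /andP[r0 r1].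
exact: k_ge0.
Qed.

Let nu_le (r : R) : 0 < r -> r < 1 -> nu <= k r.
Proof.
move=> r0 r1; apply: ge_inf; first by exists 0; exact: k_lb.
by exists r => //=; rewrite in_itv/= r0.
Qed.

Lemma lelong_upper : exists c, forall w, w != a -> cabs (w - a) < 1 ->
  (u w <= (c + nu * ln (dst w))%:E)%E.
Proof.
exists (m 1) => w wa w1; have w0 : 0 < cabs (w - a) by rewrite cabs_gt0 subr_eq0.
apply: le_trans (um w0) _; rewrite lee_fin.
have : m (cabs (w - a)) = m 1 + k (cabs (w - a)) * ln (cabs (w - a)).
  by rewrite /k divfK ?lt_eqF ?ln_lt0'// (addrC (m 1)) subrK.
move=> ->; rewrite lerD2l ler_wnM2r ?nu_le// ltW// ln_lt0'//.
Qed.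

Lemma lelong_lower (nu' : R) : nu < nu' -> exists2 r0, 0 < r0 &
  forall r, 0 < r -> r < r0 -> exists2 w, cabs (w - a) = r &
    ((nu' * ln r)%:E <= u w)%E.
Proof.
move=> nn; pose nu2 := (nu + nu') / 2.
have n2 : nu < nu2 by rewrite /nu2; lra.
have n2' : nu2 < nu' by rewrite /nu2; lra.
have [x [s /= hs kx] ks] : exists2 x, (k @` `]0, 1[) x & x < nu2.
  apply: inf_lt => //; exists (k (1/2)), (1/2) => //=.
  by rewrite in_itv/=; apply/andP; split; lra.
move: hs; rewrite -kx in ks; rewrite in_itv/= => /andP[s0 s1].
(* Below the exponential bound (nu' - nu2) ln r < m 1, so the constant m 1 is absorbed by the larger
   exponent. *)
exists (Num.min s (expR (m 1 / (nu' - nu2)))); first by rewrite lt_min s0 expR_gt0.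
move=> r r0; rewrite lt_min => /andP[rs re].
have r1 := lt_trans rs s1.
have [w wr uw] := circle_max_attained (ltW r0); exists w => //.
rewrite uw mE// lee_fin.
have -> : m r = m 1 + k r * ln r by rewrite /k divfK ?lt_eqF ?ln_lt0'// (addrC (m 1)) subrK.
have kr : k r <= nu2.
  apply: le_trans (ltW ks); apply: k_mono; rewrite ?in_itv/= ?r0 ?s0 ?ltW//.
have lr : ln r < m 1 / (nu' - nu2).
  by rewrite -[ltRHS]expRK ltr_ln ?posrE ?expR_gt0.
have lr0 := ln_lt0' r0 r1.
have : nu2 * ln r <= k r * ln r by rewrite ler_nM2r.
by move: lr; rewrite ltr_pdivlMr ?subr_gt0//; lra.
Qed.

Lemma lelongE : lelong u a = nu%:E.
Proof.
apply/cvg_lim => //.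
have kc : k r @[r --> 0^'+] --> nu.
  apply: (@nondecreasing_at_right_cvgr _ k 0 (BLeft 1)).
  - by rewrite bnd_simp.
  - exact: k_mono.
  - by exists 0; exact: k_lb.
(* The quotient in [lelong] differs from the slope [k] by m 1 / ln r. *)
have lc : m 1 / ln r @[r --> 0^'+] --> 0.
  rewrite -[X in _ --> X](mulr0 (m 1)); apply: cvgM; first exact: cvg_cst.
  apply/cvgrPdist_lt => e e0.
  near=> r; rewrite sub0r normrN normfV.
  have r0 : 0 < r by near: r; exact: nbhs_right_gt.
  have r1 : r < 1 by near: r; exact: nbhs_right_lt.
  have re : r < expR (- e^-1) by near: r; apply: nbhs_right_lt; exact: expR_gt0.
  have lr : ln r < - e^-1 by rewrite -[ltRHS]expRK ltr_ln ?posrE ?expR_gt0.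
  rewrite ltr0_norm ?ln_lt0'// invf_plt ?posrE ?oppr_gt0 ?ln_lt0'//.
  by rewrite ltrNr.
have kl : (k r + m 1 / ln r) @[r --> 0^'+] --> nu.
  by rewrite -[X in _ --> X]addr0; exact: cvgD.
have klE : (k r + m 1 / ln r)%:E @[r --> 0^'+] --> nu%:E.
  by apply: cvg_EFin; [exact: nearW|exact: kl].
apply: cvg_trans klE.
apply: near_eq_cvg; near=> r => /=.
have r0 : 0 < r by near: r; exact: nbhs_right_gt.
have r1 : r < 1 by near: r; exact: nbhs_right_lt.
rewrite mE// inver lt_eqF ?ln_lt0'// -EFinM; congr EFin.
by rewrite /k; field; rewrite lt_eqF ?ln_lt0'.
Unshelve. all: by end_near.
Qed.

Lemma lelong_spec : exists nu : R, [/\ lelong u a = nu%:E,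
  exists c : R, forall w, w != a -> cabs (w - a) < 1 ->
    (u w <= (c + nu * ln (dst w))%:E)%E
  & forall nu', nu < nu' -> exists2 r0 : R, 0 < r0 &
    forall r, 0 < r -> r < r0 -> exists2 w, cabs (w - a) = r &
      ((nu' * ln r)%:E <= u w)%E].
Proof.
by exists nu; split; [exact: lelongE|exact: lelong_upper|exact: lelong_lower].
Qed.

End lelong_dichotomy.

(** * Large Lelong numbers force infinite volume *)

(** A circle of complex radius b in the slice is the unit circle of the slice in direction b B. *)
Lemma slice_submean (R : realType) (h : Cx2 R -> R) (A B : Cx2 R) :
  balanced_pseudoconvex h -> submean (fun l => log_gauge h (A + l *: B)).
Proof.
move=> [ulty _ psh]; split; first by move=> z; exact: ulty.
  have [_ usc _] := psh A B; move=> c.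
  have := (lower_semicontinuousP _).1 usc (- c).
  rewrite (_ : [set _ | _] = [set z | (log_gauge h (A + z *: B)%R < c%:E)%E])//.
  by apply/seteqP; split => z /=; rewrite EFinN lteN2.
move=> a b; have [_ _ /(_ 0 1 ltr01)] := psh (A + a *: B) (b *: B).
rewrite scale0r addr0 => /le_trans; apply; rewrite /circle_mean.
rewrite le_eqVlt; apply/orP; left; apply/eqP; congr (_ * _)%E.
apply: eq_integral => t _; congr (log_gauge h _).
by rewrite add0r mul1r scalerDl -addrA scalerA mulrC.
Qed.

Lemma line_submean (R : realType) (h : Cx2 R -> R) (c : Cx R) :
  balanced_pseudoconvex h -> submean (fun l => log_gauge h (l, c)).
Proof.
move=> /(slice_submean (0, c) (1, 0)).
rewrite (_ : (fun l => _) = fun l => log_gauge h (l, c))//.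
apply/funext => l; congr (log_gauge h (_, _)).
  by rewrite /= /GRing.scale/= mulr1 add0r.
by rewrite /= scaler0 addr0.
Qed.

(** Exchanges the two charts of the projective line, so that estimates are made in the chart v2 != 0
    only. *)
Definition swap_gauge (R : realType) (h : Cx2 R -> R) (z : Cx2 R) := h (z.2, z.1).

Lemma swap_continuous2 (T : topologicalType) : continuous (fun z : T * T => (z.2, z.1)).
Proof. by move=> z; apply: cvg_pair; [exact: cvg_snd|exact: cvg_fst]. Qed.

Lemma usc_swap (R : realType) (u : Cx2 R -> \bar R) :
  upper_semicontinuous u -> upper_semicontinuous (fun z => u (z.2, z.1)).
Proof.
move=> usc z a /usc[V nV HV].
exists ((fun z : Cx2 R => (z.2, z.1)) @^-1` V); last by move=> y; exact: HV.
exact: swap_continuous2 nV.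
Qed.

Lemma swap_balanced (R : realType) (h : Cx2 R -> R) :
  balanced_gauge h -> balanced_gauge (swap_gauge h).
Proof.
move=> [h0 usc hom]; split; first by move=> z; exact: h0.
  exact: (usc_swap usc).
by move=> l [z1 z2]; rewrite /swap_gauge/= -hom.
Qed.

Lemma swap_pseudoconvex (R : realType) (h : Cx2 R -> R) :
  balanced_pseudoconvex h -> balanced_pseudoconvex (swap_gauge h).
Proof.
move=> [ulty usc psh]; split; first by move=> z; exact: ulty.
  exact: (usc_swap usc).
by move=> [a1 a2] [b1 b2]; exact: (psh (a2, a1) (b2, b1)).
Qed.

Lemma swap_volume (R : realType) (A : set (Cx2 R)) : open A ->
  volume [set z : Cx2 R | A (z.2, z.1)] = volume A.
Proof.
move=> oA.
have oB : open [set z : Cx2 R | A (z.2, z.1)].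
  by move: oA; apply: open_comp => z _; exact: swap_continuous2.
rewrite !volumeE; [|exact: toC2_open_measurable..].
rewrite -(@integral4_swap R (fun z => (\1_A z)%:E)).
- by apply: eq_integral => p _; rewrite !indicE; congr (nat_of_bool _)%:R%:E.
- by apply: measurable_indic_preimage; exact: toC2_open_measurable.
- by move=> z; rewrite lee_fin.
Qed.

Lemma log_gauge_gtNy (R : realType) (h : Cx2 R -> R) (z : Cx2 R) :
  balanced_gauge h -> (-oo < log_gauge h z)%E = (h z != 0).
Proof.
move=> [h0 _ _]; rewrite /log_gauge ltNye.
have [->|hz] := eqVneq (h z) 0; first by rewrite le0_lneNy ?eqxx.
by rewrite lne_EFin// lt_def hz h0.
Qed.

(** If h vanished on such a line, homogeneity would make it vanish wherever z2 != 0, and the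
    sub-mean inequality on the circle (z1, exp (it)) would extend this to z2 = 0. It supplies the
    point with u > -oo that [lelong_spec] asks for. *)
Lemma gauge_line_neq0 (R : realType) (h : Cx2 R -> R) (c : Cx R) :
  balanced_gauge h -> balanced_pseudoconvex h -> (exists z, h z != 0) ->
  c != 0 -> exists l, (-oo < log_gauge h (l, c))%E.
Proof.
move=> hg psh [[z1 z2] hz] c0; have [h0 _ hom] := hg.
apply: contrapT => nl.
have hl l : h (l, c) = 0.
  by apply/eqP; apply: contrapT => /negP H; apply: nl; exists l; rewrite log_gauge_gtNy.
have h2 w1 w2 : w2 != 0 -> h (w1, w2) = 0.
  move=> w20; have -> : (w1, w2) = (w2 / c) *: ((w1 * c / w2, c) : Cx2 R).
    by congr (_, _); rewrite /= /GRing.scale/=; field; rewrite ?w20 ?c0.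
  by rewrite hom hl mulr0.
have z20 : z2 = 0 by apply/eqP; apply: contraNT hz => /h2 ->.
subst z2; move: hz; rewrite -log_gauge_gtNy// ltNye => /eqP; apply.
have su := slice_submean (z1, 0) (0, 1) psh.
have lowb (p : R) : (log_gauge h (z1, 0%R) <= p%:E)%E.
  have H t : (log_gauge h (((z1, 0) : Cx2 R) + (0 + 1 * cis t) *: (0, 1))%R
     <= (p + 0 * cos t + 0 * cos t ^+ 2)%:E)%E.
    have -> : ((z1, 0) : Cx2 R) + (0 + 1 * cis t) *: (0, 1) = (z1, cis t).
      by congr (_, _) => /=; rewrite ?scaler0 ?addr0// add0r mul1r add0r /GRing.scale/= mulr1.
    by rewrite /log_gauge h2 ?le0_lneNy ?leNye// -cabs_gt0 cabs_cis.
  have := submean_trig su H; rewrite scale0r addr0 mul0r addr0; exact.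
have [ulty _ _] := psh.
case E : (log_gauge h (z1, 0)) => [r||] //.
- by exfalso; have := lowb (r - 1); rewrite E lee_fin; lra.
- by have := ulty (z1, 0); rewrite E.
Qed.

(** * Areas of discs *)

Section disc_area.
Variable R : realType.
Local Notation mu2 := (@lebesgue2 R).

Definition disc (a : Cx R) (r : R) : set (Cx R) := [set w | cabs (w - a) < r].

(** An integral of the indicator rather than a measure of the set, which fits the change of
    variables lemmas. *)
Definition area (A : set (Cx R)) : \bar R := (\int[mu2]_p (\1_A (toC p))%:E)%E.

Lemma measurable_indic2 (A : set (Cx R)) : open A ->
  measurable_fun setT ((fun z => (\1_A z)%:E) \o @toC R :
    measurableTypeR R * measurableTypeR R -> \bar R).
Proof. by move=> oA; apply: measurable_indic_preimage; exact: toC_open_measurable. Qed.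

Lemma indic_ge0 (T : Type) (A : set T) (x : T) : (0 <= (\1_A x : R)%:E)%E.
Proof. by rewrite lee_fin. Qed.

Lemma area_disc (a : Cx R) (r : R) : 0 < r ->
  (area (disc a r) = (r ^+ 2)%:E * area (disc 0%R 1%R))%E.
Proof.
move=> r0; rewrite /area.
have memD w : (w + a \in disc a r) = (w \in disc 0 r).
  by apply/idP/idP => /set_mem H; apply/mem_set; move: H; rewrite /disc/= subr0 addrK.
have memZ w : (w \in disc (0 : Cx R) 1) = (r%:C%C * w \in disc 0 r).
  by apply/idP/idP => /set_mem H; apply/mem_set; move: H;
    rewrite /disc/= !subr0 cabsM cabs_real gtr0_norm// gtr_pMr.
have rC : r%:C%C != 0 :> Cx R by rewrite -cabs_gt0 cabs_real normr_gt0 gt_eqF.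
have oD := @open_cabs_lt R a r.
have := integral_translate a (measurable_indic2 oD) (@indic_ge0 _ _).
rewrite -/(disc a r) => <-.
have oD0 : open (disc 0 r) by exact: open_cabs_lt.
have -> : (\int[mu2]_p (\1_(disc a r) (toC p + a)%R)%:E =
    \int[mu2]_p (\1_(disc 0%R r) (toC p))%:E)%E.
  apply: eq_integral => p _; rewrite !indicE; congr (nat_of_bool _)%:R%:E.
  by rewrite memD.
have := integral_scale rC (measurable_indic2 oD0) (@indic_ge0 _ _).
rewrite cabs_real gtr0_norm// => H.
have -> : (\int[mu2]_p (\1_(disc 0%R 1%R) (toC p))%:E =
    \int[mu2]_p (\1_(disc 0%R r) (r%:C%C * toC p)%R)%:E)%E.
  apply: eq_integral => p _; rewrite !indicE; congr (nat_of_bool _)%:R%:E.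
  by rewrite memZ.
by rewrite H muleA -EFinM mulfV ?mul1e// expf_neq0// gt_eqF.
Qed.

Lemma lebesgue2_square (c : R) : 0 <= c ->
  mu2 (`[- c, c] `*` `[- c, c]) = ((c + c) ^+ 2)%:E.
Proof.
move=> c0; rewrite /lebesgue2 product_measure1E//.
have cc : - c <= c by lra.
by rewrite [X in (X * X)%E](lebesgue_segment cc) -EFinM opprK -expr2.
Qed.

Lemma disc_coords (w : Cx R) :
  disc 0 1 w -> `|complex.Re w| <= 1 /\ `|complex.Im w| <= 1.
Proof.
rewrite /disc /= subr0 => /ltW h; split.
  exact: le_trans (Re_le_cabs w) h.
exact: le_trans (Im_le_cabs w) h.
Qed.

(** Inscribed and circumscribed squares; later steps only use that the area is positive and
    finite. *)
Lemma area_disc1_bounds : (1 <= area (disc (0 : Cx R)%R 1%R) <= 4)%E.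
Proof.
have mD : measurable (@toC R @^-1` disc 0 1 : set (measurableTypeR R * measurableTypeR R)).
  by apply: toC_open_measurable; exact: open_cabs_lt.
have -> : area (disc 0 1) = mu2 (@toC R @^-1` disc 0 1).
  have := @integral_indic _ _ R mu2 _ measurableT _ mD.
  by rewrite setIT => <-.
apply/andP; split.
  have -> : 1%E = mu2 (`[- 2^-1, 2^-1] `*` `[- 2^-1, 2^-1]).
    by rewrite lebesgue2_square//; congr EFin; rewrite expr2; field.
  apply: le_measure; rewrite ?inE//; first exact: measurableX.
  move=> [x y] [/=]; rewrite !in_itv/= -!ler_norml => hx hy.
  rewrite /disc/= subr0 -(@ltr_pXn2r _ 2)// ?nnegrE ?cabs_ge0// cabs_sqr expr1n.
  have sqb (z : R) : `|z| <= 2^-1 -> z ^+ 2 <= 4^-1.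
    by rewrite ler_norml => /andP[? ?]; nra.
  by have := sqb _ hx; have := sqb _ hy => /=; lra.
have -> : 4%E = mu2 (`[- 1, 1] `*` `[- 1, 1]).
  by rewrite lebesgue2_square//; congr EFin; rewrite expr2; ring.
apply: le_measure; rewrite ?inE//; first exact: measurableX.
by move=> [x y] /(@disc_coords (toC _))[/= hx hy]; split; rewrite /= in_itv/= -ler_norml.
Qed.

End disc_area.

Section nonneg_integrals.
Context d (T : measurableType d) (R : realType) (mu : {measure set T -> \bar R}).
Local Open Scope ereal_scope.
Implicit Types f g : T -> \bar R.

Lemma ge0_integralZeT f (k : \bar R) : measurable_fun setT f ->
  (forall x, 0 <= f x) -> 0 <= k ->
  \int[mu]_x (k * f x) = k * \int[mu]_x f x.
Proof. by move=> mf f0 k0; rewrite ge0_integralZl. Qed.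

Lemma ge0_integralZT f (k : R) : measurable_fun setT f -> (forall x, 0 <= f x) ->
  (0 <= k)%R -> \int[mu]_x (k%:E * f x) = k%:E * \int[mu]_x f x.
Proof. by move=> mf f0 k0; rewrite ge0_integralZl. Qed.

Lemma ge0_integralDT f g : measurable_fun setT f -> (forall x, 0 <= f x) ->
  measurable_fun setT g -> (forall x, 0 <= g x) ->
  \int[mu]_x (f x + g x) = \int[mu]_x f x + \int[mu]_x g x.
Proof. by move=> mf f0 mg g0; rewrite ge0_integralD. Qed.

Lemma ge0_le_integralT f g : measurable_fun setT f -> (forall x, 0 <= f x) ->
  measurable_fun setT g -> (forall x, f x <= g x) ->
  \int[mu]_x f x <= \int[mu]_x g x.
Proof. by move=> mf f0 mg fg; apply: ge0_le_integral. Qed.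

Lemma ge0_measurable_funZ f (k : R) :
  measurable_fun setT f -> measurable_fun setT (fun x => k%:E * f x).
Proof. by move=> mf; apply: emeasurable_funM. Qed.

End nonneg_integrals.

(** * Divergence of the integral of |w|^-2 at infinity *)

Definition inv_sq_tail (R : realType) (N : R) (w : Cx R) : \bar R :=
  ((cabs w ^- 2) * \1_[set w : Cx R | N < cabs (w - 0)] w)%:E.

Lemma inv_sq_tail_ge0 (R : realType) (N : R) (w : Cx R) : (0 <= inv_sq_tail N w)%E.
Proof. by rewrite lee_fin mulr_ge0// invr_ge0 exprn_ge0// cabs_ge0. Qed.

Lemma measurable_inv_sq_tail (R : realType) (N : R) : 0 < N ->
  measurable_fun setT (@inv_sq_tail R N \o @toC R :
    measurableTypeR R * measurableTypeR R -> \bar R).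
Proof.
move=> N0; apply: lsc_measurable2 => a; have [a0|a0] := ltP a 0.
  rewrite (_ : [set _ | _] = setT); first exact: openT.
  apply/seteqP; split => // w _ /=.
  by apply: lt_le_trans (inv_sq_tail_ge0 N w); rewrite lte_fin.
have oT : open [set w : Cx R | a * cabs w ^+ 2 < 1].
  move: a0; rewrite le_eqVlt => /predU1P[<-|a0].
    rewrite (_ : [set _ | _] = setT); first exact: openT.
    by apply/seteqP; split => // w _ /=; rewrite mul0r.
  rewrite (_ : [set _ | _] = [set w | cabs (w - 0) < Num.sqrt a^-1]).
    exact: open_cabs_lt.
  apply/seteqP; split => w; rewrite /mkset subr0 => H.
  - rewrite -(ger0_norm (cabs_ge0 w)) -sqrtr_sqr ltr_sqrt ?invr_gt0//.
    by rewrite -[ltRHS]mul1r ltr_pdivlMr// mulrC.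
  - move: H; rewrite -(ger0_norm (cabs_ge0 w)) -sqrtr_sqr ltr_sqrt ?invr_gt0//.
    by rewrite -[ltRHS]mul1r ltr_pdivlMr// mulrC sqrtr_sqr ger0_norm ?cabs_ge0.
rewrite (_ : [set _ | _] = [set w | N < cabs (w - 0)] `&`
    [set w | a * cabs w ^+ 2 < 1]).
  by apply: openI => //; exact: open_cabs_gt.
apply/seteqP; split => w; rewrite /mkset /inv_sq_tail lte_fin indicE.
- have [/set_mem|_] := boolP (_ \in _); last by rewrite mulr0 ltNge a0.
  rewrite /mkset => wN; rewrite mulr1 => H; split => //.
  have w0 : 0 < cabs w by rewrite -[w]subr0 (lt_trans N0).
  by rewrite -ltr_pdivlMr ?exprn_gt0// mul1r.
- move=> [wN]; rewrite mem_set// mulr1.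
  have w0 : 0 < cabs w by rewrite -[w]subr0 (lt_trans N0).
  by rewrite -ltr_pdivlMr ?exprn_gt0// mul1r.
Qed.

(** The measure |w|^-2 dA is invariant under w |-> 2 w, so the tails beyond N and beyond N / 2 have
    the same integral. If it were finite, the annulus between them would contribute 0, whereas a
    disc in it contributes a positive amount. *)
Lemma integral_inv_sq_tail (R : realType) (N : R) : 0 < N ->
  (\int[@lebesgue2 R]_p inv_sq_tail N (toC p) = +oo)%E.
Proof.
move=> N0; apply: contrapT => Joo.
have N20 : 0 < N / 2 by rewrite divr_gt0.
set J := (\int[@lebesgue2 R]_p inv_sq_tail N (toC p))%E in Joo *.
have J0 : (0 <= J)%E by apply: integral_ge0 => p _; exact: inv_sq_tail_ge0.
have Jfin : J \is a fin_num.
  by rewrite ge0_fin_numE// ltey; apply/eqP.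
have c20 : 2%:C%C != 0 :> Cx R by rewrite -cabs_gt0 cabs_real normr_gt0.
have := integral_scale c20 (measurable_inv_sq_tail N0) (@inv_sq_tail_ge0 _ _).
rewrite cabs_real ger0_norm// -/J => E1.
have E2 : (\int[@lebesgue2 R]_p inv_sq_tail N (2%:C%C * toC p)%R =
   (2 ^- 2)%:E * \int[@lebesgue2 R]_p inv_sq_tail (N / 2) (toC p))%E.
  rewrite -(ge0_integralZT _ (measurable_inv_sq_tail N20)
    (fun p => inv_sq_tail_ge0 (N / 2) (toC p))) ?invr_ge0//.
  apply: eq_integral => p _; rewrite /inv_sq_tail -EFinM; congr EFin.
  move: (toC p) => w; rewrite cabsM cabs_real ger0_norm// exprMn invfM -mulrA.
  congr (_ * (_ * _)); rewrite !indicE; congr (nat_of_bool _)%:R.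
  by apply/idP/idP => /set_mem H; apply/mem_set; move: H;
    rewrite /mkset !subr0 cabsM cabs_real ger0_norm// ltr_pdivrMr// mulrC.
have E3 : (\int[@lebesgue2 R]_p inv_sq_tail (N / 2) (toC p) = J)%E.
  move: E1; rewrite E2 => /(congr1 (fun x => (2 ^+ 2)%:E * x)%E).
  by rewrite !muleA -!EFinM mulfV ?mul1e// expf_neq0// pnatr_eq0.
(* A disc inside the annulus N / 2 < |w| < N, on which the integrand is at least N^-2. *)
pose D := disc (3 / 4 * N)%:C%C (N / 8).
have oD : open D by exact: open_cabs_lt.
have DN w : D w -> N / 2 < cabs w < N.
  rewrite /D/disc/mkset => wD.
  have q0 : cabs (3 / 4 * N)%:C%C = 3 / 4 * N.
    by rewrite cabs_real ger0_norm// mulr_ge0// ltW.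
  have := cabs_lip w (3 / 4 * N)%:C%C; rewrite q0 ler_norml => /andP[h1 h2].
  by apply/andP; split; lra.
have : (J + (N ^- 2)%:E * area D <= J)%E.
  have k0 : 0 <= N ^- 2 by rewrite invr_ge0 exprn_ge0// ltW.
  have mJ := measurable_inv_sq_tail N0.
  have mD := ge0_measurable_funZ (N ^- 2) (measurable_indic2 oD).
  rewrite -{2}E3 /J /area -(ge0_integralZT _ (measurable_indic2 oD)
    (fun p => indic_ge0 R D (toC p)) k0).
  have fJ p := inv_sq_tail_ge0 N (toC p).
  have fD p : (0 <= (N ^- 2)%:E * (\1_D (toC p))%:E)%E by rewrite mule_ge0// lee_fin.
  rewrite -(ge0_integralDT _ mJ fJ mD fD).
  apply: ge0_le_integralT; first exact: emeasurable_funD.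
  - by move=> p; rewrite adde_ge0 ?fJ ?fD.
  - exact: measurable_inv_sq_tail.
  move=> p; rewrite /comp; move: (toC p) => w; rewrite /inv_sq_tail -EFinM -EFinD lee_fin !indicE.
  have [/set_mem wN|wN] := boolP (w \in [set w : Cx R | N < cabs (w - 0)]).
    have hD : ~ D w.
      move=> /DN/andP[_]; move: wN; rewrite /mkset subr0.
      by move=> /lt_trans h /h; rewrite ltxx.
    rewrite (memNset hD) mulr0 addr0 mulr1 mem_set ?mulr1//.
    by move: wN; rewrite /mkset; apply: lt_trans; rewrite ltr_pdivrMr// ltr_pMr//; lra.
  rewrite mulr0 add0r; have [/set_mem/DN/andP[w1 w2]|_] := boolP (w \in D); last first.
    by rewrite mulr0 mulr_ge0// invr_ge0 exprn_ge0// cabs_ge0.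
  rewrite mem_set; last by rewrite /mkset subr0.
  have w0 : 0 < cabs w by exact: lt_trans w1.
  by rewrite !mulr1 lef_pV2 ?posrE ?exprn_gt0// lerXn2r ?nnegrE ?cabs_ge0 ?ltW.
rewrite -{2}(adde0 J) leeD2lE//; apply/negP; rewrite -ltNge.
rewrite /D area_disc ?divr_gt0//.
have /andP[A1 _] := @area_disc1_bounds R.
rewrite mule_gt0 ?lte_fin ?invr_gt0 ?exprn_gt0// mule_gt0 ?lte_fin ?exprn_gt0 ?divr_gt0//.
exact: lt_le_trans A1.
Qed.

Lemma volume_tonelli (R : realType) (A : set (Cx2 R)) : open A ->
  (volume A = \int[@lebesgue2 R]_q area [set z1 | A (z1, toC q)])%E.
Proof.
move=> oA; have mA := toC2_open_measurable oA; rewrite volumeE//.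
rewrite (@lebesgue4_tonelli _ (fun z => (\1_A z)%:E)).
- apply: eq_integral => q _; apply: eq_integral => p _; rewrite !indicE.
  by congr (nat_of_bool _)%:R%:E; apply/idP/idP => /set_mem/mem_set.
- exact: measurable_indic_preimage.
- by move=> z; exact: indic_ge0.
Qed.

Lemma measurable_area_section (R : realType) (A : set (Cx2 R)) : open A ->
  measurable_fun setT (fun q : measurableTypeR R * measurableTypeR R =>
    area [set z1 | A (z1, toC q)]).
Proof.
move=> oA; have mA := toC2_open_measurable oA.
have mI := @measurable_indic_preimage _ _ _ R _ _ mA.
have := @measurable_fun_fubini_tonelli_G _ _ _ _ R (@lebesgue2 R)
  _ mI (fun p => indic_ge0 R A (toC2 p)).
apply: eq_measurable_fun => q _; apply: eq_integral => p _; rewrite !indicE.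
by congr (nat_of_bool _)%:R%:E; apply/idP/idP => /set_mem/mem_set.
Qed.

Lemma open_section (R : realType) (A : set (Cx2 R)) (c : Cx R) : open A ->
  open [set z1 | A (z1, c)].
Proof.
move=> oA; rewrite openE => z /= Az.
have /nbhs_Cx2P[e e0 H] := open_nbhs_nbhs (conj oA Az).
by apply/nbhs_CxP; exists e => // y yz; apply: H; rewrite //= subrr cabs0.
Qed.

Lemma le_area (R : realType) (A B : set (Cx R)) : open A -> open B ->
  A `<=` B -> (area A <= area B)%E.
Proof.
move=> oA oB AB; apply: ge0_le_integralT.
- exact: (measurable_indic2 oA).
- by move=> p; exact: indic_ge0.
- exact: (measurable_indic2 oB).
- move=> p; rewrite lee_fin !indicE ler_nat.
  by have [/set_mem/AB/mem_set ->|] := boolP (_ \in A).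
Qed.

Lemma volume_infinite (R : realType) (h : Cx2 R -> R) (v1 v2 : Cx R) (C : R) :
  balanced_gauge h -> v2 != 0 -> 0 < C ->
  (forall w, w != v1 -> cabs (w - v1) < 1 ->
     h (w, v2) ^+ 2 <= C * cabs (w - v1)) ->
  volume (balanced_domain h) = +oo%E.
Proof.
move=> hg v20 C0 Hh; have [h0 _ hom] := hg.
have oD := open_balanced_domain hg.
have av2 : 0 < cabs v2 by rewrite cabs_gt0.
(* With om = z1 - (v1 / v2) z2, homogeneity and the hypothesis give h(z)^2 <= |om| |z2| / c0. *)
pose c0 := cabs v2 / C.
have c00 : 0 < c0 by rewrite divr_gt0.
(* For |z2| > N the point [w] below satisfies |w - v1| < 1, where the hypothesis applies. *)
pose N := c0 * cabs v2 + 1.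
have N0 : 0 < N by rewrite ltr_pwDr// mulr_ge0// ltW.
have NN : c0 * cabs v2 <= N ^+ 2.
  have : 0 <= c0 * cabs v2 by rewrite mulr_ge0// ltW.
  by rewrite /N; nra.
have [A1 A1E] : exists A1 : R, area (disc (0 : Cx R) 1) = A1%:E /\ 0 < A1.
  have /andP[] := @area_disc1_bounds R.
  case: (area _) => [r||] //.
  by rewrite !lee_fin => r1 _; exists r; split => //; exact: lt_le_trans r1.
case: A1E => A1E A10.
pose k := (c0 / 2) ^+ 2 * A1.
have k0 : 0 < k by rewrite mulr_gt0// exprn_gt0// divr_gt0.
apply/eqP; rewrite -leye_eq.
have <- : (k%:E * \int[@lebesgue2 R]_q inv_sq_tail N (toC q) = +oo)%E.
  by rewrite integral_inv_sq_tail// gt0_muley// lte_fin.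
rewrite volume_tonelli//.
rewrite -(ge0_integralZT _ (measurable_inv_sq_tail N0)
    (fun p => inv_sq_tail_ge0 N (toC p)) (ltW k0)).
apply: ge0_le_integralT.
- exact: ge0_measurable_funZ (measurable_inv_sq_tail N0).
- by move=> q; rewrite mule_ge0 ?lee_fin ?(ltW k0)//; exact: inv_sq_tail_ge0.
- exact: measurable_area_section.
move=> q; rewrite /comp; move: (toC q) => z2.
rewrite /inv_sq_tail indicE.
have [/set_mem|_] := boolP (z2 \in _); last first.
  by rewrite mulr0 mule0; apply: integral_ge0 => p _; exact: indic_ge0.
rewrite /mkset subr0 mulr1 => z2N.
have az2 : 0 < cabs z2 by exact: lt_trans z2N.
have z20 : z2 != 0 by rewrite -cabs_gt0.
pose r := c0 / 2 / cabs z2.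
have r0 : 0 < r by rewrite divr_gt0// divr_gt0.
pose kap := v1 / v2.
(* The centre is shifted by r so that this open disc avoids om = 0, that is w = v1, while |om| < 2 r
   = c0 / |z2| on it. *)
pose B := disc (kap * z2 + r%:C%C) r.
have oB : open B by exact: open_cabs_lt.
have -> : (k%:E * (cabs z2 ^- 2)%:E = area B)%E.
  rewrite area_disc// A1E -!EFinM; congr EFin; rewrite /k /r.
  by field; rewrite gt_eqF.
apply: le_area => //; first exact: open_section.
move=> z1; rewrite /B /disc /mkset => hB.
set om := z1 - kap * z2.
have omr : cabs (om - r%:C%C) < r by rewrite /om -addrA -opprD.
have om0 : om != 0.
  apply/eqP => om0; move: omr; rewrite om0 sub0r cabsN cabs_real gtr0_norm//.
  by rewrite ltxx.
have om2r : cabs om < 2 * r.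
  have := cabs_lip om r%:C%C; rewrite (cabs_real r) (gtr0_norm r0) ler_norml => /andP[_].
  lra.
have omz : cabs om * cabs z2 < c0.
  by rewrite -ltr_pdivlMr//; move: om2r; rewrite /r; lra.
pose w := z1 * v2 / z2.
have wv : w - v1 = om * (v2 / z2).
  by rewrite /w /om /kap; field; rewrite z20 v20.
have awv : cabs (w - v1) = cabs om * (cabs v2 / cabs z2).
  by rewrite wv cabsM cabsM ComplexField.Normc.normcV.
have w1 : cabs (w - v1) < 1.
  rewrite awv mulrA ltr_pdivrMr// mul1r.
  have : cabs om * cabs z2 * cabs v2 < cabs z2 * cabs z2.
    apply: (@lt_le_trans _ _ (c0 * cabs v2)); first by rewrite ltr_pM2r.
    apply: le_trans NN _; rewrite -expr2 lerXn2r ?nnegrE ?ltW//.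
  by rewrite mulrAC ltr_pM2r.
have wv1 : w != v1.
  rewrite -subr_eq0 wv mulf_neq0//.
  by rewrite mulf_neq0// invr_eq0.
have zE : (z1, z2) = (z2 / v2) *: ((w, v2) : Cx2 R).
  by congr (_, _); rewrite /w /= /GRing.scale/=; field; rewrite ?z20 ?v20.
rewrite /balanced_domain /mkset zE hom.
have H2 := Hh _ wv1 w1.
have hw0 := h0 (w, v2).
have az : cabs (z2 / v2) = cabs z2 / cabs v2.
  by rewrite cabsM ComplexField.Normc.normcV.
have ah : 0 <= cabs z2 / cabs v2 * h (w, v2).
  by rewrite mulr_ge0// divr_ge0// cabs_ge0.
rewrite az -(expr_lt1 (n := 2) _ ah)// exprMn.
apply: (@le_lt_trans _ _ ((cabs z2 / cabs v2) ^+ 2 * (C * cabs (w - v1)))).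
  by rewrite ler_wpM2l// exprn_ge0// divr_ge0// cabs_ge0.
have -> : (cabs z2 / cabs v2) ^+ 2 * (C * cabs (w - v1)) =
    cabs om * cabs z2 / c0.
  by rewrite awv /c0; field; rewrite !gt_eqF.
by rewrite ltr_pdivrMr// mul1r.
Qed.

Lemma lelong_volume_infinite (R : realType) (h : Cx2 R -> R) (v1 v2 : Cx R) :
  balanced_gauge h -> balanced_pseudoconvex h -> (exists z, h z != 0) ->
  v2 != 0 ->
  ~ (lelong (fun l => log_gauge h (l, v2)) v1 < (1 / 2)%:E)%E ->
  volume (balanced_domain h) = +oo%E.
Proof.
move=> hg psh hn v20 /negP; rewrite -leNgt.
have [l ul] := gauge_line_neq0 hg psh hn v20.
have [nu [-> [c Hc] _]] := lelong_spec v1 (line_submean v2 psh) ul.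
rewrite lee_fin => nu12.
(* exp (2 c) is the square of the constant in h <= exp (c) |w - v1|^nu; the exponent may be lowered
   to 1/2 because |w - v1| < 1. *)
apply: (volume_infinite (v1 := v1) hg v20 (expR_gt0 (2 * c))) => w wv1 w1.
have [h0 _ _] := hg.
have a0 : 0 < cabs (w - v1) by rewrite cabs_gt0 subr_eq0.
have [hw0|hw0] := leP (h (w, v2)) 0.
  have -> : h (w, v2) = 0 by apply/le_anti; rewrite hw0 h0.
  by rewrite expr0n/= mulr_ge0 ?expR_ge0// ltW.
have := Hc w wv1 w1; rewrite /log_gauge lne_EFin// lee_fin => H.
have ln0 : ln (cabs (w - v1)) < 0 by rewrite ln_lt0// a0.
have hE : h (w, v2) = expR (ln (h (w, v2))) by rewrite lnK.
have aE : cabs (w - v1) = expR (ln (cabs (w - v1))) by rewrite lnK.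
rewrite [in leLHS]hE [X in _ * X]aE expr2 -!expRD ler_expR.
have : nu * ln (cabs (w - v1)) <= 1 / 2 * ln (cabs (w - v1)) by rewrite ler_nM2r.
lra.
Qed.

(** * Sublevel sets of superharmonic functions *)

Definition lsc_ext (T : topologicalType) (R : realType) (f : T -> \bar R) :=
  forall a : R, open [set x | (a%:E < f x)%E].

Lemma lsc_ext_comp (T U : topologicalType) (R : realType) (phi : T -> U)
    (f : U -> \bar R) : continuous phi -> lsc_ext f -> lsc_ext (f \o phi).
Proof.
by move=> cphi lf a; apply: (open_comp (f := phi)) (lf a) => x _; exact: cphi.
Qed.

Lemma lsc_ext_indic (T : topologicalType) (R : realType) (A : set T) :
  open A -> lsc_ext (fun x => (\1_A x : R)%:E).
Proof.
move=> oA a; have [a0|a0] := ltP a 0.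
  rewrite (_ : [set _ | _] = setT); first exact: openT.
  apply/seteqP; split => // x _; rewrite /mkset lte_fin indicE.
  exact: lt_le_trans a0 _.
have [a1|a1] := ltP a 1.
  rewrite (_ : [set _ | _] = A)//; apply/seteqP; split => x; rewrite /mkset lte_fin indicE.
    by have [/set_mem//|_] := boolP (x \in A); rewrite ltNge a0.
  by move=> /mem_set ->.
rewrite (_ : [set _ | _] = set0); first exact: open0.
apply/seteqP; split => // x; rewrite /mkset lte_fin indicE.
by case: (x \in A); rewrite ltNge ?a1 ?a0.
Qed.

(** Test function for the area estimate: the paraboloid has an exact second difference, and the
    truncation at 0 only raises it, which is the favourable direction in [bump_midpoint]. *)
Definition bump (R : realType) (a : Cx R) (S : R) (z : Cx R) : R :=
  Num.max 0 (1 - (cabs (z - a) / S) ^+ 2).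

(** * Disc means *)

Section superharmonic.
Variables (R : realType) (V : Cx R -> \bar R) (a : Cx R) (P : R).
Hypotheses (V0 : forall z, (0 <= V z)%E) (lV : lsc_ext V).
Hypothesis V_super : forall z b : Cx R, cabs (z - a) + cabs b < P ->
  (\int[@lebesgue_measure R]_(t in `[0%R, (2 * pi)%R]) V (z + b * cis t)%R
     <= (2 * pi)%:E * V z)%E.
Local Open Scope ereal_scope.
Local Notation mu2 := (@lebesgue2 R).

(** The disc mean times the area of the disc, which avoids a division in [\bar R]. *)
Definition disc_integral (z : Cx R) (r : R) : \bar R :=
  \int[mu2]_p ((\1_(disc 0%R r) (toC p))%:E * V (z + toC p)%R).

Lemma addr_continuous (z : Cx R) : continuous (fun w : Cx R => (z + w)%R).
Proof.
move=> w A /nbhs_CxP[e e0 H]; apply/nbhs_CxP; exists e => // y yw.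
by apply: H; rewrite opprD addrACA subrr add0r.
Qed.

Lemma measurable_shift (z : Cx R) : measurable_fun setT
  ((fun w => V (z + w)%R) \o @toC R : measurableTypeR R * measurableTypeR R -> _).
Proof. by apply: lsc_measurable2; exact: (lsc_ext_comp (@addr_continuous z) lV). Qed.

Lemma measurable_disc_shift (z : Cx R) (r : R) : measurable_fun setT
  ((fun w => (\1_(disc 0%R r) w)%:E * V (z + w)%R) \o @toC R :
    measurableTypeR R * measurableTypeR R -> _).
Proof.
apply: emeasurable_funM; last exact: measurable_shift.
by apply: measurable_indic2; exact: open_cabs_lt.
Qed.

(** From circles to discs: the disc integral is averaged over rotations about z, and for each w in
    the disc the average of V(z + exp (it) w) is at most V(z). *)
Lemma disc_integral_le (z : Cx R) (r : R) : (cabs (z - a) + r <= P)%R ->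
  disc_integral z r <= area (disc (0 : Cx R)%R r) * V z.
Proof.
move=> zP; pose G (w : Cx R) := (\1_(disc 0%R r) w)%:E * V (z + w)%R.
have G0 w : 0 <= G w by rewrite mule_ge0// indic_ge0.
have pi20 : (0 < 2 * pi :> R)%R by rewrite mulr_gt0// pi_gt0.
have [mI EI] := integral2_circle (measurable_disc_shift z r) G0.
rewrite -(@lee_pmul2l _ (2 * pi)%:E) ?lte_fin//.
rewrite [X in X <= _]EI /area.
have VD0 p : 0 <= (\1_(disc 0%R r) (toC p))%:E * V z by rewrite mule_ge0// indic_ge0.
have oD : open (disc (0 : Cx R)%R r) by exact: open_cabs_lt.
have mVD : measurable_fun setT (fun p : measurableTypeR R * measurableTypeR R =>
    (\1_(disc 0%R r) (toC p))%:E * V z).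
  by apply: emeasurable_funM => //; exact: measurable_indic2.
have -> : (2 * pi)%:E * (\int[mu2]_p (\1_(disc 0%R r) (toC p))%:E * V z) =
    \int[mu2]_p ((2 * pi)%:E * ((\1_(disc 0%R r) (toC p))%:E * V z)).
  rewrite ge0_integralZT// ?ltW//; congr (_ * _).
  rewrite ge0_integralZr//; first exact: (measurable_indic2 oD).
apply: ge0_le_integralT => //.
- by move=> p; apply: integral_ge0 => t _; exact: G0.
- exact: ge0_measurable_funZ.
move=> p; move: (toC p) => w; rewrite /G.
have Ew t : ((cis t * w)%R \in disc (0 : Cx R)%R r) = (w \in disc (0 : Cx R)%R r).
  by apply/idP/idP => /set_mem H; apply/mem_set; move: H;
    rewrite /disc/mkset !subr0 cabsM cabs_cis mul1r.
under eq_integral => t _ do rewrite indicE Ew (mulrC (cis t)).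
rewrite indicE; have [/set_mem|_] := boolP (w \in _).
  rewrite /disc/mkset subr0 => wr.
  under eq_integral do rewrite mul1e.
  by rewrite mul1e; apply: V_super; apply: lt_le_trans zP; rewrite ltrD2l.
under eq_integral do rewrite mul0e.
by rewrite integral0 mul0e mule0.
Qed.

Lemma disc_integral_mono (z w : Cx R) (r s : R) :
  (cabs (z - w) + r <= s)%R -> disc_integral z r <= disc_integral w s.
Proof.
move=> zws.
have mz := measurable_disc_shift z r; have mw := measurable_disc_shift w s.
have Fz0 y : 0 <= (\1_(disc 0%R s) y)%:E * V (w + y)%R by rewrite mule_ge0// indic_ge0.
rewrite /disc_integral -(integral_translate (z - w)%R mw Fz0).
apply: ge0_le_integralT.
- exact: mz.
- by move=> p; rewrite mule_ge0// indic_ge0.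
- apply: emeasurable_funM.
    have oD : open [set y : Cx R | disc 0%R s (y + (z - w))%R].
      rewrite (_ : [set _ | _] = disc (w - z)%R s); first exact: open_cabs_lt.
      by apply/seteqP; split => y; rewrite /disc/mkset subr0 opprB.
    have := measurable_indic2 oD; apply: eq_measurable_fun => p _ /=.
    by rewrite !indicE; congr (nat_of_bool _)%:R%:E; apply/idP/idP => /set_mem H; apply/mem_set.
  have := measurable_shift z; apply: eq_measurable_fun => p _ /=.
  by congr V; rewrite addrCA [(w + (z - w))%R]addrC subrK addrC.
move=> p; move: (toC p) => y.
have -> : (w + (y + (z - w)))%R = (z + y)%R.
  by rewrite addrCA [(w + (z - w))%R]addrC subrK addrC.
rewrite lee_wpmul2r// lee_fin !indicE ler_nat.
have [/set_mem|//] := boolP (y \in _); rewrite /disc/mkset subr0 => yr.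
rewrite mem_set// /disc/mkset subr0.
by have := cabsD y (z - w)%R; lra.
Qed.

End superharmonic.

Lemma bump_ge0 (R : realType) (a : Cx R) (S : R) (z : Cx R) : 0 <= bump a S z.
Proof. by rewrite /bump le_max lexx. Qed.

Lemma bump_le1 (R : realType) (a : Cx R) (S : R) (z : Cx R) : bump a S z <= 1.
Proof. by rewrite /bump ge_max ler01 gerBl sqr_ge0. Qed.

Lemma bump_out (R : realType) (a : Cx R) (S : R) (z : Cx R) : 0 < S ->
  ~ disc a S z -> bump a S z = 0.
Proof.
move=> S0; rewrite /disc/mkset => /negP; rewrite -leNgt => Sz.
rewrite /bump; apply/max_idPl; rewrite subr_le0.
by rewrite exprn_ege1// ler_pdivlMr// mul1r.
Qed.

Lemma bump_half (R : realType) (a : Cx R) (S : R) (z : Cx R) : 0 < S ->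
  disc a (S / 2) z -> 1 / 2 <= bump a S z.
Proof.
move=> S0; rewrite /disc/mkset => Sz.
rewrite /bump le_max; apply/orP; right.
have q : cabs (z - a) / S <= 1 / 2 by rewrite ler_pdivrMr//; lra.
have q0 : 0 <= cabs (z - a) / S by rewrite divr_ge0 ?cabs_ge0// ltW.
nra.
Qed.

Lemma cabs_parallelogram (R : realType) (z w : Cx R) :
  cabs (z + w) ^+ 2 + cabs (z - w) ^+ 2 = 2 * cabs z ^+ 2 + 2 * cabs w ^+ 2.
Proof. by case: z w => [x y] [x' y']; rewrite !cabs_sqrE /=; ring. Qed.

(** The parallelogram identity gives the second difference of the paraboloid. Where the bump is
    positive it equals the paraboloid, and at z - w and z + w it is at least the paraboloid. *)
Lemma bump_midpoint (R : realType) (a : Cx R) (S : R) (z w : Cx R) : 0 < S ->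
  0 < bump a S z ->
  2 * bump a S z <= bump a S (z - w) + bump a S (z + w) + 2 * (cabs w / S) ^+ 2.
Proof.
move=> S0 bz.
have le y : 1 - (cabs (y - a) / S) ^+ 2 <= bump a S y by rewrite /bump le_max lexx orbT.
have -> : bump a S z = 1 - (cabs (z - a) / S) ^+ 2.
  by move: bz; rewrite /bump lt_max ltxx/= => h; apply/max_idPr; exact: ltW.
have := le (z - w); have := le (z + w).
have := cabs_parallelogram (z - a) w.
rewrite (_ : z - a + w = z + w - a); last by rewrite addrAC.
rewrite (_ : z - a - w = z - w - a); last by rewrite addrAC.
rewrite !expr_div_n => E h1 h2.
have S2 : 0 < S ^- 2 by rewrite invr_gt0 exprn_gt0.
have := congr1 (fun x => x * S ^- 2) E => {}E.
lra.
Qed.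

Lemma lsc_bump (R : realType) (a : Cx R) (S : R) : 0 < S ->
  lsc_ext (fun z => (bump a S z)%:E).
Proof.
move=> S0 c; have [c0|c0] := ltP c 0.
  rewrite (_ : [set _ | _] = setT); first exact: openT.
  apply/seteqP; split => // x _; rewrite /mkset lte_fin.
  exact: lt_le_trans (bump_ge0 _ _ _).
(* For c >= 1 the root is 0, by default when c > 1, and both sets are empty. *)
rewrite (_ : [set _ | _] = [set z | cabs (z - a) < S * Num.sqrt (1 - c)]).
  exact: open_cabs_lt.
apply/seteqP; split => z; rewrite /mkset lte_fin /bump lt_max (ltNge c 0) c0/=.
- rewrite ltrBrDl -ltrBrDr => h.
  have q0 : 0 <= cabs (z - a) / S by rewrite divr_ge0 ?cabs_ge0// ltW.
  rewrite mulrC -ltr_pdivrMr// -(ger0_norm q0) -sqrtr_sqr ltr_sqrt//.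
  by apply: le_lt_trans h; rewrite sqr_ge0.
- rewrite ltrBrDl -ltrBrDr mulrC -ltr_pdivrMr// => h.
  have q0 : 0 <= cabs (z - a) / S by rewrite divr_ge0 ?cabs_ge0// ltW.
  have c1 : 0 <= 1 - c.
    have := le_lt_trans q0 h; rewrite ltNge; apply: contraNle => c1.
    by rewrite ltr0_sqrtr.
  by rewrite -(sqr_sqrtr c1) ltrXn2r// nnegrE sqrtr_ge0.
Qed.

Lemma cx2_add_continuous (R : realType) : continuous (fun z : Cx2 R => z.1 + z.2).
Proof.
move=> w A /nbhs_CxP[e e0 H]; apply/nbhs_Cx2P; exists (e / 2); first by rewrite divr_gt0.
move=> y h1 h2; apply: H; rewrite opprD addrACA.
by apply: le_lt_trans (cabsD _ _) _; lra.
Qed.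

Lemma cx2_sub_continuous (R : realType) : continuous (fun z : Cx2 R => z.1 - z.2).
Proof.
move=> w A /nbhs_CxP[e e0 H]; apply/nbhs_Cx2P; exists (e / 2); first by rewrite divr_gt0.
move=> y h1 h2; apply: H; rewrite opprD addrACA.
apply: le_lt_trans (cabsD _ _) _; rewrite -[- y.2 - - w.2]opprD cabsN; lra.
Qed.

Lemma subr_continuous (R : realType) (z : Cx R) : continuous (fun w : Cx R => z - w).
Proof.
move=> w A /nbhs_CxP[e e0 H]; apply/nbhs_CxP; exists e => // y yw.
have E : z - y - (z - w) = w - y by ring.
by apply: H; rewrite E cabs_distC.
Qed.

Lemma tonelli_exchange (R : realType) (f : Cx2 R -> \bar R) :
  measurable_fun setT
    (f \o @toC2 R : (measurableTypeR R * measurableTypeR R) *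
                    (measurableTypeR R * measurableTypeR R) -> _) ->
  (forall x, (0 <= f x)%E) ->
  measurable_fun setT (fun p : measurableTypeR R * measurableTypeR R =>
    \int[@lebesgue2 R]_q f (toC p, toC q))%E /\
  (\int[@lebesgue2 R]_p \int[@lebesgue2 R]_q f (toC p, toC q) =
   \int[@lebesgue2 R]_q \int[@lebesgue2 R]_p f (toC p, toC q))%E.
Proof.
move=> mf f0.
have F0 p := f0 (toC2 p).
split.
  exact: (@measurable_fun_fubini_tonelli_F _ _ _ _ R (@lebesgue2 R) _ mf F0).
have <- := @fubini_tonelli1 _ _ _ _ R (@lebesgue2 R) (@lebesgue2 R) _ mf F0.
exact: (@fubini_tonelli2 _ _ _ _ R (@lebesgue2 R) (@lebesgue2 R) _ mf F0).
Qed.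

Section sublevel.
Variables (R : realType) (V : Cx R -> \bar R).
Hypotheses (V0 : forall z, (0 <= V z)%E) (lV : lsc_ext V).
Local Open Scope ereal_scope.
Local Notation mu2 := (@lebesgue2 R).

Lemma measurable_disc_kernel (r : R) : measurable_fun setT
  ((fun z : Cx2 R => (\1_(disc 0%R r) z.2)%:E * V (z.1 + z.2)%R) \o @toC2 R :
  (measurableTypeR R * measurableTypeR R) *
  (measurableTypeR R * measurableTypeR R) -> _).
Proof.
have csnd : continuous (snd : Cx2 R -> Cx R) by move=> z; exact: cvg_snd.
have lI : lsc_ext (fun z : Cx R => (\1_(disc 0%R r) z : R)%:E).
  by apply: lsc_ext_indic; exact: open_cabs_lt.
apply: emeasurable_funM; first exact: (lsc_measurable4 (lsc_ext_comp csnd lI)).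
exact: (lsc_measurable4 (lsc_ext_comp (@cx2_add_continuous R) lV)).
Qed.

Lemma measurable_disc_integral (r : R) :
  measurable_fun setT (fun p : measurableTypeR R * measurableTypeR R =>
    disc_integral V (toC p) r).
Proof.
have [] := tonelli_exchange (measurable_disc_kernel r).
  by move=> z; rewrite mule_ge0// indic_ge0.
by [].
Qed.

Lemma disc_integral_reflect (z : Cx R) (r : R) :
  \int[mu2]_p ((\1_(disc 0%R r) (toC p))%:E * V (z - toC p)%R) = disc_integral V z r.
Proof.
have n1 : (-1 : Cx R)%R != 0%R by rewrite oppr_eq0 oner_eq0.
have F0 w : 0 <= (\1_(disc 0%R r) w)%:E * V (z + w)%R by rewrite mule_ge0// indic_ge0.
have := integral_scale n1 (measurable_disc_shift lV z r) F0.
have -> : cabs (-1 : Cx R)%R = 1%R.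
  by rewrite cabsN -[1%R](rmorph1 (real_complex R)) cabs_real normr1.
rewrite expr1n invr1 mul1e => H; rewrite /disc_integral -[RHS]H.
apply: eq_integral => p _; move: (toC p) => w {H}; rewrite mulN1r !indicE; congr (_%:E * _).
congr (nat_of_bool _)%:R; apply/idP/idP => /set_mem H; apply/mem_set; move: H;
by rewrite /disc/mkset !subr0 cabsN.
Qed.

Lemma disc_integral_ge0 (z : Cx R) (r : R) : 0 <= disc_integral V z r.
Proof. by apply: integral_ge0 => p _; rewrite mule_ge0// indic_ge0. Qed.

End sublevel.

(** The kernel is symmetric: after Tonelli, translating the inner variable by w turns the pair (z, z
    + w) into (z - w, z), and [disc_integral_reflect] restores the sign. *)
Lemma disc_integral_self_adjoint (R : realType) (V B : Cx R -> \bar R) (r : R) :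
  (forall z, (0 <= V z)%E) -> lsc_ext V -> (forall z, (0 <= B z)%E) -> lsc_ext B ->
  (\int[@lebesgue2 R]_p (B (toC p) * disc_integral V (toC p) r) =
   \int[@lebesgue2 R]_p (V (toC p) * disc_integral B (toC p) r))%E.
Proof.
move=> V0 lV B0 lB.
pose f (z : Cx2 R) := (B z.1 * ((\1_(disc 0%R r) z.2)%:E * V (z.1 + z.2)%R))%E.
pose g (z : Cx2 R) := (V z.1 * ((\1_(disc 0%R r) z.2)%:E * B (z.1 - z.2)%R))%E.
have cfst : continuous (fst : Cx2 R -> Cx R) by move=> z; exact: cvg_fst.
have csnd : continuous (snd : Cx2 R -> Cx R) by move=> z; exact: cvg_snd.
have lI : lsc_ext (fun z : Cx R => (\1_(disc 0%R r) z : R)%:E).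
  by apply: lsc_ext_indic; exact: open_cabs_lt.
have mf : measurable_fun setT (f \o @toC2 R :
    (measurableTypeR R * measurableTypeR R) *
                    (measurableTypeR R * measurableTypeR R) -> _).
  apply: emeasurable_funM; last exact: measurable_disc_kernel.
  exact: (lsc_measurable4 (lsc_ext_comp cfst lB)).
have mg : measurable_fun setT (g \o @toC2 R :
    (measurableTypeR R * measurableTypeR R) *
                    (measurableTypeR R * measurableTypeR R) -> _).
  apply: emeasurable_funM; first exact: (lsc_measurable4 (lsc_ext_comp cfst lV)).
  apply: emeasurable_funM; first exact: (lsc_measurable4 (lsc_ext_comp csnd lI)).
  exact: (lsc_measurable4 (lsc_ext_comp (@cx2_sub_continuous R) lB)).
have f0 z : (0 <= f z)%E by rewrite mule_ge0// mule_ge0// indic_ge0.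
have g0 z : (0 <= g z)%E by rewrite mule_ge0// mule_ge0// indic_ge0.
have ker0 (W : Cx R -> \bar R) (W0 : forall z, (0 <= W z)%E) (z : Cx R) (q : R * R) :
    (0 <= ((fun w => (\1_(disc 0%R r) w)%:E * W (z + w)%R) \o @toC R) q)%E.
  by rewrite mule_ge0// indic_ge0.
have msub (z : Cx R) : measurable_fun setT
    ((fun w => (\1_(disc 0%R r) w)%:E * B (z - w)%R)%E \o @toC R :
      measurableTypeR R * measurableTypeR R -> _).
  apply: emeasurable_funM; first by apply: measurable_indic2; exact: open_cabs_lt.
  exact: (lsc_measurable2 (lsc_ext_comp (@subr_continuous R z) lB)).
have [_ Ef] := tonelli_exchange mf f0.
have [_ Eg] := tonelli_exchange mg g0.
transitivity (\int[@lebesgue2 R]_p \int[@lebesgue2 R]_q f (toC p, toC q))%E.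
  apply: eq_integral => p _; apply/esym.
  exact: (ge0_integralZeT _ (measurable_disc_shift lV (toC p) r) (ker0 V V0 _) (B0 _)).
transitivity (\int[@lebesgue2 R]_p \int[@lebesgue2 R]_q g (toC p, toC q))%E; last first.
  apply: eq_integral => p _; rewrite -(disc_integral_reflect B0 lB).
  apply: (ge0_integralZeT _ (msub (toC p)) _ (V0 _)) => q.
  by rewrite mule_ge0// indic_ge0.
rewrite Ef Eg; apply: eq_integral => q _.
have mgq : measurable_fun setT ((fun w => g (w, toC q)) \o @toC R :
   measurableTypeR R * measurableTypeR R -> _).
  exact: (measurableT_comp mg (pair2_measurable q)).
rewrite -(integral_translate (toC q) mgq (fun w => g0 _)).
apply: eq_integral => p _; rewrite /f /g; move: (toC p) (toC q) => z w.
have -> : (z + w, w).1 - (z + w, w).2 = z by rewrite /= addrK.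
by rewrite /fst /snd muleCA [RHS]muleCA (muleC (B _)).
Qed.

Lemma area_disc_fin (R : realType) (a : Cx R) (r : R) : 0 < r ->
  exists2 A : R, 0 < A & area (disc a r) = A%:E.
Proof.
move=> r0; have /andP[] := @area_disc1_bounds R; rewrite (area_disc a r0).
case: (area _) => [A||] //; rewrite lee_fin => A1 _.
exists (r ^+ 2 * A) => //.
by rewrite mulr_gt0 ?exprn_gt0// (lt_le_trans _ A1).
Qed.

(** Integrates [bump_midpoint] over |w| < r, with |w| bounded by r in the error; reflection
    identifies the two halves. *)
Lemma bump_mean (R : realType) (a z : Cx R) (S r A : R) : 0 < S -> 0 < r ->
  0 < A -> area (disc (0 : Cx R) r) = A%:E ->
  ((A * bump a S z)%:E <= disc_integral (fun w => (bump a S w)%:E) z r +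
    (A * (r / S) ^+ 2)%:E * (\1_(disc a S) z)%:E)%E.
Proof.
move=> S0 r0 A0 AE; set B := fun w => (bump a S w)%:E.
have B0 w : (0 <= B w)%E by rewrite lee_fin bump_ge0.
have lB : lsc_ext B by exact: lsc_bump.
have D0 := disc_integral_ge0 B0 z r.
have c0 : 0 <= A * (r / S) ^+ 2 by rewrite mulr_ge0 ?sqr_ge0// ltW.
have := bump_ge0 a S z; rewrite le_eqVlt => /predU1P[<-|bz].
  by rewrite mulr0; apply: adde_ge0 => //; apply: mule_ge0; [rewrite lee_fin|exact: indic_ge0].
have zD : disc a S z.
  by apply: contrapT => /(bump_out S0) bz0; move: bz; rewrite bz0 ltxx.
rewrite indicE (mem_set zD) mule1.
have mI : measurable_fun setT ((fun w => (\1_(disc 0 r) w)%:E) \o @toC R :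
    measurableTypeR R * measurableTypeR R -> \bar R).
  by apply: measurable_indic2; exact: open_cabs_lt.
have I0 (q : R * R) : (0 <= ((fun w => (\1_(disc 0 r) w : R)%:E) \o @toC R) q)%E.
  exact: indic_ge0.
have mp := measurable_disc_shift lB z r.
have mm : measurable_fun setT
    ((fun w => (\1_(disc 0 r) w)%:E * B (z - w)%R)%E \o @toC R :
      measurableTypeR R * measurableTypeR R -> _).
  apply: emeasurable_funM; first exact: mI.
  exact: (lsc_measurable2 (lsc_ext_comp (@subr_continuous R z) lB)).
have p0 (q : R * R) : (0 <= ((fun w => (\1_(disc 0 r) w)%:E * B (z + w)%R)%E \o @toC R) q)%E.
  by rewrite mule_ge0// indic_ge0.
have m0 (q : R * R) : (0 <= ((fun w => (\1_(disc 0 r) w)%:E * B (z - w)%R)%E \o @toC R) q)%E.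
  by rewrite mule_ge0// indic_ge0.
have k0 : 0 <= 2 * bump a S z by rewrite mulr_ge0// ltW.
have k1 : 0 <= 2 * (r / S) ^+ 2 by rewrite mulr_ge0// sqr_ge0.
have E1 := ge0_integralZT (@lebesgue2 R) mI I0 k0.
have E2 := ge0_integralZT (@lebesgue2 R) mI I0 k1.
have mI1 := ge0_measurable_funZ (2 * (r / S) ^+ 2) mI.
have I10 (q : R * R) : (0 <= (2 * (r / S) ^+ 2)%:E *
    ((fun w => (\1_(disc 0 r) w : R)%:E) \o @toC R) q)%E by rewrite mule_ge0.
have E3 := ge0_integralDT (@lebesgue2 R) mm m0 mp p0.
have E4 := ge0_integralDT (@lebesgue2 R) (emeasurable_funD mm mp)
  (fun q => adde_ge0 (m0 q) (p0 q)) mI1 I10.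
have key : ((2 * bump a S z)%:E * area (disc (0%R : Cx R) r) <=
   disc_integral B z r + disc_integral B z r +
   (2 * (r / S) ^+ 2)%:E * area (disc (0%R : Cx R) r))%E.
  rewrite /area -E1 -E2 -{1}(disc_integral_reflect B0 lB) /disc_integral -E3 -E4.
  apply: ge0_le_integralT.
  - exact: ge0_measurable_funZ.
  - by move=> q; rewrite mule_ge0.
  - by apply: emeasurable_funD => //; exact: emeasurable_funD.
  move=> q; rewrite /comp; move: (toC q) => w; rewrite !indicE.
  have [/set_mem|_] := boolP (w \in _); last by rewrite !mule0 !mul0e !adde0.
  rewrite /disc/mkset subr0 => wr; rewrite !mule1 !mul1e -!EFinD lee_fin.
  apply: le_trans (bump_midpoint w S0 bz) _; rewrite lerD2l ler_pM2l//.
  rewrite lerXn2r ?nnegrE ?divr_ge0 ?cabs_ge0 ?(ltW r0) ?(ltW S0)//.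
  by rewrite ler_pM2r ?invr_gt0// ltW.
move: key; rewrite AE; move: D0; case: (disc_integral B z r) => [d||] //.
  by rewrite -!EFinM -!EFinD !lee_fin; lra.
by move=> _ _; rewrite addye ?leey.
Qed.

(* Pair V with the bump B = max(0, 1 - |z - a|^2 / S^2).  Disc means are
   self-adjoint, those of V are at most V and at most V - 1 where V > T + 1,
   and those of B fall below B by at most (r / S)^2. *)
Lemma superharmonic_sublevel (R : realType) (V : Cx R -> \bar R) (a : Cx R)
    (P S r T I : R) :
  (forall z, (0 <= V z)%E) -> lsc_ext V ->
  (forall z b : Cx R, cabs (z - a) + cabs b < P ->
    (\int[@lebesgue_measure R]_(t in `[0%R, (2 * pi)%R]) V (z + b * cis t)%R
     <= (2 * pi)%:E * V z)%E) ->
  0 < S -> 0 < r -> S + r <= P -> 0 <= T ->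
  (forall z, disc a S z -> (disc_integral V z r <= area (disc (0%R : Cx R) r) * T%:E)%E) ->
  (\int[@lebesgue2 R]_p (V (toC p) * (\1_(disc a S) (toC p))%:E) <= I%:E)%E ->
  (area [set z | disc a (S / 2) z /\ ((T + 1)%:E < V z)%E] <=
    (2 * (r / S) ^+ 2 * I)%:E)%E.
Proof.
move=> V0 lV V_super S0 r0 SrP T0 HT HI.
have [A A0 AE] := area_disc_fin (0 : Cx R) r0.
set E := [set z | _ /\ _].
have oE : open E.
  rewrite (_ : E = disc a (S / 2) `&` [set z | ((T + 1)%:E < V z)%E])//.
  by apply: openI; [exact: open_cabs_lt|exact: lV].
pose B w := (bump a S w)%:E.
have B0 w : (0 <= B w)%E by rewrite lee_fin bump_ge0.
have lB : lsc_ext B by exact: lsc_bump.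
have mB : measurable_fun setT (B \o @toC R : measurableTypeR R * measurableTypeR R -> _).
  exact: lsc_measurable2.
have mV : measurable_fun setT (V \o @toC R : measurableTypeR R * measurableTypeR R -> _).
  exact: lsc_measurable2.
have mDV := measurable_disc_integral V0 lV r.
have mDB := measurable_disc_integral B0 lB r.
have oS : open (disc a S) by exact: open_cabs_lt.
have mS := measurable_indic2 oS.
have mE := measurable_indic2 oE.
have DV0 := disc_integral_ge0 V0.
have DB0 := disc_integral_ge0 B0.
pose X := (\int[@lebesgue2 R]_p (B (toC p) * disc_integral V (toC p) r))%E.
have mX : measurable_fun setT (fun p : measurableTypeR R * measurableTypeR R =>
    (B (toC p) * disc_integral V (toC p) r)%E) by exact: emeasurable_funM.
have X0 : (0 <= X)%E by apply: integral_ge0 => p _; rewrite mule_ge0.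
have [AS AS0 ASE] := area_disc_fin a S0.
(* Finiteness lets [X] cancel between [low] and [up]. *)
have Xfin : X \is a fin_num.
  rewrite ge0_fin_numE//.
  apply: (@le_lt_trans _ _ ((A * T)%:E * area (disc a S))%E); last by rewrite ASE -EFinM ltry.
  rewrite /area -(ge0_integralZT _ mS (fun p => indic_ge0 R (disc a S) (toC p))); last first.
    by rewrite mulr_ge0// ltW.
  apply: ge0_le_integralT => //.
  - by move=> p; rewrite mule_ge0.
  - exact: ge0_measurable_funZ.
  move=> p; rewrite /comp; move: (toC p) => z; rewrite indicE.
  have [/set_mem zS|/negP zS] := boolP (z \in _).
    rewrite mule1; apply: (@le_trans _ _ (1 * disc_integral V z r)%E).
      by rewrite lee_wpmul2r// lee_fin bump_le1.
    by rewrite mul1e (le_trans (HT z zS))// AE EFinM.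
  by rewrite /B (bump_out S0) ?mul0e ?mule0// => /mem_set.
have up : ((A%:E * \int[@lebesgue2 R]_p (V (toC p) * B (toC p))) <=
    X + (A * (r / S) ^+ 2 * I)%:E)%E.
  have mVB : measurable_fun setT (fun p : measurableTypeR R * measurableTypeR R =>
    (V (toC p) * B (toC p))%E) by exact: emeasurable_funM.
  have mVS : measurable_fun setT (fun p : measurableTypeR R * measurableTypeR R =>
    (V (toC p) * (\1_(disc a S) (toC p))%:E)%E) by exact: emeasurable_funM.
  have c0 : 0 <= A * (r / S) ^+ 2 by rewrite mulr_ge0 ?sqr_ge0// ltW.
  have VS0 (p : R * R) : (0 <= V (toC p) * (\1_(disc a S) (toC p))%:E)%E.
    by rewrite mule_ge0// indic_ge0.
  apply: (@le_trans _ _ (X + (A * (r / S) ^+ 2)%:E *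
      \int[@lebesgue2 R]_p (V (toC p) * (\1_(disc a S) (toC p))%:E))%E); last first.
    by apply: leeD2l; rewrite [leRHS]EFinM; apply: lee_wpmul2l; rewrite ?lee_fin.
  rewrite /X (disc_integral_self_adjoint r V0 lV B0 lB).
  rewrite -(ge0_integralZT _ mVB) ?(ltW A0)//; last by move=> p; rewrite mule_ge0.
  rewrite -(ge0_integralZT _ mVS VS0 c0).
  rewrite -ge0_integralDT.
  - apply: ge0_le_integralT.
    + exact: ge0_measurable_funZ.
    + by move=> p; rewrite mule_ge0 ?lee_fin ?(ltW A0)// mule_ge0.
    + apply: emeasurable_funD; first exact: emeasurable_funM.
      exact: ge0_measurable_funZ.
    move=> p; move: (toC p) => z.
    rewrite muleCA [X in (_ <= _ + X)%E]muleCA -ge0_muleDr ?DB0//; last first.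
      by rewrite mule_ge0// ?lee_fin// indic_ge0.
    by rewrite lee_wpmul2l// -EFinM; exact: bump_mean.
  - exact: emeasurable_funM.
  - by move=> p; rewrite mule_ge0.
  - exact: ge0_measurable_funZ.
  - by move=> p; rewrite mule_ge0 ?lee_fin.
(* Pointwise: where the bump lives the mean of V is at most V, and on E at most V - 1 while the bump
   is at least 1/2, so the integrand drops by at least A / 2 there. *)
have low : (X + (A / 2)%:E * area E <=
    A%:E * \int[@lebesgue2 R]_p (V (toC p) * B (toC p)))%E.
  have mVB : measurable_fun setT (fun p : measurableTypeR R * measurableTypeR R =>
    (V (toC p) * B (toC p))%E) by exact: emeasurable_funM.
  have a20 : 0 <= A / 2 by rewrite divr_ge0// ltW.
  rewrite /area -(ge0_integralZT _ mE (fun p => indic_ge0 R E (toC p)) a20).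
  rewrite -(ge0_integralZT _ mVB) ?(ltW A0)//; last by move=> p; rewrite mule_ge0.
  rewrite /X -ge0_integralDT//; last 3 first.
  - by move=> p; rewrite mule_ge0.
  - exact: ge0_measurable_funZ.
  - by move=> p; rewrite mule_ge0 ?lee_fin// indic_ge0.
  apply: ge0_le_integralT.
  - by apply: emeasurable_funD => //; exact: ge0_measurable_funZ.
  - move=> p; apply: adde_ge0; first exact: mule_ge0.
    by apply: mule_ge0; [rewrite lee_fin|exact: indic_ge0].
  - exact: ge0_measurable_funZ.
  move=> p; rewrite /comp; move: (toC p) => z.
  have [zS|zS] := pselect (disc a S z); last first.
    rewrite /B (bump_out S0 zS) mul0e mule0 mule0 add0e indicE memNset ?mule0//.
    move=> [zS2 _]; apply: zS; move: zS2; rewrite /disc/mkset; lra.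
  have DA : (disc_integral V z r <= A%:E * V z)%E.
    rewrite -AE; apply: (disc_integral_le V0 lV V_super).
    by move: zS; rewrite /disc/mkset; lra.
  have [[zS2 zT]|zE] := pselect (E z); last first.
    rewrite indicE memNset// mule0 adde0 muleA muleC.
    by rewrite lee_wpmul2r.
  rewrite indicE mem_set// mule1.
  have bz : 1 / 2 <= bump a S z by exact: bump_half.
  have := HT z zS; rewrite AE -EFinM.
  move: zT (DV0 z r); rewrite /B; case: (disc_integral V z r) => [d||] //.
  case: (V z) => [v||] //; rewrite !lee_fin ?lte_fin.
    move=> vT d0 dT.
    have : bump a S z * d + bump a S z * A <= A * (v * bump a S z).
      have -> : A * (v * bump a S z) = bump a S z * (A * v) by ring.
      rewrite -mulrDr ler_wpM2l ?bump_ge0//.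
      have : A * (T + 1) <= A * v by rewrite ler_pM2l// ltW.
      lra.
    have : A * (1 / 2) <= A * bump a S z by rewrite ler_pM2l.
    lra.
  move=> _ _ _; rewrite gt0_mulye ?lte_fin; last by lra.
  by rewrite gt0_muley ?lte_fin// leey.
have := le_trans low up; rewrite leeD2lE//.
have : (0 <= area E)%E by apply: integral_ge0 => p _; exact: indic_ge0.
case: (area E) => [e||] // e0.
  by rewrite -EFinM !lee_fin => h; move: A0 h; nra.
by rewrite gt0_muley ?lte_fin ?divr_gt0.
Qed.

(** * Sublevel sets near a point of small Lelong number *)

Section local_sublevel.
Variables (R : realType) (u : Cx R -> \bar R) (a : Cx R) (P : R).
Hypotheses (su : submean u) (P0 : 0 < P)
  (u_le0 : forall w, cabs (w - a) < P -> (u w <= 0)%E).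

(** Truncated at 0 so as to be nonnegative on the whole plane; on |z - a| < P, where u <= 0, it is
    -u. *)
Definition neg_part (z : Cx R) : \bar R := maxe (- u z)%E 0%E.
Local Notation V := neg_part.

Lemma neg_part_ge0 z : (0 <= V z)%E.
Proof. by rewrite le_max lexx orbT. Qed.

Lemma neg_part_lsc : lsc_ext V.
Proof.
have [_ usc _] := su; move=> c; have [c0|c0] := ltP c 0.
  rewrite (_ : [set _ | _] = setT); first exact: openT.
  apply/seteqP; split => // x _; rewrite /mkset.
  by apply: lt_le_trans (neg_part_ge0 x); rewrite lte_fin.
rewrite (_ : [set _ | _] = [set z | (u z < (- c)%:E)%E]); first exact: usc.
apply/seteqP; split => z; rewrite /mkset /V lt_max lte_fin (ltNge c 0) c0 orbF;
by rewrite lteNr EFinN.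
Qed.

Lemma neg_partE z : cabs (z - a) < P -> u z = (- V z)%E.
Proof.
move=> /u_le0 uz; rewrite /V; have -> : maxe (- u z)%E 0%E = (- u z)%E.
  by apply/max_idPl; rewrite oppe_ge0.
by rewrite oppeK.
Qed.

Lemma neg_part_super z b : cabs (z - a) + cabs b < P ->
  (\int[@lebesgue_measure R]_(t in `[0%R, (2 * pi)%R]) V (z + b * cis t)%R
     <= (2 * pi)%:E * V z)%E.
Proof.
move=> zb; have [_ _ sm] := su; have := sm z b.
have pi20 : 0 < 2 * pi :> R by rewrite mulr_gt0// pi_gt0.
have E t : u (z + b * cis t) = (- V (z + b * cis t)%R)%E.
  apply: neg_partE; apply: le_lt_trans zb.
  rewrite addrAC; apply: le_trans (cabsD _ _) _.
  by rewrite cabsM cabs_cis mulr1.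
under eq_integral do rewrite E.
rewrite integral_ge0N; last by move=> t _; exact: neg_part_ge0.
rewrite neg_partE; last by apply: le_lt_trans zb; rewrite lerDl cabs_ge0.
rewrite muleN leeN2 -(@lee_pmul2l _ (2 * pi)%:E) ?lte_fin//.
by rewrite muleA -EFinM mulfV ?mul1e// gt_eqF.
Qed.

(* If u were smaller on a whole circle of radius r, comparison with a logarithm
   on the annulus r <= |w - z| <= P / 2 would contradict the growth of u at a. *)
Lemma lelong_gap (nu' al : R) : 0 < nu' -> nu' < al ->
  (exists2 r0 : R, 0 < r0 & forall r, 0 < r -> r < r0 ->
    exists2 w, cabs (w - a) = r & ((nu' * ln r)%:E <= u w)%E) ->
  exists S : R, [/\ 0 < S, 4 * S <= P &
    forall z r, cabs (z - a) <= S / 2 -> 0 < r -> r <= S / 2 ->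
      exists2 w, cabs (w - z) = r & ((al * (ln r - ln (P / 2)))%:E <= u w)%E].
Proof.
move=> nu0 nual [r0 r00 Hr0].
have P20 : 0 < P / 2 by rewrite divr_gt0.
(* S < q means al (ln 2 + ln S - ln (P / 2)) < nu' ln S: at distance 2 S the comparison function
   then lies below the value of u at [w0]. *)
pose q := expR (al * (ln (P / 2) - ln 2) / (al - nu')).
have q0 : 0 < q by exact: expR_gt0.
pose S := Num.min (r0 / 2) (Num.min (P / 4) (q / 2)).
have S0 : 0 < S by rewrite !lt_min !divr_gt0.
have Sr0 : S < r0.
  apply: (@le_lt_trans _ _ (r0 / 2)); first by rewrite ge_min lexx.
  by lra.
have SP : 4 * S <= P.
  have : S <= P / 4 by rewrite !ge_min lexx orbT.
  lra.
have Sq : S < q.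
  apply: (@le_lt_trans _ _ (q / 2)); first by rewrite !ge_min lexx !orbT.
  by lra.
have lnS : al * (ln 2 + ln S - ln (P / 2)) < nu' * ln S.
  have : ln S < ln q by rewrite ltr_ln ?posrE.
  by rewrite expRK ltr_pdivlMr ?subr_gt0//; lra.
have al0 : 0 < al by exact: lt_trans nual.
exists S; split => // z r zS r_0 rS.
apply: contrapT => nw.
have Hc w : cabs (w - z) = r -> (u w <= (- (al * ln (P / 2)) + al * ln r)%:E)%E.
  move=> wr; rewrite leNgt; apply/negP => H; apply: nw; exists w => //.
  by apply: le_trans (ltW H); rewrite lee_fin; lra.
have Hc2 w : cabs (w - z) = P / 2 ->
    (u w <= (- (al * ln (P / 2)) + al * ln (P / 2))%:E)%E.
  move=> wP; rewrite addNr; apply: u_le0.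
  by have := cabs_triangle w z a; rewrite wP; lra.
have [w0 w0S Hw0] := Hr0 S S0 Sr0.
have d1 : S / 2 <= cabs (w0 - z).
  have := cabs_triangle w0 z a; rewrite w0S; lra.
have d2 : cabs (w0 - z) <= 2 * S.
  have := cabs_triangle w0 a z; rewrite w0S (cabs_distC a z); lra.
have := submean_annulus su (ltW al0) (or_introl (conj r_0 Hc)) Hc2 (w := w0).
have -> : r <= cabs (w0 - z) <= P / 2 by apply/andP; split; lra.
move=> /(_ isT) /(le_trans Hw0); rewrite lee_fin.
have : ln (cabs (w0 - z)) <= ln 2 + ln S.
  rewrite -lnM ?posrE// ler_ln ?posrE//; last by rewrite mulr_gt0.
  by apply: lt_le_trans d1; rewrite divr_gt0.
move=> l1; have : al * ln (cabs (w0 - z)) <= al * (ln 2 + ln S) by rewrite ler_pM2l.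
lra.
Qed.

(* The disc around z is enlarged by the factor 1 + eta so as to recentre it at
   a nearby point w where V is controlled. *)
Lemma gap_disc_integral (S al eta : R) (z : Cx R) (r : R) :
  0 < S -> 4 * S <= P -> 0 <= al -> 0 < eta <= 1 ->
  (forall z r, cabs (z - a) <= S / 2 -> 0 < r -> r <= S / 2 ->
    exists2 w, cabs (w - z) = r & ((al * (ln r - ln (P / 2)))%:E <= u w)%E) ->
  cabs (z - a) <= S / 2 -> 0 < r -> r <= S / 2 ->
  (disc_integral V z r <= area (disc (0 : Cx R)%R r) *
     ((1 + eta) ^+ 2 * al * (ln (P / 2) - ln (eta * r)))%R%:E)%E.
Proof.
move=> S0 SP al0 /andP[eta0 eta1] gap zS r0 rS.
have er0 : 0 < eta * r by rewrite mulr_gt0.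
have err : eta * r <= r by rewrite ler_piMl// ltW.
have erS : eta * r <= S / 2 by exact: le_trans rS.
have [w wz uw] := gap z (eta * r) zS er0 erS.
have lP : 0 <= ln (P / 2) - ln (eta * r).
  by rewrite subr_ge0 ler_ln ?posrE// ?divr_gt0//; lra.
have Vw : (V w <= (al * (ln (P / 2) - ln (eta * r)))%:E)%E.
  rewrite ge_max lee_fin mulr_ge0// andbT leeNl; apply: le_trans uw.
  by rewrite -EFinN lee_fin; lra.
have s0 : 0 < (1 + eta) * r by rewrite mulr_gt0//; lra.
apply: (@le_trans _ _ (disc_integral V w ((1 + eta) * r))).
  by apply: (disc_integral_mono neg_part_ge0 neg_part_lsc); rewrite cabs_distC wz; lra.
apply: (@le_trans _ _ (area (disc (0 : Cx R)%R ((1 + eta) * r)) * V w)%E).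
  apply: (disc_integral_le neg_part_ge0 neg_part_lsc neg_part_super).
  by have := cabs_triangle w z a; rewrite wz; lra.
have [A A0 AE] := area_disc_fin (0 : Cx R) (@ltr01 R).
rewrite (area_disc _ s0) (area_disc _ r0) AE -!EFinM.
apply: (@le_trans _ _ ((((1 + eta) * r) ^+ 2 * A)%:E * (al * (ln (P / 2) - ln (eta * r)))%:E)%E).
  by apply: lee_wpmul2l => //; rewrite lee_fin mulr_ge0// ?sqr_ge0// ltW.
by rewrite -EFinM lee_fin; rewrite le_eqVlt; apply/orP; left; apply/eqP; ring.
Qed.

(** For r = S1 / 2^k, each halving raises the bound on the disc means by gam ln 2 and divides (r /
    S1)^2 by 4; hence the thresholds and the bound C / 4^k. *)
Lemma lelong_sublevel : (exists z1, (-oo < u z1)%E) ->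
  (lelong u a < (1 / 2)%:E)%E ->
  exists (del gam T0 C : R), [/\ 0 < del, 0 < gam, gam < 1 / 2 & 0 <= C] /\
    forall k : nat, (area [set z | disc a del z /\
       ((T0 + gam * ln 2 * k%:R)%:E < V z)%E] <= (C / 4 ^+ k)%:E)%E.
Proof.
move=> [z1 uz1] lel.
have [nu [nuE _ Hnu]] := lelong_spec a su uz1.
move: lel; rewrite nuE lte_fin => nu2.
(* The maximum with 0 makes [nu'] positive whatever the sign of nu. *)
pose nu' := (Num.max nu 0 + 1 / 2) / 2.
have mx : Num.max nu 0 < 1 / 2 by rewrite gt_max nu2/=; lra.
have mx0 : 0 <= Num.max nu 0 by rewrite le_max lexx orbT.
have nunu' : nu < nu'.
  by have : nu <= Num.max nu 0 by [rewrite le_max lexx]; rewrite /nu'; lra.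
have nu'0 : 0 < nu' by rewrite /nu'; lra.
have nu'2 : nu' < 1 / 2 by rewrite /nu'; lra.
move: (Hnu _ nunu') nu'0 nu'2 => {}Hnu; clearbody nu'; move: nu' Hnu {nunu'} => nu' Hnu nu'0 nu'2.
pose al := (nu' + 1 / 2) / 2.
have nual : nu' < al by rewrite /al; lra.
have al2 : al < 1 / 2 by rewrite /al; lra.
clearbody al.
have al0 : 0 < al by lra.
have [S [S0 SP gap]] := lelong_gap nu'0 nual Hnu.
(* Small enough for (1 + eta)^2 al < 1/2. *)
pose eta := (1 / 2 - al) / 2.
have eta0 : 0 < eta by rewrite /eta; lra.
have eta1 : eta <= 1 by rewrite /eta; lra.
have etaI : 0 < eta <= 1 by rewrite eta0 eta1.
pose gam := (1 + eta) ^+ 2 * al.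
have gam2 : gam < 1 / 2 by rewrite /gam /eta; nra.
have gam0 : 0 <= gam by rewrite mulr_ge0 ?sqr_ge0// ltW.
clearbody eta.
have bound := gap_disc_integral S0 SP (ltW al0) etaI gap.
pose S1 := S / 2; have S10 : 0 < S1 by rewrite divr_gt0.
pose T r := gam * (ln (P / 2) - ln (eta * r)).
have T_ge0 r : 0 < r -> r <= S1 -> 0 <= T r.
  move=> r0 rS; rewrite mulr_ge0// subr_ge0 ler_ln ?posrE ?mulr_gt0 ?divr_gt0//.
  have : eta * r <= r by rewrite ler_piMl// ltW.
  by move: rS; rewrite /S1; lra.
have [I I0 HI] : exists2 I : R, 0 <= I &
    (\int[@lebesgue2 R]_p (V (toC p) * (\1_(disc a S1) (toC p))%:E) <= I%:E)%E.
  have aa : cabs (a - a) <= S / 2 by rewrite subrr cabs0 ltW.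
  have [A A0 AE] := area_disc_fin (0 : Cx R) S10.
  exists (A * T S1); first by exact: mulr_ge0 (ltW A0) (T_ge0 _ S10 (lexx _)).
  have := bound a S1 aa S10 (lexx _); rewrite AE -EFinM => /(le_trans _); apply.
  have mS : measurable_fun setT ((fun w => V w * (\1_(disc a S1) w)%:E)%E \o @toC R :
      measurableTypeR R * measurableTypeR R -> _).
    apply: emeasurable_funM; first exact: (lsc_measurable2 neg_part_lsc).
    by apply: measurable_indic2; exact: open_cabs_lt.
  rewrite -(integral_translate a mS); last first.
    by move=> w; rewrite mule_ge0 ?neg_part_ge0 ?indic_ge0.
  rewrite /disc_integral le_eqVlt; apply/orP; left; apply/eqP; apply: eq_integral => p _.
  move: (toC p) => w; rewrite muleC addrC; congr (_ * _)%E; rewrite !indicE.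
  by congr (nat_of_bool _)%:R%:E; apply/idP/idP => /set_mem H; apply/mem_set; move: H;
    rewrite /disc/mkset subr0 addrAC subrr add0r.
have p2 k : (0 < 2 ^+ k :> R) by rewrite exprn_gt0.
exists (S1 / 2), gam, (T S1 + 1), (2 * I); split.
  by split; rewrite ?divr_gt0// ?mulr_ge0// mulr_gt0// exprn_gt0//; lra.
move=> k; pose r := S1 / 2 ^+ k.
have r0 : 0 < r by rewrite divr_gt0.
have rS : r <= S1.
  by rewrite ler_pdivrMr// ler_peMr ?(ltW S10)// exprn_ege1// ler1n.
have TE : T r = T S1 + gam * ln 2 * k%:R.
  rewrite /T /r [in LHS]mulrA (@ln_div _ (eta * S1)) ?posrE ?mulr_gt0//.
  by rewrite lnXn// -[ln 2 *+ k]mulr_natr; ring.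
have SrP : S1 + r <= P by move: rS; rewrite /S1; lra.
have HT z : disc a S1 z -> (disc_integral V z r <= area (disc (0%R : Cx R) r) * (T r)%:E)%E.
  by move=> /ltW zS; apply: bound.
have := superharmonic_sublevel neg_part_ge0 neg_part_lsc neg_part_super S10 r0 SrP
  (T_ge0 r r0 rS) HT HI.
rewrite TE addrAC => /le_trans; apply; rewrite lee_fin.
have -> : r / S1 = (2 ^+ k)^-1 by rewrite /r mulrAC mulfV ?mul1r// gt_eqF.
rewrite -exprVn -exprM mulnC exprM exprVn.
have -> : (2 : R) ^+ 2 = 4 by ring.
by rewrite exprVn; rewrite le_eqVlt; apply/orP; left; apply/eqP; ring.
Qed.

End local_sublevel.

(** * Small Lelong numbers force finite volume *)

Lemma le_area_scale (R : realType) (A B : set (Cx R)) (c : Cx R) :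
  open A -> open B -> c != 0 -> (forall l, A (c * l) -> B l) ->
  (area A <= (cabs c ^+ 2)%:E * area B)%E.
Proof.
move=> oA oB c0 AB; have ac : 0 < cabs c by rewrite cabs_gt0.
have mA := measurable_indic2 oA.
have := integral_scale c0 mA (fun w => indic_ge0 R A w) => E.
have -> : area A = ((cabs c ^+ 2)%:E * \int[@lebesgue2 R]_p (\1_A (c * toC p)%R)%:E)%E.
  by rewrite E muleA -EFinM mulfV ?mul1e// gt_eqF// exprn_gt0.
apply: lee_wpmul2l; first by rewrite lee_fin sqr_ge0.
have oA' : open [set l | A (c * l)].
  move: oA; apply: open_comp => z _ U /nbhs_CxP[e e0 HU]; apply/nbhs_CxP.
  exists (e / cabs c); first by rewrite divr_gt0.
  by move=> y yz; apply: HU; rewrite -mulrBr cabsM mulrC -ltr_pdivlMr.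
apply: le_trans (le_area oA' oB AB).
by rewrite le_eqVlt; apply/orP; left; apply/eqP; apply: eq_integral => p _; rewrite !indicE.
Qed.

Lemma geometric_nneseries_fin (R : realType) (b x : R) : 0 <= b -> 0 <= x -> x < 1 ->
  (\sum_(0 <= k <oo) (b * x ^+ k)%:E < +oo)%E.
Proof.
move=> b0 x0 x1; have bx k : 0 <= b * x ^+ k by rewrite mulr_ge0// exprn_ge0.
apply: (@le_lt_trans _ _ (b / (1 - x))%:E); last exact: ltry.
apply: lime_le; first by apply: is_cvg_nneseries => k _ _; rewrite lee_fin.
apply: nearW => n; rewrite sumEFin lee_fin.
have := geometric_seriesE b (negbT (lt_eqF x1)) => /(congr1 (@^~ n)) /=.
rewrite /series /geometric/= => ->.
rewrite ler_pM2r ?invr_gt0 ?subr_gt0// ler_piMr// gerBl exprn_ge0//.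
Qed.

(** G is dominated by the sum over k of c x^k on the disc of radius r0 s^k; these discs have areas
    of order s^(2 k), so the series is geometric of ratio s^2 x. *)
Lemma discs_integral_fin (R : realType) (G : Cx R -> \bar R) (r0 x c s : R) :
  measurable_fun setT (G \o @toC R : measurableTypeR R * measurableTypeR R -> _) ->
  (forall w, (0 <= G w)%E) -> 0 < r0 -> 0 <= c -> 0 < s -> 0 <= x -> s ^+ 2 * x < 1 ->
  (forall w, exists k : nat, cabs w < r0 * s ^+ k /\ (G w <= (c * x ^+ k)%:E)%E) ->
  (\int[@lebesgue2 R]_q G (toC q) < +oo)%E.
Proof.
move=> mG G0 r00 c0 s0 x0 sx H.
have rs k : 0 < r0 * s ^+ k by rewrite mulr_gt0// exprn_gt0.
have cx k : 0 <= c * x ^+ k by rewrite mulr_ge0// exprn_ge0.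
pose F k (w : Cx R) := ((c * x ^+ k)%:E * (\1_(disc 0 (r0 * s ^+ k)) w)%:E)%E.
have F0 k w : (0 <= F k w)%E by apply: mule_ge0; [rewrite lee_fin|exact: indic_ge0].
have mI k : measurable_fun setT ((fun w => (\1_(disc (0 : Cx R) (r0 * s ^+ k)) w)%:E) \o @toC R :
    measurableTypeR R * measurableTypeR R -> \bar R).
  by apply: measurable_indic2; exact: open_cabs_lt.
have mF k : measurable_fun setT (F k \o @toC R :
    measurableTypeR R * measurableTypeR R -> _).
  exact: ge0_measurable_funZ (mI k).
have [A A0 AE] := area_disc_fin (0 : Cx R) (@ltr01 R).
have EF k : (\int[@lebesgue2 R]_q (F k \o @toC R) q =
    (c * r0 ^+ 2 * A * (s ^+ 2 * x) ^+ k)%:E)%E.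
  rewrite /F /comp.
  rewrite (ge0_integralZT _ (mI k) (fun p => indic_ge0 R _ (toC p)) (cx k)).
  rewrite -/(area _) (area_disc _ (rs k)) AE -!EFinM; congr EFin.
  rewrite !exprMn; move: (s ^+ k) (x ^+ k) => y1 y2; ring.
apply: (@le_lt_trans _ _
   (\int[@lebesgue2 R]_q \sum_(0 <= k <oo) (F k \o @toC R) q)%E); last first.
  rewrite integral_nneseries//; last by move=> k q _; exact: F0.
  rewrite (eq_eseriesr (fun k _ => EF k)).
  apply: geometric_nneseries_fin => //; last by rewrite mulr_ge0// sqr_ge0.
  by rewrite !mulr_ge0 ?sqr_ge0// ltW.
apply: ge0_le_integralT.
- exact: mG.
- by move=> q; exact: G0.
- apply: (ge0_emeasurable_sum (P := xpredT)) => [k q _ _|k _]; [exact: F0|exact: mF].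
move=> q; rewrite /comp; move: (toC q) => w.
have [k [wk Gk]] := H w.
have Fk : F k w = (c * x ^+ k)%:E.
  by rewrite /F indicE mem_set ?mule1// /disc/mkset subr0.
rewrite -Fk in Gk; apply: le_trans Gk _.
apply: le_trans (nneseries_lim_ge k.+1 (fun j _ _ => F0 j w)).
by rewrite big_nat_recr//= leeDr// sume_ge0.
Qed.

(** * Volume over a cone of directions *)

(** The neighbourhood |z1 / z2 - z0| < d of [z0 : 1] with the denominator cleared; it contains no
    point with z2 = 0. *)
Definition cone (R : realType) (z0 : Cx R) (d : R) : set (Cx2 R) :=
  [set z | cabs (z.1 - z0 * z.2) < d * cabs z.2].

Lemma open_cone (R : realType) (z0 : Cx R) (d : R) : 0 <= d -> open (cone z0 d).
Proof.
move=> d0; rewrite openE => z; rewrite /cone/mkset => Hz.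
pose e := d * cabs z.2 - cabs (z.1 - z0 * z.2).
have e0 : 0 < e by rewrite subr_gt0.
pose K := 1 + cabs z0 + d.
have K0 : 0 < K by have := cabs_ge0 z0; rewrite /K; lra.
apply/nbhs_Cx2P; exists (e / K); first by rewrite divr_gt0.
move=> y; rewrite !ltr_pdivlMr// => y1 y2.
have E : y.1 - z0 * y.2 = (y.1 - z.1) - z0 * (y.2 - z.2) + (z.1 - z0 * z.2) by ring.
have l1 := cabsD ((y.1 - z.1) - z0 * (y.2 - z.2)) (z.1 - z0 * z.2).
have l2 := cabsD (y.1 - z.1) (- (z0 * (y.2 - z.2))).
have := cabs_triangle z.2 y.2 0; rewrite !subr0 (cabs_distC z.2) => l3.
have dl3 : d * cabs z.2 <= d * (cabs (y.2 - z.2) + cabs y.2) by rewrite ler_wpM2l.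
move: l2; rewrite cabsN cabsM => l2.
rewrite E; move: y1 y2; rewrite /K; move: l1 l2 dl3; rewrite /e.
have a1 := cabs_ge0 (y.1 - z.1); have a2 := cabs_ge0 (y.2 - z.2).
have a3 := cabs_ge0 z0.
set p := cabs (y.1 - z.1) in a1 *; set q := cabs (y.2 - z.2) in a2 *.
set zz := cabs z0 in a3 *.
move=> l1 l2 dl3 y1 y2.
have : p + (zz + d) * q < d * cabs z.2 - cabs (z.1 - z0 * z.2).
  have zd : 0 <= zz + d by rewrite addr_ge0.
  have [pq|qp] := leP p q; first by lra.
  have : (zz + d) * q <= (zz + d) * p by rewrite ler_wpM2l// ltW.
  lra.
lra.
Qed.

(** The section at height g lam is g times a part of the line at height lam where h < 1 / |g|, that
    is V > ln |g|. With s = 2^gam and |g| of size q0 s^k its area is O(s^(2 k) / 4^k), and such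
    heights fill a disc of area O(s^(2 k)); this gives the ratio s^4 / 4. *)
Lemma cone_volume (R : realType) (h : Cx2 R -> R) (z0 : Cx R) (lam P : R) :
  balanced_gauge h -> balanced_pseudoconvex h -> (exists z, h z != 0) ->
  0 < lam -> 0 < P ->
  (forall w, cabs (w - lam%:C * z0) < P -> h (w, lam%:C) <= 1) ->
  (lelong (fun l => log_gauge h (l, lam%:C%C)) (lam%:C%C * z0)%R < (1 / 2)%:E)%E ->
  exists2 d, 0 < d & (volume (balanced_domain h `&` cone z0 d) < +oo)%E.
Proof.
move=> hg psh hn lam0 P0 hP lel; have [h0 _ hom] := hg.
have lC0 : lam%:C != 0 :> Cx R by rewrite -cabs_gt0 cabs_real gtr0_norm.
pose u l := log_gauge h (l, lam%:C).
have u_le0 w : cabs (w - lam%:C * z0) < P -> (u w <= 0)%E.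
  by move=> /hP h1; rewrite /u /log_gauge lne_le0 lee_fin.
have [del [gam [T0 [C [[del0 gam0 gam2 C0] HE]]]]] :=
  lelong_sublevel (line_submean (lam%:C) psh) P0 u_le0
    (gauge_line_neq0 hg psh hn lC0) lel.
(* The cone of aperture del / lam meets the line at height lam in the disc of radius del. *)
have dl0 : 0 < del / lam by rewrite divr_gt0.
exists (del / lam) => //.
set A := _ `&` _.
have oA : open A by apply: openI; [exact: open_balanced_domain|exact: open_cone (ltW dl0)].
rewrite volume_tonelli//.
have [Ad Ad0 AdE] := area_disc_fin (lam%:C * z0) del0.
pose s := expR (gam * ln 2).
have s0 : 0 < s by exact: expR_gt0.
have s1 : 1 < s by rewrite expR_gt1 mulr_gt0// ln_gt0// ltr1n.
(* This is gam < 1/2, as s^4 = 2^(4 gam). *)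
have s4 : s ^+ 4 < 4.
  rewrite -expRM_natl -[X in _ < X](@lnK R 4) ?posrE//.
  rewrite ltr_expR.
  have -> : (4 : R) = 2 ^+ 2 by rewrite -natrX.
  rewrite lnXn// -(natrX _ 2 2) -[ln 2 *+ 2]mulr_natl.
  have : 0 < ln (2 : R) by rewrite ln_gt0// ltr1n.
  by nra.
pose q0 := expR T0; have q00 : 0 < q0 by exact: expR_gt0.
have TE k : T0 + gam * ln 2 * k%:R = ln (q0 * s ^+ k).
  by rewrite lnM ?posrE ?exprn_gt0// lnXn// !expRK mulr_natr.
(* [Ad] serves k = 0; the factor 4 makes up for using the sublevel estimate at k - 1. *)
pose c := q0 ^+ 2 * (Ad + 4 * C).
have c0 : 0 <= c by rewrite mulr_ge0 ?sqr_ge0// addr_ge0 ?mulr_ge0// ltW.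
have [lq0 x0] : 0 < lam * q0 /\ 0 <= s ^+ 2 / 4.
  by rewrite mulr_gt0// divr_ge0 ?sqr_ge0.
have sx : s ^+ 2 * (s ^+ 2 / 4) < 1.
  by rewrite mulrA -exprD ltr_pdivrMr// mul1r.
have area_ge0 B : (0 <= @area R B)%E by apply: integral_ge0 => p _; exact: indic_ge0.
apply: (discs_integral_fin (G := fun w => area [set z1 | A (z1, w)])
  (measurable_area_section oA) _ lq0 c0 s0 x0 sx) => // w.
have oAw := open_section (c := w) oA.
have [->|w0] := eqVneq w 0.
  exists 0%N; rewrite cabs0 expr0 mulr1; split => //.
  rewrite (_ : [set _ | _] = set0).
    rewrite /area integral0_eq ?lee_fin ?mulr1// => p _.
    by rewrite indicE memNset// => -[].
  apply/seteqP; split => // z [_ hz].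
  have : cabs (z - z0 * 0) < del / lam * cabs (0 : Cx R) := hz.
  by move=> /(le_lt_trans (cabs_ge0 _)); rewrite cabs0 mulr0 ltxx.
pose g := w / lam%:C; have g0 : g != 0 by rewrite mulf_neq0// invr_eq0.
have wg : w = g * lam%:C by rewrite /g mulfVK.
have cwg : cabs w = lam * cabs g by rewrite wg cabsM cabs_real (gtr0_norm lam0) mulrC.
have cg : 0 < cabs g by rewrite cabs_gt0.
have Ag l : A (g * l, w) -> disc (lam%:C * z0) del l /\ cabs g * h (l, lam%:C) < 1.
  move=> [hl cl]; split; last first.
    rewrite -hom; move: hl; rewrite /balanced_domain/mkset wg.
    by rewrite (_ : g *: _ = (g * l, g * lam%:C)).
  have {}cl : cabs (g * l - z0 * w) < del / lam * cabs w := cl.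
  move: cl; rewrite cwg mulrA mulfVK ?gt_eqF// => cl.
  rewrite /disc/mkset -(ltr_pM2l cg) -cabsM (mulrC _ del).
  by rewrite (_ : g * _ = g * l - z0 * w)// wg; ring.
(* The least such k also gives q0 s^(k - 1) <= |g|, the lower bound needed for the sublevel set of
   index k - 1. *)
have [k kP kmin] : exists2 k : nat, cabs g < q0 * s ^+ k &
    forall j, (j < k)%N -> q0 * s ^+ j <= cabs g.
  have ex : exists k, cabs g < q0 * s ^+ k.
    have gl0 : 0 < gam * ln 2 by rewrite mulr_gt0// ln_gt0// ltr1n.
    pose y := (ln (cabs g) - T0) / (gam * ln 2).
    exists (Num.bound `|y|); rewrite -ltr_ln ?posrE ?mulr_gt0 ?exprn_gt0// -TE.
    rewrite -ltrBlDl -ltr_pdivrMl// mulrC; apply: le_lt_trans (ler_norm y) _.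
    exact: archi_boundP.
  exists (ex_minn ex); case: ex_minnP => m Hm mmin //.
  by move=> j jm; rewrite leNgt; apply/negP => /mmin; rewrite leqNgt jm.
exists k; split; first by rewrite cwg -mulrA ltr_pM2l.
have gk : cabs g ^+ 2 <= q0 ^+ 2 * (s ^+ 2) ^+ k.
  rewrite exprAC -exprMn lerXn2r ?nnegrE ?cabs_ge0 ?ltW// mulr_gt0// exprn_gt0//.
(* For k = 0 there is no lower bound on |g|, and the whole disc of radius del bounds the section. *)
case: k kP kmin gk => [|k] kP kmin gk.
  have oB : open (disc (lam%:C * z0) del) by exact: open_cabs_lt.
  apply: le_trans (le_area_scale oAw oB g0 (fun l H => (Ag l H).1)) _.
  rewrite AdE -EFinM lee_fin expr0 mulr1.
  move: gk; rewrite expr0 mulr1 => gk.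
  apply: (@le_trans _ _ (q0 ^+ 2 * Ad)); first by rewrite ler_wpM2r// ltW.
  by rewrite ler_wpM2l ?sqr_ge0// lerDl mulr_ge0.
pose B := [set z | disc (lam%:C * z0) del z /\
   ((T0 + gam * ln 2 * k%:R)%:E < neg_part u z)%E].
have oB : open B.
  apply: openI; first exact: open_cabs_lt.
  exact: (neg_part_lsc (line_submean (lam%:C) psh)).
have AB l : A (g * l, w) -> B l.
  move=> /Ag[dl hl]; split => //; rewrite TE /neg_part lt_max; apply/orP; left.
  rewrite lteNr /u /log_gauge.
  have [hl0|hl0] := leP (h (l, lam%:C)) 0.
    by rewrite le0_lneNy ?lee_fin// -EFinN ltNyr.
  rewrite lne_EFin// -EFinN lte_fin -lnV ?posrE ?mulr_gt0 ?exprn_gt0//.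
  rewrite ltr_ln ?posrE ?invr_gt0 ?mulr_gt0 ?exprn_gt0//.
  have qk := kmin k (ltnSn k).
  rewrite -[ltRHS]mul1r ltr_pdivlMr ?mulr_gt0 ?exprn_gt0//.
  by apply: le_lt_trans hl; rewrite mulrC ler_pM2r.
apply: le_trans (le_area_scale oAw oB g0 AB) _.
apply: (@le_trans _ _ ((cabs g ^+ 2)%:E * (C / 4 ^+ k)%:E)%E).
  by apply: lee_wpmul2l (HE k); rewrite lee_fin sqr_ge0.
rewrite -EFinM lee_fin.
have Ck : 0 <= C / 4 ^+ k by rewrite divr_ge0// exprn_ge0.
apply: (@le_trans _ _ (q0 ^+ 2 * s ^+ 2 ^+ k.+1 * (C / 4 ^+ k))).
  by rewrite ler_wpM2r.
rewrite expr_div_n /c [4 ^+ k.+1]exprS.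
have -> : q0 ^+ 2 * (Ad + 4 * C) * ((s ^+ 2) ^+ k.+1 / (4 * 4 ^+ k)) =
   q0 ^+ 2 * (s ^+ 2) ^+ k.+1 * (C / 4 ^+ k) +
   q0 ^+ 2 * (s ^+ 2) ^+ k.+1 * (Ad / (4 * 4 ^+ k)).
  move: ((s ^+ 2) ^+ k.+1) => y; field.
  by rewrite expf_neq0.
by rewrite lerDl !mulr_ge0 ?invr_ge0 ?mulr_ge0 ?exprn_ge0 ?sqr_ge0// ltW.
Qed.

Lemma gauge0 (R : realType) (h : Cx2 R -> R) : balanced_gauge h -> h 0 = 0.
Proof.
move=> [_ _ /(_ (0 : Cx R) 0)].
by rewrite scale0r (_ : cabs _ = 0) ?mul0r//; exact: cabs0.
Qed.

Lemma le_volume (R : realType) (A B : set (Cx2 R)) : open A -> open B ->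
  A `<=` B -> (volume A <= volume B)%E.
Proof.
move=> oA oB AB; apply: le_measure; rewrite ?inE; first exact: toC2_open_measurable.
  exact: toC2_open_measurable.
by move=> p; exact: AB.
Qed.

Lemma volumeU_fin (R : realType) (A B : set (Cx2 R)) : open A -> open B ->
  (volume A < +oo)%E -> (volume B < +oo)%E -> (volume (A `|` B) < +oo)%E.
Proof.
move=> oA oB vA vB; apply: le_lt_trans (lte_add_pinfty vA vB).
by apply: measureU2; exact: toC2_open_measurable.
Qed.

Lemma volume_bidisc_fin (R : realType) : exists W : set (Cx2 R),
  [/\ open W, W 0 & (volume W < +oo)%E].
Proof.
pose W : set (Cx2 R) := [set z | disc 0 1 z.1 /\ disc 0 1 z.2].
have oD : open (disc (0 : Cx R) 1) by exact: open_cabs_lt.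
have oW : open W.
  apply: openI.
    by apply: (open_comp (f := fst)) oD => z _; exact: cvg_fst.
  by apply: (open_comp (f := snd)) oD => z _; exact: cvg_snd.
exists W; split => //; first by split; rewrite /disc/mkset subrr
    -[X in cabs X]/(0 : Cx R) cabs0.
have [A A0 AE] := area_disc_fin (0 : Cx R) (@ltr01 R).
rewrite volume_tonelli//.
rewrite (_ : (\int[@lebesgue2 R]_q _)%E = (A * A)%:E) ?ltry//.
rewrite EFinM -{2}AE /area.
rewrite -(ge0_integralZT _ (measurable_indic2 oD) (fun p => indic_ge0 R _ (toC p)) (ltW A0)).
apply: eq_integral => q _; rewrite /comp; move: (toC q) => w; rewrite indicE.
have [/set_mem wD|wD] := boolP (w \in _).
  rewrite mule1 -AE; congr area; apply/seteqP; split => z; first by case.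
  by move=> zD; split.
rewrite mule0; apply: integral0_eq => p _; rewrite indicE memNset// => -[_ wD'].
by move/negP: wD; apply; apply/mem_set.
Qed.

(** * Covering the domain by cones *)

Section finite_volume.
Variables (R : realType) (h : Cx2 R -> R).
Hypotheses (hg : balanced_gauge h) (psh : balanced_pseudoconvex h)
  (hn : exists z, h z != 0).

(** The hypothesis ranges over all representatives of the direction because the height [lam] is
    found only inside the proof. *)
Lemma lelong_cone_volume (z0 : Cx R) :
  (forall v2 : Cx R, v2 != 0 ->
    (lelong (fun l => log_gauge h (l, v2)) (v2 * z0)%R < (1 / 2)%:E)%E) ->
  exists2 d, 0 < d & (volume (balanced_domain h `&` cone z0 d) < +oo)%E.
Proof.
move=> Hl; have D0 : balanced_domain h 0.
  by rewrite /balanced_domain/mkset gauge0// ltr01.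
have /nbhs_Cx2P[d d0 Hd] := open_nbhs_nbhs (conj (open_balanced_domain hg) D0).
have z01 : 0 < 1 + cabs z0 by have := cabs_ge0 z0; lra.
(* The disc of radius d / 2 around lam z0 at height lam then lies in a bidisc of radius d inside the
   domain, so h < 1 on it. *)
pose lam := d / 2 / (1 + cabs z0).
have lam0 : 0 < lam by rewrite !divr_gt0.
have lamE : lam * (1 + cabs z0) = d / 2 by rewrite /lam mulfVK// gt_eqF.
have lz0 : 0 <= lam * cabs z0 by rewrite mulr_ge0 ?cabs_ge0// ltW.
have lC0 : lam%:C != 0 :> Cx R by rewrite -cabs_gt0 cabs_real gtr0_norm.
have d20 : 0 < d / 2 by rewrite divr_gt0.
apply: (cone_volume hg psh hn lam0 d20) => [w wz|]; last exact: Hl.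
apply/ltW; apply: Hd.
  have -> : (w, lam%:C).1 - (0 : Cx2 R).1 = w by rewrite subr0.
  have := cabs_triangle w (lam%:C * z0) 0.
  by rewrite !subr0 cabsM cabs_real (gtr0_norm lam0); lra.
have -> : (w, lam%:C).2 - (0 : Cx2 R).2 = lam%:C by rewrite subr0.
by rewrite cabs_real (gtr0_norm lam0); lra.
Qed.

Lemma lelong_sector_volume (M : R) :
  (forall v1 v2 : Cx R, v2 != 0 ->
    (lelong (fun l => log_gauge h (l, v2)) v1 < (1 / 2)%:E)%E) ->
  exists W, [/\ open W, (volume W < +oo)%E &
    forall z, balanced_domain h z -> z.2 != 0 -> cabs z.1 <= M * cabs z.2 -> W z].
Proof.
move=> Hl; pose K := [set w : Cx R | 0 <= cabs (w - 0) <= M].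
(* Open supersets are glued rather than the pieces themselves, so that unions stay open and
   subadditivity applies. *)
pose Pr (U : set (Cx R)) := exists W, [/\ open W, (volume W < +oo)%E &
  forall z, balanced_domain h z -> z.2 != 0 -> U (z.1 / z.2) -> W z].
have : Pr K.
  apply: (compact_local_to_global (@compact_annulus R 0 0 M)).
  - exists set0; split=> //.
    by rewrite /volume preimage_set0 measure0.
  - by move=> A B AB [W [oW vW HW]]; exists W; split => // z hz z2 /AB; exact: HW.
  - move=> A B [W [oW vW HW]] [W' [oW' vW' HW']]; exists (W `|` W'); split.
    + exact: openU.
    + exact: volumeU_fin.
    + by move=> z hz z2 [H|H]; [left; exact: HW|right; exact: HW'].
  move=> x _; have [d d0 vd] := lelong_cone_volume (z0 := x) (fun v2 => Hl (v2 * x) v2).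
  exists (disc x d).
    by apply/nbhs_CxP; exists d.
  exists (balanced_domain h `&` cone x d); split => //.
    by apply: openI; [exact: open_balanced_domain|exact: open_cone (ltW d0)].
  move=> z hz z2 [_ zd]; split => //; rewrite /cone/mkset.
  have -> : z.1 - x * z.2 = (z.1 / z.2 - x) * z.2 by rewrite mulrBl mulfVK.
  by rewrite cabsM ltr_pM2r ?cabs_gt0.
move=> [W [oW vW HW]]; exists W; split => // z hz z2 zM; apply: HW => //.
rewrite /K/mkset subr0 cabs_ge0/= cabsM ComplexField.Normc.normcV.
by rewrite ler_pdivrMr ?cabs_gt0.
Qed.

End finite_volume.

(** The direction [1 : 0] is missing from the chart z2 != 0. After the exchange of coordinates one
    cone around it leaves the compact set of directions |z1| <= |z2| / lam. The origin lies in no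
    cone and is covered by a bidisc. *)
Lemma lelong_volume_finite (R : realType) (h : Cx2 R -> R) :
  balanced_gauge h -> balanced_pseudoconvex h -> (exists z, h z != 0) ->
  (forall v : Cx2 R, v != 0 -> (lelong_proj h v < (1 / 2)%:E)%E) ->
  (volume (balanced_domain h) < +oo)%E.
Proof.
move=> hg psh hn Hl.
have Hl1 v1 v2 : v2 != 0 -> (lelong (fun l => log_gauge h (l, v2)) v1 < (1 / 2)%:E)%E.
  move=> v20; have := Hl (v1, v2); rewrite /lelong_proj v20; apply.
  by apply: contraNneq v20 => -[_ ->].
have hn' : exists z, swap_gauge h z != 0.
  by have [[z1 z2] hz] := hn; exists (z2, z1).
have [lam lam0 Hlam] : exists2 d : R, 0 < d &
    (volume (balanced_domain (swap_gauge h) `&` cone 0%R d) < +oo)%E.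
  apply: (lelong_cone_volume (swap_balanced hg) (swap_pseudoconvex psh) hn') => v v0.
  have := Hl (v, 0); rewrite /lelong_proj mulr0 eqxx; apply.
  by apply: contraNneq v0 => -[->].
have oS : open (balanced_domain (swap_gauge h) `&` cone 0 lam).
  apply: openI; last exact: open_cone (ltW lam0).
  by apply: open_balanced_domain; exact: swap_balanced.
have oS' : open [set z : Cx2 R | (balanced_domain (swap_gauge h) `&` cone 0 lam) (z.2, z.1)].
  by move: oS; apply: open_comp => z _; exact: swap_continuous2.
have [W1 [oW1 W10 vW1]] := volume_bidisc_fin R.
have [W2 [oW2 vW2 HW2]] := lelong_sector_volume hg psh hn lam^-1 Hl1.
apply: (@le_lt_trans _ _ (volume (W1 `|` W2 `|` 
   [set z : Cx2 R | (balanced_domain (swap_gauge h) `&` cone 0 lam) (z.2, z.1)]))).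
  apply: le_volume; [exact: open_balanced_domain|by do !apply: openU|].
  move=> z hz.
  have [zl|zl] := ltP (cabs z.2) (lam * cabs z.1).
    right; split; first by case: z hz {zl}.
    by rewrite /cone/mkset/fst/snd mul0r subr0.
  left; have [z20|z20] := eqVneq z.2 0; last first.
    by right; apply: HW2 => //; rewrite ler_pdivlMl.
  left; move: zl; rewrite z20 cabs0 pmulr_rle0// => z1.
  have z10 : z.1 = 0 by apply/eqP; rewrite -cabs_eq0; apply/eqP/le_anti; rewrite z1 cabs_ge0.
  by have -> : z = 0 by case: z {hz z1} z10 z20 => x y /= -> ->.
rewrite -(swap_volume oS) in Hlam.
exact: (volumeU_fin (openU oW1 oW2) oS' (volumeU_fin oW1 oW2 vW1 vW2) Hlam).
Qed.

Theorem corollary12 (R : realType) (h : Cx2 R -> R)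
    (h_gauge : balanced_gauge h)
    (h_psc : balanced_pseudoconvex h)
    (h_neq0 : exists z, h z != 0) :
  [<-> (0 < bergman_kernel (balanced_domain h) 0%R)%E;
       forall z, balanced_domain h z ->
         (0 < bergman_kernel (balanced_domain h) z)%E;
       (volume (balanced_domain h) < +oo)%E;
       forall v : Cx2 R, v != 0 -> (lelong_proj h v < (1 / 2)%:E)%E].
Proof.
tfae.
- by move=> /(bergman_volume h_gauge) vfin z _; exact: volume_bergman.
- move=> /(_ 0) K0; apply: (bergman_volume h_gauge); apply: K0.
  by rewrite /balanced_domain/mkset gauge0// ltr01.
- move=> vfin [v1 v2] v0; rewrite /lelong_proj; apply: contrapT => nl.
  move: vfin; case: ifPn nl => [v20|/negbNE/eqP v20]/= nl.
    by rewrite (lelong_volume_infinite h_gauge h_psc h_neq0 v20 nl).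
  simpl in v20; rewrite v20 in nl v0.
  have v10 : v1 != 0 by apply: contraNneq v0 => ->.
  have hn' : exists z, swap_gauge h z != 0.
    by have [[z1 z2] hz] := h_neq0; exists (z2, z1).
  rewrite -(swap_volume (open_balanced_domain h_gauge)).
  by rewrite [X in volume X](_ : _ = balanced_domain (swap_gauge h))//
   (lelong_volume_infinite (swap_balanced h_gauge) (swap_pseudoconvex h_psc) hn' v10 nl).
- by move=> /(lelong_volume_finite h_gauge h_psc h_neq0) vfin; exact: volume_bergman.
Qed.
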